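(* There exist polynomials $n_0(\cdot)$ and $m_0(\cdot)$ such that for all integers $t \ge 1$, $n \ge n_0(t)$, $m \ge m_0(t)$ the following holds. If $\mathcal{F} \subset [m]^n$ is $(t-1)$-avoiding, then $|\mathcal{F}| \le m^{n-t}$, and equality holds if and only if $\mathcal{F} = \{x \in [m]^n : x_T = z\}$ for some $T \subset [n]$ of size $t$ and some $z \in [m]^T$.
   Context: Here $[m]=\{1,\dots,m\}$. For $x,y \in [m]^n$, the agreement is $\operatorname{agr}(x,y) = |\{i \in [n] : x_i = y_i\}|$. A family $\mathcal{F} \subset [m]^n$ is called $(t-1)$-avoiding if $\operatorname{agr}(x,y) \ne t-1$ for all $x,y \in \mathcal{F}$. For $x\in[m]^n$ and $T \subset [n]$, $x_T \in [m]^T$ denotes the restriction of $x$ to the coordinates in $T$. *)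

(* Defs.v *)
From HB Require Import structures.
From mathcomp Require Import all_boot all_order all_algebra.

Set Implicit Arguments.
Unset Strict Implicit.
Unset Printing Implicit Defensive.

(* The alphabet {1, ..., m} and the coordinate set {1, ..., n} are represented
   by 'I_m and 'I_n (a relabelling by a shift of one), so [m]^n becomes
   {ffun 'I_n -> 'I_m}. *)
Notation word m n := {ffun 'I_n -> 'I_m}.

Definition agr (m n : nat) (x y : word m n) : nat :=
  #|[set i : 'I_n | x i == y i]|.

Definition avoiding (s m n : nat) (F : {set word m n}) : Prop :=
  forall x y : word m n, x \in F -> y \in F -> agr x y <> s.

(* [m]^T, for a set T of coordinates. *)
Notation subword m T := {ffun {i | i \in T} -> 'I_m}.

Definition restr (m n : nat) (T : {set 'I_n}) (x : word m n) : subword m T :=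
  [ffun i : {i | i \in T} => x (val i)].

(* Main.v *)
(* All densities are taken in the uniform distribution on words, and one has to
   show that [F] has density at most [1 / m ^ t].

   Suppose first that [F] fills a cube of codimension [t] up to a small proportion
   [d].  Fix many disjoint blocks of the other coordinates.  A word of [F] outside
   the cube agrees with its labels in fewer than [t] places, so in each block the
   avoidance hypothesis and an isoperimetric inequality for pairs of words with
   no agreement make such words extremely rare compared with [d]; hence the cube
   is the unique optimum.

   It remains to find this cube when [F] has density at least [1 / m ^ t].  Both
   arguments cut [F] greedily into pieces, each living in a cube on whose
   remaining coordinates it is global: restricting [s] more coordinates raises
   its density by at most [K ^ s].

   If [m] is at most [n ^ poly(t)], then [n] exceeds a large power of [t log m].
   Hypercontractivity for global functions shows that two pieces whose labels
   agree in fewer than [t] places contain words that agree in exactly [t - 1]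
   places.  So all labels agree pairwise in at least [t] places, which leaves room
   for only one cube of codimension [t].

   If [m] is larger, a second moment argument replaces hypercontractivity: if two
   pieces are made to agree in [t - 1] places, then avoidance forces one more
   agreement, an event of probability at most [n / m].  Hence a family with small
   density in every cube of codimension [t] is negligible, and among the
   remaining cubes any two nearly exclude each other while having almost
   independent indicators, so one of them has density close to 1. *)

Require Import Defs.
From HB Require Import structures.
From mathcomp Require Import all_boot all_order all_algebra.
From mathcomp Require Import zify ring lra.

Set Implicit Arguments.
Unset Strict Implicit.
Unset Printing Implicit Defensive.

Import Order.TTheory GRing.Theory Num.Theory.

Local Open Scope ring_scope.

(** * Averages over sets of coordinates *)

Section Averages.
Variables (R : realFieldType) (m n : nat).
Hypothesis m_gt0 : (0 < m)%N.
Local Notation word := {ffun 'I_n -> 'I_m}.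
Implicit Types (f g u v : word -> R) (x y z : word) (J A S U : {set 'I_n}).

(** All averages run over full words, and restriction to a subcube is overwriting by [mix]. No
    subcube becomes a type of its own; a function on it is a function that ignores the fixed
    coordinates. Only an ordered field is assumed, so norms appear as even powers, Hölder's
    inequality as a tangent line, roots and logarithms as integer approximations.

    The remainder of the greedy cutting must be small against [1 / m ^ t], so cutting stops at
    density [1 / m ^ (t + 1)]. With globality constant [K] a piece may then fix about
    [t * log m / log K] coordinates, and this number shapes both regimes. The hypercontractive
    argument takes [K = 2]: the [O(t * log m)] fixed coordinates are harmless once they are few
    against [n] and [m]. The second moment argument pays a factor of order [n] per fixed coordinate
    when it sums over supports. There [K] is a power [m ^ (1 / O(t))] of the alphabet size, which
    leaves [O(t ^ 2)] fixed coordinates, and the cost is outweighed once [m] exceeds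
    [(4 n) ^ O(t ^ 3)]. *)

Definition mix J x y : word := [ffun i => if i \in J then y i else x i].

Lemma mixE J x y i : mix J x y i = if i \in J then y i else x i.
Proof. by rewrite ffunE. Qed.

Definition E f : R := (m ^ n)%:R^-1 * \sum_x f x.

(** Conditional expectation given the coordinates outside [J], kept as a function on full words. *)
Definition Av J f x : R := E (fun y => f (mix J x y)).

Definition indep J f := forall x y, f (mix J x y) = f x.

Lemma word_count_gt0 : 0 < (m ^ n)%:R :> R.
Proof. by rewrite ltr0n expn_gt0 m_gt0. Qed.

Lemma eq_E f g : (forall x, f x = g x) -> E f = E g.
Proof. by move=> fg; rewrite /E; congr (_ * _); apply: eq_bigr. Qed.

Lemma eq_Av J f g x : (forall y, f y = g y) -> Av J f x = Av J g x.
Proof. by move=> fg; apply: eq_E => y; apply: fg. Qed.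

Lemma E_cst c : E (fun=> c) = c.
Proof.
rewrite /E sumr_const card_ffun !card_ord -[c *+ _]mulr_natl mulrA mulVf ?mul1r //.
by rewrite gt_eqF ?word_count_gt0.
Qed.

Lemma E_add f g : E (fun x => f x + g x) = E f + E g.
Proof. by rewrite /E big_split mulrDr. Qed.

Lemma E_scale c f : E (fun x => c * f x) = c * E f.
Proof. by rewrite /E -mulr_sumr mulrCA. Qed.

Lemma E_scaler c f : E (fun x => f x * c) = E f * c.
Proof. by rewrite mulrC -E_scale; apply: eq_E => x; rewrite mulrC. Qed.

Lemma E_opp f : E (fun x => - f x) = - E f.
Proof. by rewrite -mulN1r -E_scale; apply: eq_E => x; rewrite mulN1r. Qed.

Lemma E_sub f g : E (fun x => f x - g x) = E f - E g.
Proof. by rewrite E_add E_opp. Qed.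

Lemma E_sum (I : Type) (r : seq I) (P : pred I) (F : I -> word -> R) :
  E (fun x => \sum_(i <- r | P i) F i x) = \sum_(i <- r | P i) E (F i).
Proof. by rewrite /E exchange_big mulr_sumr. Qed.

Lemma E_le f g : (forall x, f x <= g x) -> E f <= E g.
Proof.
by move=> fg; rewrite ler_pM2l ?invr_gt0 ?word_count_gt0 //; apply: ler_sum.
Qed.

Lemma E_ge0 f : (forall x, 0 <= f x) -> 0 <= E f.
Proof. by move=> f0; rewrite -(E_cst 0); apply: E_le. Qed.

Lemma E_gt0_ex f : 0 < E f -> exists x, 0 < f x.
Proof.
move=> Ef; apply/existsP; apply: contraTT Ef; rewrite negb_exists => /forallP h.
by rewrite -leNgt -(E_cst 0); apply: E_le => x; rewrite leNgt h.
Qed.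

(** Exchanging the coordinates in [J] between two words is an involution on pairs of words, hence
    preserves the uniform measure. Invariance of [E] under [Av] and self-adjointness of [Av] both
    come from this. *)
Lemma EE_swap J (F : word -> word -> R) :
  E (fun x => E (fun y => F (mix J x y) (mix J y x))) = E (fun x => E (F x)).
Proof.
rewrite /E -!mulr_sumr; congr (_ * (_ * _)).
rewrite !pair_bigA /=.
pose h (p : word * word) := (mix J p.1 p.2, mix J p.2 p.1).
have hK : involutive h.
  by case=> x y; congr pair; apply/ffunP => i; rewrite /= !mixE; case: (i \in J).
by rewrite [RHS](reindex_inj (inv_inj hK)).
Qed.

Lemma mix_id J x y : mix J (mix J x y) (mix J y x) = x.
Proof. by apply/ffunP => i; rewrite !mixE; case: (i \in J). Qed.

Lemma E_Av J f : E (Av J f) = E f.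
Proof.
rewrite /Av (EE_swap J (fun x _ => f x)).
by apply: eq_E => x; rewrite E_cst.
Qed.

Lemma Av_Av J J' f x : Av J (Av J' f) x = Av (J :|: J') f x.
Proof.
rewrite /Av -[RHS](E_Av J' (fun z => f (mix (J :|: J') x z))) /Av.
apply: eq_E => y; apply: eq_E => z; congr f; apply/ffunP => i.
by rewrite !mixE !inE; case: (i \in J); case: (i \in J').
Qed.

Lemma E_mul_Av J f g : E (fun x => f x * Av J g x) = E (fun x => Av J f x * g x).
Proof.
rewrite /Av.
transitivity (E (fun x => E (fun y => f x * g (mix J x y)))).
  by apply: eq_E => x; rewrite E_scale.
transitivity (E (fun x => E (fun y => f (mix J x y) * g x))); last first.
  by apply: eq_E => x; rewrite E_scaler.
rewrite -[LHS](EE_swap J).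
by apply: eq_E => x; apply: eq_E => y; rewrite mix_id.
Qed.

Lemma Av_add J f g x : Av J (fun x => f x + g x) x = Av J f x + Av J g x.
Proof. exact: E_add. Qed.
Lemma Av_sub J f g x : Av J (fun x => f x - g x) x = Av J f x - Av J g x.
Proof. exact: E_sub. Qed.
Lemma Av_scale J c f x : Av J (fun x => c * f x) x = c * Av J f x.
Proof. exact: E_scale. Qed.
Lemma Av_cst J c x : Av J (fun=> c) x = c.
Proof. exact: E_cst. Qed.
Lemma Av_sum (I : Type) (r : seq I) (P : pred I) (F : I -> word -> R) J x :
  Av J (fun x => \sum_(i <- r | P i) F i x) x = \sum_(i <- r | P i) Av J (F i) x.
Proof. exact: E_sum. Qed.
Lemma Av_le J f g x : (forall x, f x <= g x) -> Av J f x <= Av J g x.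
Proof. by move=> fg; apply: E_le => y. Qed.
Lemma Av_ge0 J f x : (forall x, 0 <= f x) -> 0 <= Av J f x.
Proof. by move=> fg; apply: E_ge0 => y. Qed.
Lemma Av_le_cst J f c x : (forall x, f x <= c) -> Av J f x <= c.
Proof. by move=> fg; rewrite -(Av_cst J c x); apply: Av_le. Qed.

Lemma mix_mix J x y z : mix J (mix J x y) z = mix J x z.
Proof. by apply/ffunP => i; rewrite !mixE; case: (i \in J). Qed.

Lemma mix_set0 x y : mix set0 x y = x.
Proof. by apply/ffunP => i; rewrite mixE inE. Qed.

Lemma mix_setT x y : mix setT x y = y.
Proof. by apply/ffunP => i; rewrite mixE inE. Qed.

Lemma mixC J x y : mix (~: J) x y = mix J y x.
Proof. by apply/ffunP => i; rewrite !mixE inE; case: (i \in J). Qed.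

Lemma Av_set0 f x : Av set0 f x = f x.
Proof.
by rewrite /Av -[RHS]E_cst; apply: eq_E => y; rewrite mix_set0.
Qed.

Lemma Av_setT f x : Av setT f x = E f.
Proof. by apply: eq_E => y; rewrite mix_setT. Qed.

Lemma indep_Av J f : indep J (Av J f).
Proof. by move=> x y; apply: eq_E => z; rewrite mix_mix. Qed.

Lemma indepS J A f : A \subset J -> indep J f -> indep A f.
Proof.
move=> AJ fJ x y; rewrite -[RHS](fJ x y) -[LHS](fJ _ y); congr f.
apply/ffunP => i; rewrite !mixE; case: ifP => // /negP iJ.
by case: ifP => // /(subsetP AJ).
Qed.

Lemma indep_AvS J A f : A \subset J -> indep A (Av J f).
Proof. by move=> AJ; apply: indepS AJ (@indep_Av J f). Qed.

Lemma Av_indep_mul J u f x : indep J u -> Av J (fun x => u x * f x) x = u x * Av J f x.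
Proof. by move=> uJ; rewrite -Av_scale; apply: eq_E => y; rewrite uJ. Qed.

Lemma Av_indep J u x : indep J u -> Av J u x = u x.
Proof. by move=> uJ; rewrite -[RHS](Av_cst J _ x); apply: eq_E => y; rewrite uJ. Qed.

Lemma Av_indep_keep J A f : indep A f -> indep A (Av J f).
Proof.
move=> fA x y; apply: eq_E => z.
rewrite -(fA (mix J x z) (mix J y z)); congr f.
by apply/ffunP => i; rewrite !mixE; case: (i \in J) => //=; rewrite if_same.
Qed.

Lemma E_indep_mul J u v : indep J u -> indep (~: J) v ->
  E (fun x => u x * v x) = E u * E v.
Proof.
move=> uJ vJ; rewrite -(E_Av J) -E_scaler.
apply: eq_E => x; rewrite (Av_indep_mul _ _ uJ); congr (_ * _).
by apply: eq_E => y; rewrite -mixC vJ.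
Qed.

(** Cauchy-Schwarz by Lagrange's identity: the double average of [(f x * g y - f y * g x) ^+ 2] is
    twice the difference of the two sides. *)
Lemma EE_CS (f g : word -> R) : (E (fun x => f x * g x)) ^+ 2 <= E (fun x => f x ^+ 2) * E (fun x => g x ^+ 2).
Proof.
have : 0 <= E (fun x => E (fun y => (f x * g y - f y * g x) ^+ 2)).
  by apply: E_ge0 => x; apply: E_ge0 => y; rewrite sqr_ge0.
have -> : E (fun x => E (fun y => (f x * g y - f y * g x) ^+ 2)) =
  E (fun x => E (fun y => f x ^+ 2 * g y ^+ 2 + f y ^+ 2 * g x ^+ 2 -
     2 * (f x * g x) * (f y * g y))).
  by apply: eq_E => x; apply: eq_E => y; ring.
under eq_E do rewrite E_sub E_add !E_scale E_scaler.
rewrite E_sub E_add !E_scaler !E_scale.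
set a := E (fun x => f x ^+ 2); set b := E (fun x => g x ^+ 2); set c := E _.
by move=> h; nra.
Qed.

Lemma Av_CS J f g x : (Av J (fun x => f x * g x) x) ^+ 2 <= Av J (fun x => f x ^+ 2) x * Av J (fun x => g x ^+ 2) x.
Proof. exact: EE_CS. Qed.

Lemma Av_sqr_le J f x : (Av J f x) ^+ 2 <= Av J (fun x => f x ^+ 2) x.
Proof.
have := Av_CS J f (fun=> 1) x.
rewrite Av_cst; under eq_Av do rewrite mulr1.
by rewrite expr1n mulr1.
Qed.

End Averages.

(** * Tensor products of operators acting on single letters *)

Section ProductOperators.
Variables (R : realFieldType) (m n : nat).
Hypothesis m_gt0 : (0 < m)%N.
Local Notation word := {ffun 'I_n -> 'I_m}.
Implicit Types (f g u v : word -> R) (x y z : word) (J A S U : {set 'I_n}).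
Implicit Types (a b c : R) (al be : 'I_n -> R).

Let m_neq0 : m%:R != 0 :> R.
Proof. by rewrite pnatr_eq0 -lt0n. Qed.

(** Combination of the identity and the all-ones matrix with eigenvalue [a] on constants and [b] on
    mean-zero functions of one letter. Composition therefore multiplies the parameters
    ([ker_comp]). *)
Definition ker a b (c d : 'I_m) : R := (a - b) / m%:R + b * (c == d)%:R.

(* The operator acting on coordinate [i] as [al i] on constants and as [be i]
   on mean-zero functions. *)
Definition Op al be f x : R :=
  \sum_(y : word) (\prod_i ker (al i) (be i) (x i) (y i)) * f y.

Lemma ker_comp a b a' b' (c d : 'I_m) :
  \sum_e ker a b c e * ker a' b' e d = ker (a * a') (b * b') c d.
Proof.
rewrite /ker.
transitivity (\sum_(e : 'I_m) ((a - b) / m%:R * ((a' - b') / m%:R) +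
   (a - b) / m%:R * b' * (e == d)%:R + (a' - b') / m%:R * b * (c == e)%:R
   + b * b' * ((c == e)%:R * (e == d)%:R))).
  by apply: eq_bigr => e _; ring.
rewrite !big_split /= sumr_const card_ord -!mulr_sumr.
rewrite (bigD1 d) //= eqxx big1 => [|e /negPf-> //].
rewrite (bigD1 c) //= eqxx big1 => [|e]; last by rewrite eq_sym => /negPf->.
rewrite (bigD1 c) //= eqxx big1 => [|e]; last first.
  by rewrite eq_sym => /negPf->; rewrite mul0r.
rewrite -[_ *+ m]mulr_natl (_ : true%:R = 1) //; field.
exact: m_neq0.
Qed.

Lemma eq_Op al be al' be' f g x :
  (forall i, al i = al' i) -> (forall i, be i = be' i) ->
  (forall y, f y = g y) -> Op al be f x = Op al' be' g x.
Proof.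
move=> ha hb hf; apply: eq_bigr => y _; rewrite hf; congr (_ * _).
by apply: eq_bigr => i _; rewrite ha hb.
Qed.

Lemma Op_comp al be al' be' f x :
  Op al be (Op al' be' f) x =
  Op (fun i => al i * al' i) (fun i => be i * be' i) f x.
Proof.
rewrite /Op; under eq_bigr do rewrite mulr_sumr.
rewrite exchange_big; apply: eq_bigr => z _ /=.
under eq_bigr do rewrite mulrA.
rewrite -mulr_suml; congr (_ * _).
under [RHS]eq_bigr do rewrite -ker_comp.
rewrite bigA_distr_bigA; apply: eq_bigr => y _.
by rewrite big_split.
Qed.

(** Distributivity of a tensor product of sums. The expansions [Op_expand] and [L_T_expand] are two
    choices of how to split the eigenvalues of each factor. *)
Lemma Op_set al be al' be' f x :
  Op (fun i => al i + al' i) (fun i => be i + be' i) f x =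
  \sum_(S : {set 'I_n}) Op (fun i => if i \in S then al i else al' i)
                       (fun i => if i \in S then be i else be' i) f x.
Proof.
rewrite /Op exchange_big; apply: eq_bigr => y _ /=.
rewrite -mulr_suml; congr (_ * _).
transitivity (\prod_i (ker (al i) (be i) (x i) (y i) + ker (al' i) (be' i) (x i) (y i))).
  by apply: eq_bigr => i _; rewrite /ker; ring.
rewrite bigA_distr; apply: eq_bigr => S _; apply: eq_bigr => i _.
by case: ifP.
Qed.

Lemma Op_scale (c : 'I_n -> R) al be f x :
  Op (fun i => c i * al i) (fun i => c i * be i) f x = \prod_i c i * Op al be f x.
Proof.
rewrite /Op mulr_sumr; apply: eq_bigr => y _; rewrite mulrA -big_split /=.
by congr (_ * _); apply: eq_bigr => i _; rewrite /ker; ring.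
Qed.

Lemma Op_0 i al be f x : al i = 0 -> be i = 0 -> Op al be f x = 0.
Proof.
move=> ha hb; rewrite /Op big1 // => y _.
by rewrite (bigD1 i) //= ha hb /ker subrr !mul0r addr0 !mul0r.
Qed.

Lemma Op_linear1 j (s t : R) al be al1 be1 al2 be2 f x :
  (forall i, i != j -> (al1 i = al i) * (be1 i = be i) * (al2 i = al i) * (be2 i = be i)) ->
  al j = s * al1 j + t * al2 j -> be j = s * be1 j + t * be2 j ->
  Op al be f x = s * Op al1 be1 f x + t * Op al2 be2 f x.
Proof.
move=> hj ha hb; rewrite /Op !mulr_sumr -big_split; apply: eq_bigr => y _ /=.
rewrite (bigD1 j) //= [X in s * (X * _)](bigD1 j) //= [X in t * (X * _)](bigD1 j) //=.
have -> : \prod_(i < n | i != j) ker (al1 i) (be1 i) (x i) (y i) =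
       \prod_(i < n | i != j) ker (al i) (be i) (x i) (y i).
  by apply: eq_bigr => i ij; rewrite !hj.
have -> : \prod_(i < n | i != j) ker (al2 i) (be2 i) (x i) (y i) =
       \prod_(i < n | i != j) ker (al i) (be i) (x i) (y i).
  by apply: eq_bigr => i ij; rewrite !hj.
by rewrite ha hb /ker; ring.
Qed.

Lemma prod_delta (x y : word) : \prod_i (x i == y i)%:R = (x == y)%:R :> R.
Proof.
case: eqP => [->|/eqP xy]; first by rewrite big1 // => i _; rewrite eqxx.
have [i xyi] : exists i, x i != y i.
  apply/existsP; apply: contraNT xy; rewrite negb_exists => /forallP h.
  by apply/eqP/ffunP => i; apply/eqP; have := h i; rewrite negbK.
by rewrite (bigD1 i) //= (negPf xyi) mul0r.
Qed.

Lemma E_prod (h : 'I_n -> 'I_m -> R) :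
  E (fun y => \prod_i h i (y i)) = \prod_i (m%:R^-1 * \sum_c h i c).
Proof.
rewrite big_split /= prodr_const card_ord bigA_distr_bigA /E.
by rewrite natrX exprVn.
Qed.

Lemma AvE J f x : Av J f x = Op (fun=> 1) (fun i => (i \notin J)%:R) f x.
Proof.
transitivity (E (fun y => \sum_(z : word) (mix J x y == z)%:R * f z)).
  apply: eq_E => y; rewrite (bigD1 (mix J x y)) //= eqxx mul1r big1 ?addr0 //.
  by move=> z; rewrite eq_sym => /negPf->; rewrite mul0r.
rewrite E_sum; apply: eq_bigr => z _; rewrite E_scaler; congr (_ * _).
under eq_E do rewrite -prod_delta; under eq_E do under eq_bigr do rewrite mixE.
rewrite (E_prod (fun i (c : 'I_m) => ((if i \in J then c else x i) == z i)%:R)).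
apply: eq_bigr => i _; rewrite /ker; case: (boolP (i \in J)) => _ /=.
  rewrite subr0 mul0r addr0 mul1r (bigD1 (z i)) //= eqxx big1 ?addr0 ?mulr1 //.
  by move=> c /negPf->.
by rewrite subrr mul0r add0r mul1r sumr_const card_ord -[X in _ * X]mulr_natl mulKf.
Qed.

Lemma ker_sym a b (c d : 'I_m) : ker a b c d = ker a b d c.
Proof. by rewrite /ker eq_sym. Qed.

(** The one-letter kernels are symmetric, and outside [J] both the averaging kernel and the operator
    are the identity. So an operator acting only on [J] is self-adjoint for the inner product over
    [J] with the other coordinates frozen. *)
Lemma Av_mul_Op J al be f g x :
  (forall i, i \notin J -> al i = 1) -> (forall i, i \notin J -> be i = 1) ->
  Av J (fun y => f y * Op al be g y) x = Av J (fun y => Op al be f y * g y) x.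
Proof.
move=> ha hb; rewrite !AvE /Op.
transitivity (\sum_(y : word) \sum_(z : word) \prod_i ker 1 (i \notin J)%:R (x i) (y i) *
   (\prod_i ker (al i) (be i) (y i) (z i)) * (f y * g z)).
  apply: eq_bigr => y _; rewrite !mulr_sumr.
  by apply: eq_bigr => z _; rewrite !mulrA; ring.
rewrite exchange_big /=; apply: eq_bigr => y _.
rewrite mulr_suml mulr_sumr; apply: eq_bigr => z _.
rewrite mulrA [RHS](_ : _ = \prod_i ker 1 (i \notin J)%:R (x i) (y i) *
   (\prod_i ker (al i) (be i) (y i) (z i)) * (f z * g y)); last by ring.
rewrite -!mulrA; rewrite !mulrA -!big_split /= ; do 2 congr (_ * _).
apply: eq_bigr => i _; case: (boolP (i \in J)) => iJ /=.
  by rewrite [ker (al i) _ _ _]ker_sym /ker; congr (_ * _); rewrite !mul0r.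
rewrite ha // hb // /ker subrr !mul0r !add0r !mul1r -!natrM; congr (_%:R).
by have [->//|yz] := eqVneq (y i) (z i); rewrite !muln0.
Qed.

(* [T J c] is the noise operator of correlation [c] on [J]; [L S] keeps the part
   of a function with mean zero in each coordinate of [S]; inside [J], [P J U]
   projects onto the Efron-Stein component of [U]. *)
Definition T J c := Op (fun=> 1) (fun i => if i \in J then c else 1).
Definition L S := Op (fun i => (i \notin S)%:R) (fun=> 1).
Definition P J U := Op (fun i => (i \notin U)%:R) (fun i => (i \notin J :\: U)%:R).
End ProductOperators.

(** * Power inequalities for real numbers *)

Section PowerInequalities.
Variable R : realFieldType.

Lemma bernoulli (x : R) k : -1 <= x -> 1 + k%:R * x <= (1 + x) ^+ k.
Proof.
move=> x1; elim: k => [|k IH]; first by rewrite mul0r addr0 expr0.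
rewrite exprS -natr1; have k0 : 0 <= k%:R :> R by [].
have : (1 + x) * (1 + k%:R * x) <= (1 + x) * (1 + x) ^+ k.
  by apply: ler_wpM2l => //; lra.
by move=> h; apply: le_trans h; have := sqr_ge0 x; nra.
Qed.

Lemma bernoulli_scaled (a y : R) k : 0 <= a -> 0 <= y ->
  a ^+ k + k%:R * a ^+ k.-1 * y <= (a + y) ^+ k.
Proof.
move=> a0 y0; case: k => [|k]; first by rewrite !expr0 !mul0r addr0.
elim: k => [|k IH]; first by rewrite !expr1 expr0 mulr1 mul1r.
rewrite [leRHS]exprS; apply: le_trans (ler_wpM2l (addr_ge0 a0 y0) IH).
rewrite -subr_ge0 /= (_ : _ - _ = k.+1%:R * a ^+ k * y ^+ 2).
  by rewrite !mulr_ge0 ?exprn_ge0.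
by rewrite -[k.+2%:R]natr1 !exprS; ring.
Qed.

(** Convexity of an even power, as the graph lying above its tangent at [c]. For [c] nonzero,
    Bernoulli is applied to [(h / c) ^+ 2]. *)
Lemma even_pow_tangent (c h : R) p :
  c ^+ (2 * p) + (2 * p)%:R * c ^+ (2 * p).-1 * (h - c) <= h ^+ (2 * p).
Proof.
have [->|c0] := eqVneq c 0.
  case: p => [|p]; first by rewrite !expr0 !mul0r addr0.
  have -> : (2 * p.+1 = (2 * p).+2)%N by lia.
  rewrite /= !exprS !mul0r mulr0 mul0r addr0 mulrA -expr2 mulr_ge0 ?sqr_ge0 //.
  by rewrite exprM exprn_ge0 // sqr_ge0.
case: p => [|p]; first by rewrite !expr0 !mul0r addr0.
pose x := (h - c) / c.
have -> : h = c * (1 + x) by rewrite /x; field.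
have -> : c * (1 + x) - c = c * x by ring.
have -> : c ^+ (2 * p.+1) + (2 * p.+1)%:R * c ^+ (2 * p.+1).-1 * (c * x) =
  c ^+ (2 * p.+1) * (1 + (2 * p.+1)%:R * x).
  have -> : (2 * p.+1 = (2 * p).+2)%N by lia.
  by rewrite /= !exprS; ring.
rewrite exprMn ler_wpM2l //; first by rewrite exprM exprn_ge0 // sqr_ge0.
rewrite exprM; apply: le_trans (_ : 1 + p.+1%:R * ((1 + x) ^+ 2 - 1) <= _).
  rewrite natrM; have : 0 <= p.+1%:R :> R by [].
  by have := sqr_ge0 x; set k := p.+1%:R; nra.
by rewrite -[X in X ^+ p.+1](_ : 1 + ((1 + x) ^+ 2 - 1) = _) ?bernoulli //;
  have := sqr_ge0 (1 + x); lra.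
Qed.

(** [(1 + d / a) ^+ k] exceeds its first-order expansion by at most [(k d / a) ^+ 2] while
    [p |d| <= a]; stated after multiplication by [a ^+ (k + 2)], which avoids division. *)
Lemma pow_quadratic (a d : R) p k : 0 <= a -> - a <= p%:R * d -> p%:R * d <= a ->
  (k <= p)%N ->
  (a + d) ^+ k * a ^+ 2 <= a ^+ k * (a ^+ 2 + k%:R * a * d + k%:R ^+ 2 * d ^+ 2).
Proof.
move=> a0 h1 h2; elim: k => [|k IH] kp; first by rewrite !expr0; lra.
have {}IH := IH (ltnW kp).
have kpR : k%:R + 1 <= p%:R :> R by rewrite natr1 ler_nat.
have k0 : 0 <= k%:R :> R by [].
have ad : 0 <= a + d.
  have [d0|d0] := leP 0 d; first lra.
  by nra.
rewrite exprS -mulrA; apply: le_trans (ler_wpM2l ad IH) _.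
rewrite [a ^+ k.+1]exprS -natr1 [X in X <= _](_ : _ = a ^+ k * ((a + d) * (a ^+ 2 + k%:R * a * d + k%:R ^+ 2 * d ^+ 2))); last by ring.
rewrite [X in _ <= X](_ : _ = a ^+ k * (a * (a ^+ 2 + (k%:R + 1) * a * d + (k%:R + 1) ^+ 2 * d ^+ 2))); last by ring.
apply: ler_wpM2l; first exact: exprn_ge0.
rewrite -subr_ge0 (_ : _ - _ = d ^+ 2 * ((k%:R + 1) * a - k%:R ^+ 2 * d)); last by ring.
apply: mulr_ge0; first exact: sqr_ge0.
have [d0|d0] := leP d 0; first by have := sqr_ge0 (k%:R : R); nra.
have : k%:R * d <= a by nra.
move=> h; have := ler_wpM2l k0 h.
rewrite expr2; lra.
Qed.

(* One-coordinate hypercontractive estimate, with [a], [c], [y] standing for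
   [|u|^2], [<u, v>], [|v|^2]. *)
Lemma two_point_estimate (a y c rho : R) p : (0 < p)%N -> 0 <= a -> 0 <= y ->
  c ^+ 2 <= a * y -> rho = (8 * p)%:R^-1 ->
  (a + 2 * rho * c + rho ^+ 2 * y) ^+ p <=
  a ^+ p + 2 * p%:R * rho * a ^+ p.-1 * c + p%:R * a ^+ p.-1 * y + y ^+ p.
Proof.
move=> p0 a0 y0 cay rhoE.
have pR : 1 <= p%:R :> R by rewrite ler1n.
have pn0 : p%:R != 0 :> R by rewrite gt_eqF //; lra.
have rp : p%:R * rho = 8^-1 by rewrite rhoE natrM; field.
have r0 : 0 < rho by rewrite rhoE invr_gt0 ltr0n muln_gt0.
have r8 : rho <= 8^-1 by rewrite -rp; nra.
have cb : - (a + y) <= 2 * c <= a + y.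
  have : (2 * c) ^+ 2 <= (a + y) ^+ 2 by have := sqr_ge0 (a - y); nra.
  move=> h; rewrite -ler_norml; rewrite -(@ler_pXn2r _ 2) // ?nnegrE ?normr_ge0 //; last lra.
  by rewrite real_normK ?num_real.
have /andP[cb1 cb2] := cb.
have ap0 : 0 <= a ^+ p.-1 by exact: exprn_ge0.
have app : a ^+ p = a * a ^+ p.-1 by rewrite -exprS prednK.
have main0 : 0 <= a ^+ p + 2 * p%:R * rho * a ^+ p.-1 * c + p%:R * a ^+ p.-1 * y.
  rewrite app.
  have -> : a * a ^+ p.-1 + 2 * p%:R * rho * a ^+ p.-1 * c + p%:R * a ^+ p.-1 * y =
    a ^+ p.-1 * (a + (p%:R * rho) * (2 * c) + p%:R * y) by ring.
  by apply: mulr_ge0 => //; rewrite rp; nra.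
(* When [y > 4 a] the base on the left is below [y], and [y ^+ p] alone suffices. Otherwise
   [p * rho = 1 / 8] keeps [p |d|] below [a], and the second-order expansion applies. *)
have [ya|ya] := leP y (4 * a); last first.
  apply: le_trans (_ : y ^+ p <= _); last by lra.
  have h0 : 0 <= a + 2 * rho * c + rho ^+ 2 * y.
    have [ay|ay] := leP a 0.
      have a00 : a = 0 by lra.
      have c0 : c = 0 by apply/eqP; rewrite -sqrf_eq0; apply/eqP; rewrite a00 mul0r in cay; have := sqr_ge0 c; lra.
      by rewrite a00 c0 mulr0 !add0r mulr_ge0 ?sqr_ge0.
    have : 0 <= (a + rho * c) ^+ 2 by exact: sqr_ge0.
    have : rho ^+ 2 * c ^+ 2 <= rho ^+ 2 * (a * y) by rewrite ler_wpM2l ?sqr_ge0.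
    move=> h1 h2; rewrite -(pmulr_rge0 _ ay); nra.
  have h1 : rho * (2 * c) <= 8^-1 * (a + y).
    by apply: le_trans (ler_wpM2l (ltW r0) cb2) _; rewrite ler_wpM2r //; lra.
  have h2 : rho ^+ 2 * y <= 8^-1 * y.
    by rewrite ler_wpM2r // expr2; apply: le_trans (ler_wpM2l (ltW r0) r8) _; lra.
  apply: lerXn2r; rewrite ?nnegrE //; lra.
have c2a : - (2 * a) <= c <= 2 * a.
  have : c ^+ 2 <= (2 * a) ^+ 2 by nra.
  move=> h; rewrite -ler_norml -(@ler_pXn2r _ 2) // ?nnegrE ?normr_ge0 //; last lra.
  by rewrite real_normK ?num_real.
have /andP[ca1 ca2] := c2a.
pose d := 2 * rho * c + rho ^+ 2 * y.
have pd : p%:R * d = 4^-1 * c + 8^-1 * rho * y.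
  rewrite /d mulrDr (_ : p%:R * (2 * rho * c) = 2 * (p%:R * rho) * c); last by ring.
  rewrite (_ : p%:R * (rho ^+ 2 * y) = (p%:R * rho) * rho * y); last by ring.
  by rewrite rp; lra.
have ry : 0 <= rho * y <= a / 2.
  by apply/andP; split; nra.
have /andP[ry1 ry2] := ry.
have := @pow_quadratic a d p p a0; rewrite pd => hq.
have {}hq : (a + d) ^+ p * a ^+ 2 <= a ^+ p * (a ^+ 2 + p%:R * a * d + p%:R ^+ 2 * d ^+ 2).
  by apply: hq => //; lra.
have [a00|a_neq0] := eqVneq a 0.
  have y00 : y = 0 by lra.
  have c00 : c = 0 by lra.
  by rewrite a00 y00 c00 !mulr0 !addr0 [0 ^+ p]expr0n gtn_eqF // addr0.
have a_gt0 : 0 < a by rewrite lt_def a_neq0.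
have pd2 : (p%:R * d) ^+ 2 <= a * y / 4.
  rewrite pd; have := sqr_ge0 (c - rho * y); nra.
rewrite -addrA -/d.
rewrite -(ler_pM2r (exprn_gt0 2 a_gt0)); apply: le_trans hq _.
have e1 : p%:R * rho ^+ 2 * y <= y / 64.
  rewrite expr2 mulrA rp; nra.
apply: le_trans (_ : a ^+ p.-1 * a ^+ 2 * (a + 2 * p%:R * rho * c + p%:R * y) <= _); last first.
  rewrite app [X in _ <= X]mulrC.
  have : 0 <= y ^+ p by exact: exprn_ge0.
  have : 0 <= a ^+ 2 by exact: sqr_ge0.
  move=> h1 h2; have := mulr_ge0 h1 h2; set q := a ^+ p.-1; set s := y ^+ p; nra.
rewrite app (_ : a * a ^+ p.-1 * (a ^+ 2 + p%:R * a * d + p%:R ^+ 2 * d ^+ 2) =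
  a ^+ p.-1 * (a * (a ^+ 2 + a * (p%:R * d) + (p%:R * d) ^+ 2))); last by ring.
rewrite -mulrA ler_wpM2l //.
rewrite expr2 -[X in _ <= X]mulrA ler_wpM2l //.
have -> : a * a + a * (p%:R * d) + (p%:R * d) ^+ 2 =
   a * (a + 2 * p%:R * rho * c + p%:R * rho ^+ 2 * y) + (p%:R * d) ^+ 2.
  by rewrite {1}/d; ring.
nra.
Qed.
End PowerInequalities.

(** * Hypercontractivity with Laplacians *)

Section Hypercontractivity.
Variables (R : realFieldType) (m n : nat).
Hypothesis m_gt0 : (0 < m)%N.
Local Notation word := {ffun 'I_n -> 'I_m}.
Implicit Types (f g u v : word -> R) (x y z : word) (J A S U : {set 'I_n}).
Implicit Types (a b c : R) (al be : 'I_n -> R).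

Lemma Op_id f x : Op (fun=> 1) (fun=> 1) f x = f x.
Proof.
rewrite -[RHS](Av_set0 m_gt0 f x) AvE //; apply: eq_Op => // i.
by rewrite inE.
Qed.

Lemma T1E j c f x :
  T [set j] c f x = Av [set j] f x + c * (f x - Av [set j] f x).
Proof.
rewrite AvE // -[f x]Op_id /T.
rewrite (@Op_linear1 R m n j (1 - c) c _ _ (fun=> 1) (fun i => (i \notin [set j])%:R) (fun=> 1) (fun=> 1)).
- ring.
- by move=> i ij; rewrite !inE (negPf ij).
- by ring.
by rewrite !inE eqxx /=; ring.
Qed.

Lemma L_set0 f x : L set0 f x = f x.
Proof. by rewrite -[RHS]Op_id; apply: eq_Op => // i; rewrite inE. Qed.

Lemma L_cons j S f x : j \notin S ->
  L (j |: S) f x = L S f x - Av [set j] (L S f) x.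
Proof.
move=> jS; rewrite AvE // Op_comp // /L.
rewrite (@Op_linear1 R m n j 1 (-1) _ _ (fun i => (i \notin S)%:R) (fun=> 1)
   (fun i => 1 * (i \notin S)%:R) (fun i => (i \notin [set j])%:R * 1)).
- by rewrite mul1r mulN1r.
- by move=> i ij; rewrite !inE (negPf ij) /= !mul1r.
- by rewrite !inE eqxx jS /=; ring.
by rewrite !inE eqxx /=; ring.
Qed.

Lemma T_cons j J c f x : j \notin J -> T (j |: J) c f x = T J c (T [set j] c f) x.
Proof.
move=> jJ; rewrite /T Op_comp //; apply: eq_Op => // i; rewrite ?mul1r // !inE.
by have [->|] := eqVneq i j; rewrite ?(negPf jJ) ?mul1r ?mulr1.
Qed.

Lemma L_T S J c f x : L S (T J c f) x = T J c (L S f) x.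
Proof. by rewrite /L /T !Op_comp //; apply: eq_Op => // i; rewrite mulrC. Qed.

Lemma T_set0 c f x : T set0 c f x = f x.
Proof. by rewrite -[RHS]Op_id; apply: eq_Op => // i; rewrite inE. Qed.

Lemma sum_subset_cons j J (F : {set 'I_n} -> R) : j \notin J ->
  \sum_(S : {set 'I_n} | S \subset j |: J) F S =
  \sum_(S : {set 'I_n} | S \subset J) (F S + F (j |: S)).
Proof.
move=> jJ; rewrite big_split /= (bigID (fun S => j \in S)) [LHS]addrC /=; congr (_ + _).
  apply: eq_bigl => S; apply/andP/idP => [[/subsetP SJ jS]|SJ].
    apply/subsetP => i iS; move/(_ i iS): SJ; rewrite !inE => /orP[/eqP ij|//].
    by rewrite -ij iS in jS.
  split; first by apply: subset_trans SJ (subsetUr _ _).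
  by apply: contra jJ => /(subsetP SJ).
rewrite (reindex_onto (fun S => j |: S) (fun S => S :\ j)) /=; last first.
  by move=> S /andP[_ jS]; rewrite setD1K.
apply: eq_bigl => S; rewrite setU11 andbT.
apply/andP/idP => [[SJ /eqP SE]|SJ].
  rewrite -SE; apply/subsetP => i; rewrite !inE => /andP[ij]; rewrite (negPf ij) /= => iS.
  by move/subsetP/(_ i): SJ; rewrite !inE iS orbT (negPf ij) /= => ->.
split; first exact: setUS.
by rewrite setU1K // ; apply: contra jJ => /(subsetP SJ).
Qed.

Section Step.
Variable p : nat.
Hypothesis p_gt0 : (0 < p)%N.
Variable rho : R.
Hypothesis rhoE : rho = (8 * p)%:R^-1.

(** Write [w] as its average [a] over [j] plus a fluctuation [h] and apply [two_point_estimate]. The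
    cross term averages to zero over [j]; Bernoulli absorbs [p * A2 ^+ (p - 1) * X2] into the power
    of the full second moment over [j |: U]; the remaining [X2 ^+ p] is the fluctuation term on the
    right. *)
Lemma hypercontractive_step j U w x : j \notin U ->
  Av [set j] (fun y => Av U (fun z => T [set j] rho w z ^+ 2) y ^+ p) x <=
  Av [set j] (fun y => Av (j |: U) (fun z => w z ^+ 2) y ^+ p +
                       Av U (fun z => (w z - Av [set j] w z) ^+ 2) y ^+ p) x.
Proof.
move=> jU.
pose a := Av [set j] w; pose h z := w z - a z.
pose A2 := Av U (fun z => a z ^+ 2); pose X2 := Av U (fun z => h z ^+ 2).
pose c := Av U (fun z => a z * h z).
have inda : indep [set j] a by apply: indep_Av.
have indA2 : indep [set j] A2.
  by apply: Av_indep_keep => y z; rewrite inda.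
have ET y : Av U (fun z => T [set j] rho w z ^+ 2) y = A2 y + 2 * rho * c y + rho ^+ 2 * X2 y.
  rewrite /A2 /c /X2 -!Av_scale -!Av_add; apply: eq_Av => z.
  by rewrite T1E /h /a; ring.
have Ec : Av [set j] c x = 0.
  rewrite Av_Av // setUC -Av_Av // (@eq_Av _ _ _ U _ (fun=> 0)) ?Av_cst // => y.
  rewrite Av_indep_mul // /h Av_sub (Av_indep _ _ inda) //.
  by rewrite /a subrr mulr0.
have EW y : Av (j |: U) (fun z => w z ^+ 2) y = A2 y + Av [set j] X2 y.
  rewrite setUC -Av_Av // [X in _ + X]Av_Av // setUC -Av_Av // /A2 -Av_add.
  apply: eq_Av => z.
  have -> : Av [set j] (fun z => h z ^+ 2) z = Av [set j] (fun z => w z ^+ 2) z + Av [set j] (fun z => a z * (-2 * w z + a z)) z.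
    by rewrite -Av_add; apply: eq_Av => s; rewrite /h; ring.
  rewrite Av_indep_mul // Av_add Av_scale [Av _ a z]Av_indep //.
  by rewrite -/(a z); ring.
have A20 y : 0 <= A2 y by apply: Av_ge0 => // z; rewrite sqr_ge0.
have X20 y : 0 <= X2 y by apply: Av_ge0 => // z; rewrite sqr_ge0.
apply: le_trans (_ : Av [set j] (fun y => A2 y ^+ p + 2 * p%:R * rho * A2 y ^+ p.-1 * c y
   + p%:R * A2 y ^+ p.-1 * X2 y + X2 y ^+ p) x <= _).
  apply: Av_le => // y; rewrite ET; apply: two_point_estimate => //.
  by apply: Av_CS.
rewrite Av_add [X in _ <= X]Av_add lerD //.
have ind1 (k : R) q : indep [set j] (fun y => k * A2 y ^+ q).
  by move=> y z; rewrite indA2.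
have ind2 : indep [set j] (fun y => A2 y ^+ p) by move=> y z; rewrite indA2.
rewrite 2!Av_add (Av_indep _ _ ind2) // !(Av_indep_mul _ _ (ind1 _ _)) Ec mulr0 addr0.
rewrite (@eq_Av _ _ _ [set j] (fun y => Av (j |: U) _ y ^+ p) (fun y => (A2 y + Av [set j] X2 y) ^+ p)); last by move=> y; rewrite EW.
have ind3 : indep [set j] (fun y => (A2 y + Av [set j] X2 y) ^+ p).
  by move=> y z /=; rewrite indA2 indep_Av.
rewrite (Av_indep _ _ ind3) //.
apply: bernoulli_scaled => //; exact: Av_ge0.
Qed.

(** Coordinates of [J] are peeled off one at a time. At each of them [hypercontractive_step] offers
    either an average of squares or a Laplacian, and [S] records where the Laplacian was taken. *)
Lemma hypercontractive J f x :
  Av J (fun y => T J rho f y ^+ (2 * p)) x <=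
  \sum_(S : {set 'I_n} | S \subset J)
     Av J (fun y => Av (J :\: S) (fun z => L S f z ^+ 2) y ^+ p) x.
Proof.
move: {2}#|J| (erefl #|J|) => k; elim: k J f x => [|k IH] J f x Jk.
  move/eqP: Jk; rewrite cards_eq0 => /eqP->.
  rewrite (bigD1 set0) ?sub0set //= big1 => [|S /andP[]]; last first.
    by rewrite subset0 => ->.
  rewrite addr0 !Av_set0 // setD0 Av_set0 // T_set0 L_set0.
  by rewrite exprM.
have [j jJ] : exists j, j \in J by apply/set0Pn; rewrite -cards_eq0 Jk.
have jJ' : j \notin J :\ j by rewrite !inE eqxx.
have J'k : #|J :\ j| = k by move: Jk; rewrite (cardsD1 j) jJ => -[].
move: (J :\ j) jJ' J'k (setD1K jJ) => J' jJ' J'k <- {J jJ Jk}.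
rewrite -Av_Av // (sum_subset_cons _ jJ').
apply: le_trans (_ : Av [set j] (fun y => \sum_(S : {set 'I_n} | S \subset J')
     Av J' (fun y => Av (J' :\: S) (fun z => L S (T [set j] rho f) z ^+ 2) y ^+ p) y) x <= _).
  apply: Av_le => // y; apply: le_trans (IH _ (T [set j] rho f) y J'k).
  by apply: Av_le => // z; rewrite T_cons.
rewrite Av_sum; apply: ler_sum => S SJ.
have jS : j \notin S by apply: contra jJ' => /(subsetP SJ).
rewrite Av_Av // setUC -Av_Av //.
apply: le_trans (_ : Av J' (Av [set j] (fun y => Av (j |: (J' :\: S)) (fun z => L S f z ^+ 2) y ^+ p +
                       Av (J' :\: S) (fun z => (L S f z - Av [set j] (L S f) z) ^+ 2) y ^+ p)) x <= _).
  apply: Av_le => // y; apply: le_trans (hypercontractive_step _ _ _); last first.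
    by rewrite inE negb_and jJ' orbT.
  by apply: Av_le => // z; rewrite le_eqVlt; apply/orP; left; apply/eqP; congr (_ ^+ p);
    apply: eq_Av => s; rewrite L_T.
rewrite Av_Av // Av_add setUC lerD //.
  apply: Av_le => // y; rewrite le_eqVlt; apply/orP; left; apply/eqP; congr (_ ^+ p).
  have -> : (j |: J') :\: S = j |: (J' :\: S) => //.
  by apply/setP => i; rewrite !inE; have [->|] := eqVneq i j; rewrite ?jS.
apply: Av_le => // y; rewrite le_eqVlt; apply/orP; left; apply/eqP; congr (_ ^+ p).
have -> : (j |: J') :\: (j |: S) = J' :\: S.
  apply/setP => i; rewrite !inE; have [->|] := eqVneq i j; rewrite /= ?(negPf jJ') ?andbF //.
by apply: eq_Av => z; rewrite L_cons.
Qed.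

End Step.
End Hypercontractivity.

(** * Efron-Stein weights, Laplacians and a power mean inequality *)

Section GlobalFunctions.
Variables (R : realFieldType) (m n : nat).
Hypothesis m_gt0 : (0 < m)%N.
Local Notation word := {ffun 'I_n -> 'I_m}.
Implicit Types (f g u v : word -> R) (x y z : word) (J A S U : {set 'I_n}).
Implicit Types (a b c : R) (al be : 'I_n -> R).

Lemma prod_if_set U c : \prod_(i < n) (if i \in U then c else 1) = c ^+ #|U|.
Proof. by rewrite -big_mkcond /= prodr_const. Qed.

Lemma Av_T_sqr J c f x :
  Av J (fun y => T J c f y ^+ 2) x = Av J (fun y => f y * T J (c ^+ 2) f y) x.
Proof.
rewrite (@eq_Av _ _ _ J _ (fun y => T J c f y * T J c f y)); last first.
  by move=> y; rewrite expr2.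
rewrite /T -Av_mul_Op => // [|i /negPf-> //].
apply: eq_Av => y; rewrite Op_comp //; congr (_ * _).
by apply: eq_Op => // i; [rewrite mulr1 | case: ifP; rewrite ?mulr1 ?expr2].
Qed.

Lemma Op_expand J (e : 'I_n -> R) f x :
  Op (fun=> 1) (fun i => if i \in J then e i else 1) f x =
  \sum_(U : {set 'I_n} | U \subset J) \prod_(i in U) e i * P J U f x.
Proof.
rewrite [LHS](@eq_Op _ _ _ _ _ (fun i => 0 + 1) (fun i => (if i \in J then e i else 0) + (if i \in J then 0 else 1)) _ f) //; first last.
- by move=> i; case: ifP; rewrite ?addr0 ?add0r.
- by move=> i; rewrite add0r.
rewrite Op_set (bigID (fun U => U \subset J)) /= [X in _ + X]big1 ?addr0 => [|U /subsetPn[i iU iJ]].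
  apply: eq_bigr => U UJ; rewrite [\prod_(_ in U) _]big_mkcond -Op_scale.
  apply: eq_Op => // i; rewrite ?inE; case: (boolP (i \in U)) => iU; rewrite ?mulr0 ?mulr1 ?mul1r //=.
    by rewrite (subsetP UJ) ?mulr1.
  by case: (i \in J).
by apply: (@Op_0 _ _ _ i); rewrite iU // (negPf iJ).
Qed.

Lemma T_expand J c f x :
  T J c f x = \sum_(U : {set 'I_n} | U \subset J) c ^+ #|U| * P J U f x.
Proof. by rewrite /T Op_expand; apply: eq_bigr => U _; rewrite prodr_const. Qed.

(** On each coordinate of [J] the eigenvalue pair [(1, 2 c)] is the sum of [(0, c)], noise followed
    by the Laplacian, and [(1, c)], noise alone. *)
Lemma L_T_expand J c f x :
  T J (2 * c) f x = \sum_(U : {set 'I_n} | U \subset J) L U (T J c f) x.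
Proof.
rewrite [LHS](@eq_Op _ _ _ _ _ (fun i => 0 + 1) (fun i => (if i \in J then c else 0) + (if i \in J then c else 1)) _ f) //; first last.
- by move=> i; case: ifP => _; rewrite ?add0r //; ring.
- by move=> i; rewrite add0r.
rewrite Op_set (bigID (fun U => U \subset J)) /= [X in _ + X]big1 ?addr0 => [|U /subsetPn[i iU iJ]].
  apply: eq_bigr => U UJ; rewrite /L /T Op_comp //.
  apply: eq_Op => // i; rewrite ?mulr1 ?mul1r; case: (boolP (i \in U)) => iU //=.
  by rewrite (subsetP UJ).
by apply: (@Op_0 _ _ _ i); rewrite iU // (negPf iJ).
Qed.

(** [P J U] is an orthogonal projection over [J]: self-adjoint and idempotent. *)
Lemma Av_P_sqr J U f g x : U \subset J ->
  Av J (fun y => f y * P J U g y) x = Av J (fun y => P J U f y * P J U g y) x.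
Proof.
move=> /subsetP UJ; rewrite /P -[RHS]Av_mul_Op => // [|i iJ|i iJ].
- apply: eq_Av => y; rewrite Op_comp //; congr (_ * _).
  by apply: eq_Op => // i; rewrite -natrM mulnb andbb.
- by case: (boolP (i \in U)) iJ => // /UJ ->.
by rewrite inE (negPf iJ) andbF.
Qed.

(** Efron-Stein weight of [f] on [U], the coordinates outside [J] being frozen. *)
Definition weight J U f x := Av J (fun y => f y * P J U f y) x.

Lemma weight_ge0 J U f x : U \subset J -> 0 <= weight J U f x.
Proof.
move=> UJ; rewrite /weight Av_P_sqr //.
by apply: Av_ge0 => // y; rewrite -expr2 sqr_ge0.
Qed.

Lemma Av_mul_T J c f x :
  Av J (fun y => f y * T J c f y) x =
  \sum_(U : {set 'I_n} | U \subset J) c ^+ #|U| * weight J U f x.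
Proof.
transitivity (Av J (fun y => \sum_(U : {set 'I_n} | U \subset J) c ^+ #|U| * (f y * P J U f y)) x).
  apply: eq_Av => y; rewrite T_expand mulr_sumr.
  by apply: eq_bigr => U _; rewrite mulrCA.
by rewrite Av_sum; apply: eq_bigr => U _; rewrite Av_scale.
Qed.

Lemma Av_mul_T_mono J c c' f x : 0 <= c -> c <= c' ->
  Av J (fun y => f y * T J c f y) x <= Av J (fun y => f y * T J c' f y) x.
Proof.
move=> c0 cc'; rewrite !Av_mul_T; apply: ler_sum => U UJ.
apply: ler_wpM2r; first exact: weight_ge0.
by apply: lerXn2r; rewrite ?nnegrE //; lra.
Qed.

(** Each [L S] is a projection commuting with the noise, so each square equals the inner product of
    [f] with [L S (T J (c ^+ 2) f)]; [L_T_expand] sums these, which doubles the rate. *)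
Lemma sum_L_T_sqr J c f x :
  \sum_(S : {set 'I_n} | S \subset J) Av J (fun y => L S (T J c f) y ^+ 2) x =
  Av J (fun y => f y * T J (2 * c ^+ 2) f y) x.
Proof.
transitivity (Av J (fun y => \sum_(S : {set 'I_n} | S \subset J) f y * L S (T J (c ^+ 2) f) y) x); last first.
  by apply: eq_Av => y; rewrite L_T_expand mulr_sumr.
rewrite Av_sum; apply: eq_bigr => S /subsetP SJ.
transitivity (Av J (fun y => L S (T J c f) y * L S (T J c f) y) x).
  by apply: eq_Av => y; rewrite expr2.
transitivity (Av J (fun y => Op (fun i => (i \notin S)%:R * 1) (fun i => 1 * (if i \in J then c else 1)) f y * L S (T J c f) y) x).
  by apply: eq_Av => y; rewrite {1}/L /T Op_comp.
rewrite -Av_mul_Op // => [|i iJ|i /negPf->]; last 2 first.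
- by rewrite mulr1; case: (boolP (i \in S)) iJ => // /SJ ->.
- by rewrite mulr1.
apply: eq_Av => y; congr (_ * _); rewrite /L /T !Op_comp //.
apply: eq_Op => // i.
  by rewrite !mulr1 -natrM mulnb andbb.
by case: ifP => _; rewrite !mul1r ?mulr1 ?expr2.
Qed.

Lemma L_T_factor S J c f x : S \subset J ->
  L S (T J c f) x = c ^+ #|S| * L S (T (J :\: S) c f) x.
Proof.
move=> /subsetP SJ; rewrite -prod_if_set /L /T !Op_comp // -Op_scale.
apply: eq_Op => // i; case: (boolP (i \in S)) => iS; rewrite ?inE ?iS /=;
  rewrite ?mul0r ?mulr0 ?mul1r ?mulr1 //.
by rewrite SJ.
Qed.

(** Each coordinate of [S] costs a factor 4, from [(u - Av u) ^+ 2 <= 2 u ^+ 2 + 2 Av (u ^+ 2)]. The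
    hypothesis is uniform in the base point because averaging over a coordinate moves it. *)
Lemma Av_L_sqr_le U S v M x :
  (forall z, Av U (fun y => v y ^+ 2) z <= M) ->
  Av U (fun y => L S v y ^+ 2) x <= 4 ^+ #|S| * M.
Proof.
move=> hM; move: {2}#|S| (erefl #|S|) => k; elim: k S x => [|k IH] S x Sk.
  move/eqP: (Sk); rewrite cards_eq0 => /eqP->; rewrite cards0 mul1r.
  rewrite (@eq_Av _ _ _ U _ (fun y => v y ^+ 2)) //.
  by move=> y; rewrite L_set0.
have [j jS] : exists j, j \in S by apply/set0Pn; rewrite -cards_eq0 Sk.
have jS' : j \notin S :\ j by rewrite !inE eqxx.
have S'k : #|S :\ j| = k by move: Sk; rewrite (cardsD1 j) jS => -[].
move: (S :\ j) jS' S'k (setD1K jS) => S' jS' S'k <- {S jS Sk}.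
rewrite cardsU1 jS' S'k exprS -mulrA.
set u := L S' v; have {}IH z : Av U (fun y => u y ^+ 2) z <= 4 ^+ k * M.
  by have := IH S' z S'k; rewrite S'k.
apply: le_trans (_ : Av U (fun y => 2 * u y ^+ 2 + 2 * Av [set j] (fun y => u y ^+ 2) y) x <= _).
  apply: Av_le => // y; rewrite L_cons // -/u.
  have := Av_sqr_le m_gt0 [set j] u y; have := sqr_ge0 (u y + Av [set j] u y); nra.
rewrite Av_add [X in X + _]Av_scale [X in _ + X]Av_scale.
have -> : Av U (fun y => Av [set j] (fun y => u y ^+ 2) y) x =
   Av [set j] (Av U (fun y => u y ^+ 2)) x.
  by rewrite Av_Av // setUC -Av_Av.
have : Av [set j] (Av U (fun y => u y ^+ 2)) x <= 4 ^+ k * M by apply: Av_le_cst.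
have := IH x; lra.
Qed.

(** Hölder with exponent [2 p] for the weight [f]. To avoid roots, the tangent inequality for
    [h ^+ (2 p)] at [c = G / gam] is multiplied by [f] and averaged; [f <= 1] then removes the
    weight on the right. *)
Lemma weighted_power_mean J f h gam p x :
  (forall y, 0 <= f y <= 1) -> 0 < gam -> Av J f x <= gam -> (0 < p)%N ->
  Av J (fun y => f y * h y) x ^+ (2 * p) <=
  gam ^+ (2 * p).-1 * Av J (fun y => h y ^+ (2 * p)) x.
Proof.
move=> f01 g0 fg p0; set G := Av J _ x.
pose c := G / gam; pose q := (2 * p)%N.
have Gc : G = c * gam by rewrite /c divfK // gt_eqF.
have qq : q = q.-1.+1 by rewrite /q prednK // muln_gt0.
have cq0 : 0 <= c ^+ q by rewrite exprM exprn_ge0 // sqr_ge0.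
have key : c ^+ q * gam <= Av J (fun y => h y ^+ q) x.
  apply: le_trans (_ : Av J (fun y => (c ^+ q - q%:R * c ^+ q.-1 * c) * f y + (q%:R * c ^+ q.-1) * (f y * h y)) x <= _).
    rewrite Av_add !Av_scale -/G Gc.
    have cq : c ^+ q = c * c ^+ q.-1 by rewrite -exprS -qq.
    have qR : q%:R = q.-1%:R + 1 :> R by rewrite natr1 -qq.
    have -> : c ^+ q - q%:R * c ^+ q.-1 * c = - (q.-1%:R * c ^+ q).
      by rewrite cq qR; ring.
    have -> : q%:R * c ^+ q.-1 * (c * gam) = (q.-1%:R + 1) * (c ^+ q * gam).
      by rewrite cq qR; ring.
    have : q.-1%:R * c ^+ q * Av J f x <= q.-1%:R * c ^+ q * gam.
      by rewrite ler_wpM2l // mulr_ge0.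
    lra.
  apply: Av_le => // y; have /andP[f0 f1] := f01 y.
  have h1 := even_pow_tangent c (h y) p; rewrite -/q in h1.
  have h2 : 0 <= h y ^+ q by rewrite exprM exprn_ge0 // sqr_ge0.
  have h3 := ler_wpM2l f0 h1.
  have h4 : f y * h y ^+ q <= h y ^+ q by nra.
  by apply: le_trans h4; apply: le_trans h3; rewrite le_eqVlt; apply/orP; left; apply/eqP; ring.
rewrite -/q Gc exprMn [X in _ * gam ^+ X]qq exprS [gam * _]mulrC mulrCA.
by rewrite ler_wpM2l // exprn_ge0 // ltW.
Qed.
End GlobalFunctions.

(** * Noise stability of global functions *)

Section NoiseStability.
Variables (R : realFieldType) (m n : nat).
Hypothesis m_gt0 : (0 < m)%N.
Local Notation word := {ffun 'I_n -> 'I_m}.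
Implicit Types (f g u v : word -> R) (x y z : word) (J A S U : {set 'I_n}).

(* The coordinates of [x] in [S] are the restricted ones; those outside [J] are
   mere parameters. *)
Definition global (K gam : R) J f :=
  forall S x, S \subset J -> Av (J :\: S) f x <= K ^+ #|S| * gam.

Lemma globalS K gam J S f : S \subset J -> global K gam J f ->
  global K (K ^+ #|S| * gam) (J :\: S) f.
Proof.
move=> SJ gf S' x S'J; rewrite setDDl mulrA -exprD.
have disj : [disjoint S & S'].
  apply/pred0P => i /=; apply/negP => /andP[iS iS'].
  by have := subsetP S'J i iS'; rewrite inE iS.
have <- : #|S :|: S'| = (#|S'| + #|S|)%N by rewrite cardsU (disjoint_setI0 disj) cards0 subn0 addnC.
apply: gf; rewrite subUset SJ; apply: subset_trans S'J _; exact: subsetDl.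
Qed.

(** Induction on [|J|]. Suppose the noise stability [G] exceeds [4 gam ^+ 2]. For nonempty [S] the
    induction hypothesis on restrictions to [J :\: S] bounds [Q S] pointwise by [4 gam ^+ 2], hence
    by [G]; for empty [S] it is a noise stability of rate [kap ^+ 2 <= sig], again at most [G]. So
    the [p]-th powers in the hypercontractive inequality sum to at most [G ^+ p]. Hölder turns this
    into [G ^+ p <= gam ^+ (2 p - 1)], which [1 <= gam * 4 ^+ p] makes incompatible with the
    assumption. *)
Theorem global_noise_stability (p : nat) (K : R) : (0 < p)%N -> 1 <= K ->
  forall J f gam, (forall y, 0 <= f y <= 1) -> 1 <= gam * 2 ^+ (2 * p) ->
  global K gam J f ->
  forall x, Av J (fun y => f y * T J ((128 * p ^ 2)%:R * K)^-1 f y) x <= 4 * gam ^+ 2.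
Proof.
move=> p0 K1 J f gam f01; move: {2}#|J| (leqnn #|J|) => k.
elim: k J gam => [|k IH] J gam Jk hgam gf x.
  move: Jk; rewrite leqn0 cards_eq0 => /eqP J0; rewrite {}J0 in gf *.
  rewrite Av_set0 // T_set0 //.
  have := gf set0 x (sub0set _); rewrite setD0 Av_set0 // cards0 mul1r => h.
  by have /andP[f0 f1] := f01 x; nra.
have gam0 : 0 < gam.
  have : 0 < (2 : R) ^+ (2 * p) by rewrite exprn_gt0.
  by move=> h; rewrite -(pmulr_lgt0 _ h); lra.
have pR : 1 <= p%:R :> R by rewrite ler1n.
have pn0 : p%:R != 0 :> R by rewrite gt_eqF //; lra.
have Kn0 : K != 0 by rewrite gt_eqF //; lra.
(* [rho] is the noise spent on hypercontractivity. [kap] pays, for each coordinate of [S], a factor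
   2 for the Laplacian and a factor [K] for the restriction, and still leaves [rho]. The stated rate
   is [sig = rho * kap]. *)
pose rho : R := (8 * p)%:R^-1; pose kap : R := rho / (2 * K).
pose sig : R := ((128 * p ^ 2)%:R * K)^-1.
have sigE : sig = rho * kap.
  by rewrite /sig /kap /rho !natrM; field; rewrite pn0 Kn0.
have r0 : 0 < rho by rewrite invr_gt0 ltr0n muln_gt0.
have r1 : rho <= 8^-1.
  by rewrite /rho lef_pV2 ?posrE ?ltr0n ?muln_gt0 // natrM; lra.
have k0 : 0 < kap by rewrite divr_gt0 //; lra.
have kK : kap * (2 * K) = rho by rewrite /kap divfK // mulf_neq0 ?pnatr_eq0.
have kr : 2 * kap <= rho by nra.
have k2s : 2 * kap ^+ 2 <= sig by rewrite sigE expr2 mulrA; nra.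
set G := Av J _ x; rewrite -/sig in G *.
rewrite leNgt; apply/negP => hG.
have G0 : 0 < G by have := sqr_ge0 gam; nra.
pose Q S y := Av (J :\: S) (fun z => L S (T J kap f) z ^+ 2) y.
have Q0 S y : 0 <= Q S y by apply: Av_ge0 => // z; rewrite sqr_ge0.
have QG S : S \subset J -> Av J (fun y => Q S y ^+ p) x <= G ^+ p.-1 * Av J (Q S) x.
  move=> SJ; have [->|S0] := eqVneq S set0.
    have QE y : Q set0 y = Av J (fun z => T J kap f z ^+ 2) y.
      by rewrite /Q setD0; apply: eq_Av => z; rewrite L_set0.
    have Qx : Q set0 x <= G.
      rewrite QE Av_T_sqr //; apply: Av_mul_T_mono => //; first exact: sqr_ge0.
      by have := sqr_ge0 kap; lra.
    have ind1 : indep J (Q set0) by move=> y z; rewrite !QE indep_Av.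
    have ind2 : indep J (fun y => Q set0 y ^+ p) by move=> y z; rewrite ind1.
    rewrite (Av_indep _ _ ind1) // (Av_indep _ _ ind2) // -[X in _ ^+ X](prednK p0) exprSr.
    rewrite ler_wpM2r //; apply: lerXn2r; rewrite ?nnegrE //; exact: ltW.
  rewrite -Av_scale; apply: Av_le => // y; rewrite -[X in _ ^+ X](prednK p0) exprSr.
  rewrite ler_wpM2r //; apply: lerXn2r; rewrite ?nnegrE // ?(ltW G0) //.
  apply: le_trans (ltW hG).
  have -> : Q S y = (kap ^+ #|S|) ^+ 2 * Av (J :\: S) (fun z => L S (T (J :\: S) kap f) z ^+ 2) y.
    by rewrite -Av_scale; apply: eq_Av => z; rewrite (L_T_factor _ _ _ _ SJ) // exprMn.
  have hM z : Av (J :\: S) (fun y => T (J :\: S) kap f y ^+ 2) z <= 4 * (K ^+ #|S| * gam) ^+ 2.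
    rewrite Av_T_sqr //; apply: le_trans (_ : Av (J :\: S) (fun y => f y * T (J :\: S) sig f y) z <= _).
      apply: Av_mul_T_mono => //; first exact: sqr_ge0.
      by have := sqr_ge0 kap; lra.
    apply: IH; last exact: globalS.
      rewrite -ltnS; apply: leq_trans Jk; apply: proper_card; apply/properP; split; first exact: subsetDl.
      have [i iS] := set0Pn _ S0; exists i; first exact: (subsetP SJ).
      by rewrite inE iS.
    apply: le_trans hgam _; rewrite ler_wpM2r ?exprn_ge0 //.
    by rewrite ler_peMl ?(ltW gam0) // exprn_ege1.
  apply: le_trans (ler_wpM2l (sqr_ge0 _) (Av_L_sqr_le m_gt0 S y hM)) _.
  have -> : kap ^+ #|S| ^+ 2 * (4 ^+ #|S| * (4 * (K ^+ #|S| * gam) ^+ 2)) =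
     ((kap * (2 * K)) ^+ #|S|) ^+ 2 * (4 * gam ^+ 2).
    by rewrite !exprMn -!exprM (_ : (4 : R) = 2 ^+ 2) -?exprM; [rewrite [(2 * #|S|)%N]mulnC; ring | ring].
  rewrite ger_pMl; last by have := exprn_gt0 2 gam0; lra.
  rewrite kK; do 2 (apply: exprn_ile1; rewrite ?exprn_ge0 ?(ltW r0) //).
  lra.
have main : G ^+ (2 * p) <= gam ^+ (2 * p).-1 * G ^+ p.
  apply: le_trans (weighted_power_mean m_gt0 (T J sig f) f01 gam0 _ p0) _.
    by have := gf set0 x (sub0set _); rewrite setD0 cards0 mul1r.
  rewrite ler_wpM2l ?exprn_ge0 ?(ltW gam0) //.
  rewrite (@eq_Av _ _ _ J _ (fun y => T J rho (T J kap f) y ^+ (2 * p))); last first.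
    move=> y; congr (_ ^+ _); rewrite /T Op_comp //; apply: eq_Op => // i; first by rewrite mulr1.
    by case: ifP; rewrite ?mulr1.
  apply: le_trans (hypercontractive m_gt0 p0 erefl _ _ _) _.
  apply: le_trans (ler_sum _ (fun S SJ => QG S SJ)) _.
  rewrite -mulr_sumr -[X in _ <= _ ^+ X](prednK p0) exprSr ler_wpM2l ?exprn_ge0 ?(ltW G0) //.
  apply: le_trans (_ : \sum_(S : {set 'I_n} | S \subset J) Av J (fun y => L S (T J kap f) y ^+ 2) x <= _).
    apply: ler_sum => S SJ; rewrite /Q.
    rewrite [X in X <= _](_ : _ = Av J (Av (J :\: S) (fun z => L S (T J kap f) z ^+ 2)) x) //.
    by rewrite Av_Av // (setUidPl (subsetDl _ _)).
  rewrite sum_L_T_sqr //; apply: Av_mul_T_mono => //.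
  by rewrite mulr_ge0 ?sqr_ge0.
have {main} : G ^+ p <= gam ^+ (2 * p).-1.
  rewrite -(ler_pM2r (exprn_gt0 p G0)) -exprD addnn -mul2n; exact: main.
apply/negP; rewrite -ltNge; apply: le_lt_trans (_ : (4 * gam ^+ 2) ^+ p < _); last first.
  by rewrite ltr_pXn2r // nnegrE ?(ltW G0) // mulr_ge0 ?sqr_ge0.
have -> : (4 * gam ^+ 2) ^+ p = (gam * 2 ^+ (2 * p)) * gam ^+ (2 * p).-1.
  rewrite exprMn -exprM (_ : (4 : R) = 2 ^+ 2); last by ring.
  rewrite -exprM -[in gam ^+ (2 * p)](@prednK (2 * p)) ?muln_gt0 //.
  by rewrite exprS; ring.
by rewrite ler_peMl ?exprn_ge0 ?(ltW gam0).
Qed.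
End NoiseStability.

(** * Pairs of words with a prescribed number of agreements *)

Lemma bin_sub_bound (N a v : nat) : (v <= a <= N)%N ->
  ('C(N - v, a - v) * N ^ v <= 'C(N, a) * a ^ v)%N.
Proof.
move=> /andP[va aN]; elim: v va => [|v IH] va; first by rewrite !subn0 !expn0.
have {}IH := IH (ltnW va).
have Nv : (0 < N - v)%N by lia.
have e : ((N - v) * 'C(N - v.+1, a - v.+1) = (a - v) * 'C(N - v, a - v))%N.
  rewrite (_ : (N - v.+1 = (N - v).-1)%N); last by lia.
  rewrite mul_bin_diag; rewrite (_ : (a - v.+1).+1 = a - v)%N //; lia.
have h : ((a - v) * N <= (N - v) * a)%N.
  by rewrite !mulnBl [(N * a)%N]mulnC leq_sub2l // leq_mul2l aN orbT.
rewrite -(leq_pmul2l Nv) mulnA e.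
apply: leq_trans (_ : ((a - v) * N) * ('C(N, a) * a ^ v) <= _)%N.
  rewrite expnS [X in (X <= _)%N](_ : _ = (a - v) * N * ('C(N - v, a - v) * N ^ v))%N; last by ring.
  by rewrite leq_mul2l IH orbT.
by apply: leq_trans (leq_mul h (leqnn _)) _; rewrite expnS; apply: eq_leq; ring.
Qed.

Lemma weighted_amgm (R : realFieldType) (u v s : R) : 0 < s ->
  - (2^-1 * (s * u ^+ 2 + s^-1 * v ^+ 2)) <= u * v <= 2^-1 * (s * u ^+ 2 + s^-1 * v ^+ 2).
Proof.
move=> s0; have e1 : s * s^-1 = 1 by rewrite mulfV // gt_eqF.
have si : 0 < s^-1 by rewrite invr_gt0.
have h1 : 0 <= s^-1 * (s * u + v) ^+ 2 by rewrite mulr_ge0 ?sqr_ge0 ?ltW.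
have h2 : 0 <= s^-1 * (s * u - v) ^+ 2 by rewrite mulr_ge0 ?sqr_ge0 ?ltW.
have {}h1 : 0 <= (s * s^-1) * s * u ^+ 2 + 2 * (s * s^-1) * u * v + s^-1 * v ^+ 2.
  by apply: le_trans h1 _; rewrite le_eqVlt; apply/orP; left; apply/eqP; ring.
have {}h2 : 0 <= (s * s^-1) * s * u ^+ 2 - 2 * (s * s^-1) * u * v + s^-1 * v ^+ 2.
  by apply: le_trans h2 _; rewrite le_eqVlt; apply/orP; left; apply/eqP; ring.
by rewrite e1 in h1 h2; apply/andP; split; lra.
Qed.

Section CorrelatedPairs.
Variables (R : realFieldType) (m n : nat).
Hypothesis m_gt0 : (0 < m)%N.
Local Notation word := {ffun 'I_n -> 'I_m}.
Implicit Types (f g u v : word -> R) (x y z : word) (J A S U V : {set 'I_n}).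

Lemma card_subsets_containing J V a : V \subset J -> (#|V| <= a)%N ->
  #|[set A : {set 'I_n} | [&& A \subset J, V \subset A & #|A| == a]]| =
  'C(#|J| - #|V|, a - #|V|).
Proof.
move=> VJ Va.
have <- : #|J :\: V| = (#|J| - #|V|)%N by rewrite cardsD (setIidPr VJ).
rewrite -cards_draws -[RHS](card_in_imset (f := fun B => V :|: B)); last first.
  move=> B C; rewrite !inE => /andP[BJ _] /andP[CJ _] /setP e.
  apply/setP => i; have := e i; rewrite !inE; case: (boolP (i \in V)) => //= iV _.
  by apply/idP/idP => [/(subsetP BJ)|/(subsetP CJ)]; rewrite inE iV.
apply: eq_card => A; rewrite !inE; apply/and3P/imsetP => [[AJ VA /eqP Aa]|[B]].
  exists (A :\: V); last by rewrite -[LHS](setID A V) (setIidPr VA).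
  by rewrite inE setSD //= cardsD (setIidPr VA) Aa.
rewrite inE => /andP[BJ /eqP Ba] ->; split; last 1 first.
- have /disjoint_setI0 h : [disjoint V & B].
    apply/pred0P => i /=; apply/negP => /andP[iV iB].
    by have := subsetP BJ i iB; rewrite inE iV.
  rewrite cardsU h cards0 subn0 Ba; lia.
- by rewrite subUset VJ (subset_trans BJ) ?subsetDl.
- exact: subsetUl.
Qed.

(** Each factor is at most [(i \in A) + nu]. After expansion, [bin_sub_bound] says that a random
    [a]-subset contains a given set [V] with probability at most [(a / |J|) ^+ |V|], as if
    membership were independent. *)
Lemma sum_random_set (J U : {set 'I_n}) a (nu : R) : U \subset J -> (a <= #|J|)%N -> (0 < #|J|)%N -> 0 <= nu ->
  \sum_(A : {set 'I_n} | (A \subset J) && (#|A| == a)) \prod_(i in U) (if i \in A then 1 else nu) <=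
  ('C(#|J|, a))%:R * (a%:R / #|J|%:R + nu) ^+ #|U|.
Proof.
move=> UJ aJ J0 nu0; set N := #|J|.
have N0 : 0 < N%:R :> R by rewrite ltr0n.
apply: le_trans (_ : \sum_(A : {set 'I_n} | (A \subset J) && (#|A| == a)) \sum_(V : {set 'I_n} | V \subset U) (V \subset A)%:R * nu ^+ #|U :\: V| <= _).
  apply: ler_sum => A _.
  apply: le_trans (_ : \prod_(i in U) ((i \in A)%:R + nu) <= _).
    apply: ler_prod => i _; case: ifP => _; rewrite ?ler01 ?nu0 //=; lra.
  rewrite big_mkcond /= (eq_bigr (fun i => (if i \in U then (i \in A)%:R else 0) + (if i \in U then nu else 1))); last first.
    by move=> i _; case: ifP => _; rewrite ?add0r.
  rewrite bigA_distr (bigID (fun V => V \subset U)) /= [X in _ + X]big1 ?addr0; last first.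
    by move=> V /subsetPn[i iV iU]; rewrite (bigD1 i) //= iV (negPf iU) mul0r.
  apply: ler_sum => V VU.
  rewrite le_eqVlt; apply/orP; left; apply/eqP.
  rewrite -(prod_if_set (U :\: V)).
  have [VA|/subsetPn[i iV iA]] := boolP (V \subset A); last first.
    by rewrite (bigD1 i) //= iV (subsetP VU) // (negPf iA) !mul0r.
  rewrite mul1r; apply: eq_bigr => i _; rewrite inE; case: (boolP (i \in V)) => //= iV.
  by rewrite (subsetP VU) // (subsetP VA).
rewrite exchange_big /=.
apply: le_trans (_ : \sum_(V : {set 'I_n} | V \subset U) ('C(N, a))%:R * ((a%:R / N%:R) ^+ #|V| * nu ^+ #|U :\: V|) <= _).
  apply: ler_sum => V VU; rewrite -mulr_suml mulrA ler_wpM2r ?exprn_ge0 //.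
  rewrite -natr_sum -big_mkcondr sum1_card.
  have -> : #|[pred A : {set 'I_n} | (A \subset J) && (#|A| == a) && (V \subset A)]| =
     #|[set A : {set 'I_n} | [&& A \subset J, V \subset A & #|A| == a]]|.
    by apply: eq_card => A; rewrite !inE -andbA [(_ == _) && _]andbC.
  have [Va|Va] := leqP #|V| a; last first.
    rewrite (_ : #|_| = 0%N) ?mulr_ge0 ?exprn_ge0 ?divr_ge0 //.
    apply/eqP; rewrite cards_eq0; apply/eqP/setP => A; rewrite !inE.
    apply/negP => /and3P[_ /subset_leq_card + /eqP]; lia.
  rewrite card_subsets_containing ?(subset_trans VU) //.
  rewrite expr_div_n mulrA ler_pdivlMr ?exprn_gt0 // -!natrX -!natrM ler_nat.
  by apply: bin_sub_bound; rewrite Va.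
rewrite -mulr_sumr ler_wpM2l // -(prod_if_set U).
rewrite (eq_bigr (fun i => (if i \in U then a%:R / N%:R else 0) + (if i \in U then nu else 1)) (P := predT)); last first.
  by move=> i _; case: ifP => _; rewrite ?add0r.
rewrite bigA_distr [X in _ <= X](bigID (fun V => V \subset U)) /= [X in _ <= _ + X]big1 ?addr0; last first.
  by move=> V /subsetPn[i iV iU]; rewrite (bigD1 i) //= iV (negPf iU) mul0r.
apply: ler_sum => V VU; rewrite -(prod_if_set V) -(prod_if_set (U :\: V)) -big_split /=.
rewrite le_eqVlt; apply/orP; left; apply/eqP; apply: eq_bigr => i _.
rewrite inE; case: (boolP (i \in V)) => //= iV; rewrite ?mulr1 ?mul1r //.
by rewrite (subsetP VU).
Qed.

(** Choose [A] at random among the [a]-subsets of [J], and let [y] equal [x] on [A] and differ from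
    [x] on the rest of [J]. Averaged over [A], the absolute eigenvalue of this operator on the
    Efron-Stein component of a set [U] is at most [eta ^+ |U|]. Noise stability at a rate [sig]
    larger than [16 * eta] then makes the nonconstant part smaller than [E f * E g], so some [A]
    gives a positive correlation. *)
Lemma correlated_pair J f g a p gf gg :
  (1 < m)%N -> (0 < p)%N -> (0 < #|J|)%N -> (a <= #|J|)%N ->
  (forall y, 0 <= f y <= 1) -> (forall y, 0 <= g y <= 1) -> indep (~: J) g ->
  global 2 gf J f -> global 2 gg J g -> 0 < gf -> 0 < gg ->
  gf <= 2 * E f -> gg <= 2 * E g ->
  1 <= gf * 2 ^+ (2 * p) -> 1 <= gg * 2 ^+ (2 * p) ->
  (a%:R / #|J|%:R + m.-1%:R^-1) * (4096 * p%:R ^+ 2) < 1 :> R ->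
  exists x y, [/\ 0 < f x, 0 < g y & #|[set i in J | x i == y i]| = a].
Proof.
move=> m1 p0 J0 aJ f01 g01 gJ glf glg gf0 gg0 gfE ggE gfp ggp small.
have f0 y : 0 <= f y by have /andP[] := f01 y.
have g0 y : 0 <= g y by have /andP[] := g01 y.
set nu : R := m.-1%:R^-1 in small *.
have m10 : 0 < m.-1%:R :> R by rewrite ltr0n -subn1 subn_gt0.
have nu0 : 0 < nu by rewrite invr_gt0.
set eta := _ + nu in small.
have eta0 : 0 < eta by rewrite ltr_wpDl // divr_ge0.
have pR : 1 <= p%:R :> R by rewrite ler1n.
pose sig : R := ((128 * p ^ 2)%:R * 2)^-1.
have sigE : sig = (256 * p%:R ^+ 2)^-1.
  by rewrite /sig natrM natrX; congr (_^-1); ring.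
have sig0 : 0 < sig by rewrite sigE invr_gt0 mulr_gt0 // exprn_gt0 //; lra.
have es : 16 * (eta / sig) < 1 by rewrite sigE invrK; clear -small; lra.
have Ef0 : 0 < E f by clear -gf0 gfE; lra.
have Eg0 : 0 < E g by clear -gg0 ggE; lra.
(* With eigenvalue [- nu = - 1 / (m - 1)] the one-letter kernel is uniform on the letters different
   from the given one; with eigenvalue 1 it is the identity. *)
pose OA A := Op (fun=> 1 : R) (fun i => if i \in J then (if i \in A then 1 else - nu) else 1) g.
pose Dw (h : word -> R) := \sum_(U : {set 'I_n} | (U \subset J) && (U != set0)) eta ^+ #|U| * E (fun x => P J U h x ^+ 2).
have EP (h k : word -> R) U : U \subset J -> E (fun x => h x * P J U k x) = E (fun x => P J U h x * P J U k x).
  by move=> UJ; rewrite -(E_Av m_gt0 J) -[RHS](E_Av m_gt0 J); apply: eq_E => x; rewrite Av_P_sqr.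
(* Only nonempty [U] occur, so [eta ^+ |U| <= (eta / sig) * sig ^+ |U|]: this is where the small
   factor is gained. The 16 is the 4 of noise stability times the square of [gh <= 2 * E h]. *)
have DwE (h : word -> R) (gh : R) : (forall y, 0 <= h y <= 1) -> global 2 gh J h -> gh <= 2 * E h -> 0 < gh ->
   1 <= gh * 2 ^+ (2 * p) -> Dw h <= (eta / sig) * (16 * E h ^+ 2).
  move=> h01 glh ghE gh0 ghp.
  apply: le_trans (_ : (eta / sig) * E (fun x => h x * T J sig h x) <= _); last first.
    rewrite ler_wpM2l ?divr_ge0 ?(ltW eta0) ?(ltW sig0) //.
    rewrite -(E_Av m_gt0 J); apply: le_trans (_ : 4 * gh ^+ 2 <= _); last by nra.
    rewrite -[X in _ <= X](@E_cst R m n m_gt0); apply: E_le => // x.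
    by apply: global_noise_stability => //; rewrite ler1n.
  rewrite -(E_Av m_gt0 J) (@eq_E _ _ _ _ _ (fun x => Av_mul_T J sig h x)) E_sum mulr_sumr.
  rewrite [X in _ <= X](bigID (fun U => U != set0)) /=.
  apply: ler_wpDr.
    apply: sumr_ge0 => U /andP[UJ _]; rewrite mulr_ge0 ?divr_ge0 ?(ltW eta0) ?(ltW sig0) //.
    by apply: E_ge0 => // x; rewrite mulr_ge0 ?exprn_ge0 ?(ltW sig0) ?weight_ge0.
  apply: ler_sum => U /andP[UJ U0]; rewrite E_scale /weight E_Av // EP //.
  rewrite (@eq_E _ _ _ (fun x => P J U h x * P J U h x) (fun x => P J U h x ^+ 2)) // mulrA.
  apply: ler_wpM2r; first by apply: E_ge0 => // x; rewrite sqr_ge0.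
  have : (0 < #|U|)%N by rewrite card_gt0.
  case: #|U| => // k _; rewrite !exprS !mulrA divfK ?gt_eqF //.
  rewrite ler_wpM2l ?(ltW eta0) //; apply: lerXn2r; rewrite ?nnegrE ?(ltW eta0) ?(ltW sig0) //.
  by move: es; rewrite mulrA ltr_pdivrMr // mul1r; lra.
have DfE := DwE _ _ f01 glf gfE gf0 gfp.
have DgE := DwE _ _ g01 glg ggE gg0 ggp.
(* This weight in the AM-GM inequality balances [E f ^+ 2] against [E g ^+ 2], so that the error is
   proportional to [E f * E g]. *)
pose s := E g / E f.
have s0 : 0 < s by rewrite divr_gt0.
have amgm U : U \subset J -> `|E (fun x => f x * P J U g x)| <=
   2^-1 * (s * E (fun x => P J U f x ^+ 2) + s^-1 * E (fun x => P J U g x ^+ 2)).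
  move=> UJ; rewrite EP // -!E_scale -E_add -E_scale.
  rewrite ler_norml -E_opp; apply/andP; split; apply: E_le => // x;
    by have /andP[] := weighted_amgm (P J U f x) (P J U g x) s0.
pose aset A := (A \subset J) && (#|A| == a).
have OAE A : OA A =1 (fun x => \sum_(U : {set 'I_n} | U \subset J) \prod_(i in U) (if i \in A then 1 else - nu) * P J U g x).
  by move=> x; rewrite /OA Op_expand.
have OA_lower A : E f * E g - \sum_(U : {set 'I_n} | (U \subset J) && (U != set0)) \prod_(i in U) (if i \in A then 1 else nu) * (2^-1 * (s * E (fun x => P J U f x ^+ 2) + s^-1 * E (fun x => P J U g x ^+ 2))) <= E (fun x => f x * OA A x).
  rewrite (@eq_E _ _ _ (fun x => f x * OA A x) (fun x => \sum_(U : {set 'I_n} | U \subset J) \prod_(i in U) (if i \in A then 1 else - nu) * (f x * P J U g x))); last first.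
    by move=> x; rewrite OAE mulr_sumr; apply: eq_bigr => U _; rewrite mulrCA.
  rewrite E_sum [X in _ <= X](bigD1 set0) ?sub0set //= big_set0 (@eq_E _ _ _ (fun x => 1 * (f x * P J set0 g x)) (fun x => f x * E g)); last first.
    move=> x; rewrite mul1r; congr (_ * _); rewrite -(Av_setT g x) -(setUCr J) -Av_Av //.
    rewrite -(@eq_Av _ _ _ J g (Av (~: J) g)); last by move=> y; rewrite Av_indep.
    by rewrite AvE //; apply: eq_Op => // i; rewrite !inE ?andbT.
  rewrite E_scaler lerD2l -sumrN; apply: ler_sum => U /andP[UJ _].
  rewrite E_scale; set e := E (fun x => f x * P J U g x); set pr := \prod_(i in U) _; set pr' := \prod_(i in U) _.
  have prE : `|pr'| = pr.
    rewrite normr_prod; apply: eq_bigr => i _; case: ifP => _; first by rewrite normr1.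
    by rewrite normrN ger0_norm // ltW.
  have pr0 : 0 <= pr by rewrite -prE.
  apply: le_trans (_ : - `|pr' * e| <= _); last by rewrite lerNl; apply: le_trans (ler_norm _) _; rewrite normrN.
  by rewrite lerN2 normrM prE ler_wpM2l // amgm.
have total : 0 < \sum_(A | aset A) E (fun x => f x * OA A x).
  have cpos : 0 < ('C(#|J|, a))%:R :> R by rewrite ltr0n bin_gt0.
  apply: lt_le_trans (ler_sum _ (fun A _ => OA_lower A)).
  rewrite big_split /= sumr_const sumrN exchange_big /=.
  have -> : #|[pred A | aset A]| = 'C(#|J|, a).
    by rewrite -cards_draws; apply: eq_card => A; rewrite !inE.
  rewrite -[_ *+ _]mulr_natl subr_gt0.
  apply: le_lt_trans (_ : ('C(#|J|, a))%:R * (\sum_(U : {set 'I_n} | (U \subset J) && (U != set0)) eta ^+ #|U| * (2^-1 * (s * E (fun x => P J U f x ^+ 2) + s^-1 * E (fun x => P J U g x ^+ 2)))) < _).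
    rewrite mulr_sumr; apply: ler_sum => U /andP[UJ _].
    rewrite -mulr_suml mulrA ler_wpM2r //.
      by rewrite mulr_ge0 ?invr_ge0 //; apply: addr_ge0; apply: mulr_ge0; rewrite ?invr_ge0 ?(ltW s0) //; apply: E_ge0 => // x; rewrite sqr_ge0.
    exact: sum_random_set (ltW nu0).
  rewrite ltr_pM2l //.
  have -> : \sum_(U : {set 'I_n} | (U \subset J) && (U != set0)) eta ^+ #|U| * (2^-1 * (s * E (fun x => P J U f x ^+ 2) + s^-1 * E (fun x => P J U g x ^+ 2))) =
     2^-1 * (s * Dw f + s^-1 * Dw g).
    rewrite /Dw !mulr_sumr -big_split mulr_sumr /=; apply: eq_bigr => U _; ring.
  apply: le_lt_trans (_ : 2^-1 * (s * ((eta / sig) * (16 * E f ^+ 2)) + s^-1 * ((eta / sig) * (16 * E g ^+ 2))) < _).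
    apply: ler_wpM2l; first by rewrite invr_ge0.
    by apply: lerD; apply: ler_wpM2l; rewrite // ?invr_ge0 ltW.
  have -> : 2^-1 * (s * ((eta / sig) * (16 * E f ^+ 2)) + s^-1 * ((eta / sig) * (16 * E g ^+ 2))) = (16 * (eta / sig)) * (E f * E g).
    by rewrite /s; field; rewrite !gt_eqF.
  by rewrite gtr_pMl // mulr_gt0.
have [A /andP[AJ /eqP Aa] EA] : exists2 A, aset A & 0 < E (fun x => f x * OA A x).
  apply/exists_inP; apply: contraTT total; rewrite negb_exists_in => /forall_inP h.
  by rewrite -leNgt; apply: sumr_le0 => A /h; rewrite -leNgt.
have [x fx] := E_gt0_ex m_gt0 EA.
have fx0 : 0 < f x.
  by rewrite lt_def f0 andbT; apply: contraTneq fx => ->; rewrite mul0r ltxx.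
have : 0 < OA A x by rewrite -(pmulr_rgt0 _ fx0).
rewrite /OA /Op => hs.
have [y hy] : exists y : word, 0 < (\prod_i ker 1 (if i \in J then if i \in A then 1 else - nu else 1) (x i) (y i)) * g y.
  apply/existsP; apply: contraTT hs; rewrite negb_exists => /forallP h.
  by rewrite -leNgt; apply: sumr_le0 => y _; rewrite leNgt h.
have gy0 : 0 < g y.
  by rewrite lt_def g0 andbT; apply: contraTneq hy => ->; rewrite mulr0 ltxx.
exists x, y; split=> //; rewrite -Aa; apply: eq_card => i; rewrite inE.
have ki : ker 1 (if i \in J then if i \in A then 1 else - nu else 1) (x i) (y i) != 0.
  by apply: contraTneq hy => e; rewrite (bigD1 i) //= e !mul0r ltxx.
apply/andP/idP => [[iJ xy]|iA].
  apply: contraNT ki => iA; rewrite iJ (negPf iA) /ker xy /nu mulr1 opprK.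
  have mE : m%:R = m.-1%:R + 1 :> R by rewrite natr1 prednK.
  rewrite mE; apply/eqP; field; rewrite gt_eqF //= gt_eqF //; lra.
split; first exact: (subsetP AJ).
apply: contraNT ki => xy; rewrite (subsetP AJ) // iA /ker subrr mul0r (negPf xy) mulr0 addr0 //.
Qed.
End CorrelatedPairs.

(** * Cubes, pieces and the greedy decomposition *)

Section Cubes.
Variables (R : realFieldType) (m n : nat).
Hypothesis m_gt0 : (0 < m)%N.
Local Notation word := {ffun 'I_n -> 'I_m}.
Implicit Types (f g : word -> R) (x y z w : word) (A S T : {set 'I_n}) (X Y F : {set word}).

Definition cube S w : {set word} := [set x : word | [forall i in S, x i == w i]].

Definition ind X x : R := (x \in X)%:R.

Definition dens X S w : R := Av (~: S) (ind X) w.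

Lemma cubeP S w x : reflect (forall i, i \in S -> x i = w i) (x \in cube S w).
Proof.
rewrite inE; apply: (iffP forall_inP) => h i iS; first exact/eqP/h.
by apply/eqP/h.
Qed.

Lemma mix_in_cube S x w : mix S x w \in cube S w.
Proof. by apply/cubeP => i iS; rewrite mixE iS. Qed.

Lemma ind_ge0 X x : 0 <= ind X x.
Proof. by rewrite ler0n. Qed.

Lemma ind_le1 X x : ind X x <= 1.
Proof. by rewrite lern1 leq_b1. Qed.

Lemma ind01 X x : 0 <= ind X x <= 1.
Proof. by rewrite ind_ge0 ind_le1. Qed.

Lemma ind_sub X Y x : X \subset Y -> ind X x <= ind Y x.
Proof.
by move=> /subsetP XY; rewrite ler_nat; case: (boolP (x \in X)) => // /XY ->.
Qed.

Lemma E_ind X : E (ind X) = #|X|%:R / (m ^ n)%:R.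
Proof. by rewrite /E mulrC -natr_sum -sum1_card [in RHS]big_mkcond. Qed.

Lemma cube_prod S w x :
  \prod_i ker 1 (i \in S)%:R (w i) (x i) = ind (cube S w) x / (m ^ (n - #|S|))%:R.
Proof.
have m0 : m%:R != 0 :> R by rewrite pnatr_eq0 -lt0n.
rewrite /ind; case: (boolP (x \in _)) => [/cubeP h|]; last first.
  rewrite inE negb_forall => /existsP[i]; rewrite negb_imply => /andP[iS xw].
  by rewrite (bigD1 i) //= iS /ker subrr eq_sym (negPf xw) mul0r mulr0 addr0 !mul0r.
have -> : (n - #|S| = #|~: S|)%N by rewrite -[RHS](addKn #|S|) cardsC card_ord.
rewrite mul1r natrX -exprVn -prodr_const.
rewrite [RHS]big_mkcond; apply: eq_bigr => i _; rewrite inE /ker.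
case: (boolP (i \in S)) => iS /=; first by rewrite h // eqxx subrr mul0r mul1r add0r.
by rewrite subr0 mul0r addr0 mul1r.
Qed.

Lemma densE X S w : dens X S w = #|X :&: cube S w|%:R / (m ^ (n - #|S|))%:R.
Proof.
rewrite /dens AvE // -sum1_card natr_sum mulr_suml [RHS]big_mkcond.
apply: eq_bigr => x _; rewrite (eq_bigr (fun i => ker 1 (i \in S)%:R (w i) (x i))); last first.
  by move=> i _; rewrite inE negbK.
rewrite cube_prod inE /ind; case: (x \in X); rewrite ?mulr0 //=.
by case: (x \in cube S w); rewrite ?mul0r ?mulr1.
Qed.

Lemma dens_E X S w : dens X S w = E (fun x => ind X (mix S x w)).
Proof. by apply: eq_E => y; rewrite mixC. Qed.

Lemma E_cube S w : E (ind (cube S w)) = ((m ^ #|S|)%:R)^-1.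
Proof.
have h : dens setT S w = 1.
  by rewrite /dens -[RHS](Av_cst m_gt0 (~: S) 1 w); apply: eq_Av => y; rewrite /ind inE.
rewrite densE setTI in h.
have Sn : (#|S| <= n)%N by rewrite -[X in (_ <= X)%N](card_ord n) max_card.
have q0 k : (m ^ k)%:R != 0 :> R by rewrite pnatr_eq0 expn_eq0 negb_and -lt0n m_gt0.
rewrite E_ind -[_%:R in LHS](divfK (q0 (n - #|S|)%N)) h mul1r.
by rewrite -[X in _ / (_ ^ X)%:R](subnK Sn) expnD natrM invfM mulrA mulfV ?mul1r.
Qed.

End Cubes.

Section Pieces.
Variables (R : realFieldType) (m n : nat).
Hypothesis m_gt0 : (0 < m)%N.
Local Notation word := {ffun 'I_n -> 'I_m}.
Implicit Types (f g : word -> R) (x y z w : word) (A S T : {set 'I_n}) (X Y F : {set word}).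

(* In [(S, w, X)] only the restriction of [w] to [S] matters, and [X] is meant
   to lie in [cube S w]. *)
Definition piece := ({set 'I_n} * word * {set word})%type.
Implicit Types p q : piece.
Definition supp p := p.1.1.
Definition lbl p := p.1.2.
Definition members p := p.2.
(** Overwriting the coordinates in [supp p] by the label turns the indicator of the piece inside its
    cube into a function on all words that ignores [supp p]. Its mean [mass p] is thus a density
    relative to the cube. *)
Definition pfun p x : R := ind R (members p) (mix (supp p) x (lbl p)).
Definition mass p : R := E (pfun p).

Definition agree_set p q := [set i in supp p :&: supp q | lbl p i == lbl q i].

Lemma pfun01 p x : 0 <= pfun p x <= 1.
Proof. exact: ind01. Qed.

Lemma pfun_ge0 p x : 0 <= pfun p x.
Proof. exact: ind_ge0. Qed.

Lemma mass_dens p : mass p = dens R (members p) (supp p) (lbl p).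
Proof. by rewrite dens_E. Qed.

Lemma mass_ge0 p : 0 <= mass p.
Proof. by apply: E_ge0 => // x; apply: pfun_ge0. Qed.

Lemma mass_le1 p : mass p <= 1.
Proof.
rewrite -(@E_cst R m n m_gt0 1); apply: E_le => // x.
by have /andP[] := pfun01 p x.
Qed.

Lemma massE p : members p \subset cube (supp p) (lbl p) ->
  mass p = E (ind R (members p)) * (m ^ #|supp p|)%:R.
Proof.
move=> h; rewrite mass_dens densE // (setIidPl h) E_ind.
have Sn : (#|supp p| <= n)%N by rewrite -[X in (_ <= X)%N](card_ord n) max_card.
have q0 k : (m ^ k)%:R != 0 :> R by rewrite pnatr_eq0 expn_eq0 negb_and -lt0n m_gt0.
have -> : (m ^ n)%:R = (m ^ (n - #|supp p|))%:R * (m ^ #|supp p|)%:R :> R.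
  by rewrite -natrM -expnD subnK.
by rewrite invfM mulrA divfK.
Qed.

Lemma Av_pfun A p x :
  Av (~: A) (pfun p) x = dens R (members p) (supp p :|: A) (mix (supp p) x (lbl p)).
Proof.
apply: eq_E => y; rewrite /pfun; congr ind; apply/ffunP => i; rewrite !mixE !inE.
by case: (i \in supp p) => //=.
Qed.

(* What the choice of a pair [(S, w)] maximising [#|F :&: cube S w| * (m / K)^|S|]
   provides. *)
Definition spread (K tau : R) p :=
  [/\ members p \subset cube (supp p) (lbl p),
      forall A x, [disjoint A & supp p] -> Av (~: A) (pfun p) x <= K ^+ #|A| * mass p &
      K ^+ #|supp p| * tau < mass p].

Lemma dens_set0 X w : dens R X set0 w = E (ind R X).
Proof. by rewrite /dens setC0 Av_setT. Qed.

Lemma dens_le X Y S w : X \subset Y -> dens R X S w <= dens R Y S w.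
Proof. by move=> XY; apply: Av_le => // x; apply: ind_sub. Qed.

Lemma dens_cubeI X S w : dens R (X :&: cube S w) S w = dens R X S w.
Proof. by rewrite !densE // -setIA setIid. Qed.

(** A cube of maximal score is removed as long as the density exceeds [tau]. Comparing its score
    with that of a further restriction gives globality; comparing it with the empty restriction
    gives the lower bound on the mass. *)
Lemma spread_decomposition (K tau : R) X : 1 <= K -> 0 <= tau ->
  exists (s : seq piece) (Y : {set word}),
    [/\ forall x, ind R X x = ind R Y x + \sum_(p <- s) ind R (members p) x,
        E (ind R Y) <= tau,
        Y \subset X &
        forall p, p \in s -> spread K tau p /\ members p \subset X].
Proof.
move=> K1 tau0; have K0 : 0 < K by lra.
move: {2}#|X| (leqnn #|X|) => k; elim: k X => [|k IH] X Xk.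
  exists [::], X; split=> // [x|]; first by rewrite big_nil addr0.
  by rewrite E_ind; move: Xk; rewrite leqn0 => /eqP->; rewrite mul0r.
have [Xtau|Xtau] := leP (E (ind R X)) tau.
  by exists [::], X; split=> // x; rewrite big_nil addr0.
have [w0 w0X] : exists w, 0 < ind R X w by apply: E_gt0_ex => //; lra.
pose score (a : {set 'I_n} * word) : R := dens R X a.1 a.2 / K ^+ #|a.1|.
case: (@Order.TotalTheory.arg_maxP _ _ _ (set0, w0) predT score isT) => [[S w]] _ smax.
have {}smax S' w' : dens R X S' w' <= K ^+ #|S'| / K ^+ #|S| * dens R X S w.
  have := smax (S', w') isT; rewrite /score /= => h.
  rewrite ler_pdivrMr ?exprn_gt0 // in h.
  by apply: le_trans h _; rewrite mulrAC [K ^+ _ / _ * _]mulrAC [K ^+ _ * _]mulrC.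
have Sdens : K ^+ #|S| * tau < dens R X S w.
  have := smax set0 w; rewrite dens_set0 cards0 expr0 => h.
  rewrite mulrC -ltr_pdivlMr ?exprn_gt0 //; apply: lt_le_trans Xtau (le_trans h _).
  by rewrite mulrC mul1r.
pose p : piece := (S, w, X :&: cube S w).
have pdens : mass p = dens R X S w by rewrite mass_dens /= dens_cubeI.
have sp : spread K tau p.
  split=> [|A x AS|]; first exact: subsetIr.
    rewrite Av_pfun; apply: le_trans (dens_le _ _ (subsetIl _ _)) _.
    apply: le_trans (smax _ _) _; rewrite pdens cardsU setIC (disjoint_setI0 AS) cards0 subn0.
    by rewrite exprD [K ^+ #|S| * _]mulrC mulfK // expf_neq0 // gt_eqF.
  by rewrite pdens.
have [|s [Y [h1 h2 h3 h4]]] := IH (X :\: cube S w).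
  have : (0 < #|X :&: cube S w|)%N.
    rewrite lt0n; apply: contraTneq Sdens => h.
    by rewrite densE // h mul0r -leNgt mulr_ge0 ?exprn_ge0 // ltW.
  by have := cardsID (cube S w) X; lia.
exists (p :: s), Y; split=> //; first 2 last.
- move=> q; rewrite inE => /orP[/eqP->|/h4[? qX]]; first by split=> //; apply: subsetIl.
  by split=> //; apply: subset_trans qX (subsetDl _ _).
- move=> x; rewrite big_cons addrCA -h1 /ind /= in_setI in_setD.
  by case: (x \in X); case: (x \in cube S w); rewrite ?addr0 ?add0r.
by apply: subset_trans h3 (subsetDl _ _).
Qed.

End Pieces.

(** * Agreement between the labels of two spread pieces *)

Section SpreadPairs.
Variables (R : realFieldType) (m n : nat).
Hypothesis m_gt0 : (0 < m)%N.
Local Notation word := {ffun 'I_n -> 'I_m}.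
Local Notation piece := (piece m n).
Implicit Types (f g : word -> R) (x y z w : word) (A S T J : {set 'I_n}) (X Y F : {set word}) (p q : piece).

Lemma E_coord k (c : 'I_m) : E (fun x : word => (x k == c)%:R) = m%:R^-1 :> R.
Proof.
have e (x : word) : (x k == c)%:R = ind R (cube [set k] [ffun=> c]) x.
  rewrite /ind; congr (nat_of_bool _)%:R; apply/eqP/cubeP => [h i|h].
    by rewrite inE => /eqP->; rewrite ffunE.
  by rewrite h ?ffunE // inE.
by rewrite (eq_E e) E_cube // cards1 expn1.
Qed.

Lemma E_pin f k (c : 'I_m) M : (forall x, Av (~: [set k]) f x <= M) ->
  E (fun x => f x * (x k == c)%:R) <= M / m%:R.
Proof.
move=> fM; rewrite -(E_coord k c) -E_scale -(E_Av m_gt0 (~: [set k])).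
apply: E_le => // x.
have -> : Av (~: [set k]) (fun y => f y * (y k == c)%:R) x = Av (~: [set k]) f x * (x k == c)%:R.
  have ih : indep (~: [set k]) (fun x : word => (x k == c)%:R : R).
    by move=> y z; rewrite mixE !inE eqxx.
  rewrite [RHS]mulrC -(Av_indep_mul _ _ ih).
  by apply: eq_Av => y; rewrite mulrC.
by rewrite ler_wpM2r.
Qed.

(** Masses are at most 1, whereas spreadness puts this one above [K ^+ |supp p| * tau]; few
    coordinates can be fixed. *)
Lemma spread_supp_lt (K tau : R) e p : 1 <= K -> spread K tau p -> 1 <= tau * K ^+ e -> (#|supp p| < e)%N.
Proof.
move=> K1 [_ _ h] h1; rewrite ltnNge; apply/negP => es.
have K0 : 0 < K by lra.
have tau0 : 0 < tau by rewrite -(pmulr_lgt0 _ (exprn_gt0 e K0)); lra.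
have : tau * K ^+ e <= K ^+ #|supp p| * tau.
  by rewrite mulrC ler_wpM2r ?(ltW tau0) // ler_weXn2l.
by have := mass_le1 R m_gt0 p; lra.
Qed.

(** Keeps the members of [p] that differ from the label of [q] at every coordinate fixed by [q]
    only. Once both pieces are cleared of each other, their words agree inside the two supports
    exactly on [agree_set p q]. *)
Definition clear p q x : R := pfun R p x * \prod_(k in supp q :\: supp p) (x k != lbl q k)%:R.
Definition cleared p q := Av (supp p :|: supp q) (clear p q).

Lemma clear01 p q x : 0 <= clear p q x <= 1.
Proof.
have /andP[h0 h1] := pfun01 R p x.
have : 0 <= (\prod_(k in supp q :\: supp p) (x k != lbl q k)%:R : R) <= 1.
  by rewrite prodr_ge0 //= prodr_ile1 // => k _; rewrite ler0n lern1 leq_b1.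
by move=> /andP[h2 h3]; rewrite /clear mulr_ge0 //= mulr_ile1.
Qed.

Lemma cleared01 p q x : 0 <= cleared p q x <= 1.
Proof.
rewrite /cleared; apply/andP; split.
  by apply: Av_ge0 => // y; have /andP[] := clear01 p q y.
by apply: Av_le_cst => // y; have /andP[] := clear01 p q y.
Qed.

(** Union bound: by globality each forbidden letter removes at most a proportion [K / m] of the
    mass. *)
Lemma clear_lower (K tau : R) p q : 1 <= K -> spread K tau p ->
  mass R p * (1 - #|supp q|%:R * K / m%:R) <= E (cleared p q).
Proof.
move=> K1 [_ glob _]; rewrite /cleared E_Av //.
apply: le_trans (_ : E (fun x => pfun R p x - \sum_(k in supp q :\: supp p) pfun R p x * (x k == lbl q k)%:R) <= _); last first.
  apply: E_le => // x; rewrite /clear -mulr_sumr -[X in X - _]mulr1 -mulrBr.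
  apply: ler_wpM2l; first exact: pfun_ge0.
  have h0 : 0 <= \sum_(i in supp q :\: supp p) (x i == lbl q i)%:R :> R by apply: sumr_ge0.
  case: (boolP [exists k in supp q :\: supp p, x k == lbl q k]) => [/exists_inP[k kD xk]|].
    rewrite [X in _ <= X](bigD1 k) //= xk mul0r (bigD1 k) //= xk.
    have : 0 <= \sum_(i in supp q :\: supp p | i != k) (x i == lbl q i)%:R :> R by apply: sumr_ge0.
    by rewrite (_ : true%:R = 1 :> R) //; lra.
  rewrite negb_exists_in => /forall_inP h; rewrite big1 => [|k kD]; last by rewrite (negPf (h k kD)).
  by rewrite big1 ?subr0 // => k kD; rewrite (h k kD).
rewrite E_sub E_sum mulrBr mulr1 lerD2l lerN2.
have h k : k \in supp q :\: supp p -> E (fun x => pfun R p x * (x k == lbl q k)%:R) <= K * mass R p / m%:R.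
  move=> kD; apply: E_pin => x; apply: le_trans (glob [set k] x _) _.
    by rewrite disjoints1; move: kD; rewrite inE => /andP[].
  by rewrite cards1 expr1.
apply: le_trans (ler_sum _ h) _; rewrite sumr_const -[X in X <= _]mulr_natl.
have : #|supp q :\: supp p|%:R <= #|supp q|%:R :> R.
  by rewrite ler_nat subset_leq_card // subsetDl.
move=> h1; apply: le_trans (_ : #|supp q|%:R * (K * mass R p / m%:R) <= _).
  by rewrite ler_wpM2r // divr_ge0 // mulr_ge0 ?mass_ge0 //; lra.
by rewrite le_eqVlt; apply/orP; left; apply/eqP; ring.
Qed.

Lemma cleared_global (K tau : R) p q : 1 <= K -> spread K tau p ->
  global K (mass R p) (~: (supp p :|: supp q)) (cleared p q).
Proof.
move=> K1 [_ glob _] S x SJ; rewrite /cleared Av_Av //.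
have -> : (~: (supp p :|: supp q) :\: S) :|: (supp p :|: supp q) = ~: S.
  apply/setP => i; rewrite !inE; have /implyP := subsetP SJ i; rewrite !inE negb_or.
  by case: (i \in S); case: (i \in supp p); case: (i \in supp q).
apply: le_trans (glob S x _); last first.
  apply/pred0P => i /=; apply/negP => /andP[iS ip].
  by have := subsetP SJ i iS; rewrite !inE ip.
apply: Av_le => // y; rewrite /clear -[X in _ <= X]mulr1 ler_wpM2l ?pfun_ge0 //.
by rewrite prodr_ile1 // => k _; rewrite ler0n lern1 leq_b1.
Qed.

Lemma cleared_witness p q x : 0 < cleared p q x ->
  exists x', [/\ x' \in members p, forall i, i \in supp p -> x' i = lbl p i,
    forall i, i \in supp q :\: supp p -> x' i != lbl q i &
    forall i, i \notin supp p :|: supp q -> x' i = x i].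
Proof.
move=> /E_gt0_ex -/(_ m_gt0)[y]; set z := mix _ x y => hz.
have h1 : pfun R p z != 0 by apply: contraTneq hz; rewrite /clear => ->; rewrite mul0r ltxx.
exists (mix (supp p) z (lbl p)); split=> [|i ip|i|i].
- by move: h1; rewrite /pfun /ind; case: (_ \in _); rewrite ?eqxx.
- by rewrite mixE ip.
- rewrite !inE => /andP[ip iq]; rewrite mixE (negPf ip).
  apply: contraTneq hz => e; rewrite /clear (bigD1 i) /= ?inE ?ip //.
  by rewrite e eqxx mul0r mulr0 ltxx.
rewrite inE negb_or => /andP[ip iq]; rewrite mixE (negPf ip) /z mixE inE.
by rewrite (negPf ip) (negPf iq).
Qed.

(** If the labels agree in only [c < t] places, clearing makes [c] the number of agreements inside
    the supports. [correlated_pair] then supplies [a = t - 1 - c] agreements on the remaining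
    coordinates [J], for the forbidden total [t - 1]. At most half of each mass is lost by clearing,
    because [8 * e <= m]. *)
Lemma spread_pair_agree F t p q (tau : R) e :
  avoiding (t - 1) F -> (0 < t)%N -> (0 < e)%N -> (8 * e <= m)%N -> (1 < m)%N ->
  spread 2 tau p -> spread 2 tau q -> members p \subset F -> members q \subset F ->
  1 <= tau * 2 ^+ (2 * e) -> (4 * e + t <= n)%N ->
  (t%:R / (n - 4 * e)%:R + m.-1%:R^-1) * (4096 * e%:R ^+ 2) < 1 :> R ->
  (t <= #|agree_set p q|)%N.
Proof.
move=> avF t0 e0 em m1 sp sq pF qF htau en small; rewrite leqNgt; apply/negP => ct.
have two1 : 1 <= 2 :> R by rewrite ler1n.
have pe := spread_supp_lt two1 sp htau.
have qe := spread_supp_lt two1 sq htau.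
set J := ~: (supp p :|: supp q).
have Jn : (n - 4 * e <= #|J|)%N.
  have := cardsC (supp p :|: supp q); rewrite card_ord.
  have [+ _] := leq_card_setU (supp p) (supp q); rewrite -/J.
  by clear -pe qe; lia.
pose a := (t - 1 - #|agree_set p q|)%N.
have an : (a <= n - 4 * e)%N by rewrite /a; clear -en; lia.
have mR : 0 < m%:R :> R by rewrite ltr0n.
have tau0 : 0 <= tau.
  have h2 := exprn_gt0 (2 * e) (ltr0n _ _ : 0 < 2 :> R).
  by rewrite -(pmulr_lge0 _ h2); lra.
have massgt (r : piece) : spread 2 tau r -> 0 < mass R r.
  by move=> [_ _ h]; apply: le_lt_trans h; apply: mulr_ge0 => //; apply: exprn_ge0.
have half (r r' : piece) : spread 2 tau r -> (#|supp r'| < 2 * e)%N -> mass R r <= 2 * E (cleared r r').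
  move=> sr r'e; have := clear_lower r' two1 sr.
  have : #|supp r'|%:R * 2 / m%:R <= 2^-1 :> R.
    rewrite ler_pdivrMr // -(ler_nat R) in em *.
    have : #|supp r'|%:R <= (2 * e)%:R :> R by rewrite ler_nat ltnW.
    by rewrite !natrM in em *; clear -em; lra.
  have := massgt _ sr; clear => h1 h2 h3.
  have : mass R r * 2^-1 <= mass R r * (1 - #|supp r'|%:R * 2 / m%:R).
    by rewrite ler_pM2l //; lra.
  by lra.
have big (r : piece) : spread 2 tau r -> 1 <= mass R r * 2 ^+ (2 * e).
  move=> sr; apply: le_trans htau _; rewrite ler_wpM2r ?exprn_ge0 //.
  have [_ _ /ltW h] := sr; apply: le_trans h.
  by rewrite ler_peMl // exprn_ege1 // ler1n.
have J0 : (0 < #|J|)%N by clear -Jn en t0; lia.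
have n0 : 0 < (n - 4 * e)%:R :> R by rewrite ltr0n; clear -en t0; lia.
have [||||x [y [fx gy xy]]] := @correlated_pair R m n m_gt0 J (cleared p q) (cleared q p) a e (mass R p) (mass R q) m1 e0 J0 _ (cleared01 p q) (cleared01 q p) _ (cleared_global two1 sp) _ (massgt _ sp) (massgt _ sq) (half _ _ sp qe) (half _ _ sq pe) (big _ sp) (big _ sq).
- exact: leq_trans an Jn.
- by rewrite /J setCK setUC; apply: indep_Av.
- by rewrite /J setUC; apply: cleared_global sq.
- apply: le_lt_trans small; rewrite ler_wpM2r ?mulr_ge0 ?exprn_ge0 // lerD2r.
  rewrite ler_pdivrMr ?ltr0n // mulrAC ler_pdivlMr //.
  rewrite -!natrM ler_nat leq_mul //; rewrite /a; clear; lia.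
have [x' [x'p x'l x'q x'J]] := cleared_witness fx.
have [y' [y'q y'l y'p y'J]] := cleared_witness gy.
apply: (avF x' y'); [exact: (subsetP pF) | exact: (subsetP qF) |].
have -> : agr x' y' = (#|[set i in J | x i == y i]| + #|agree_set p q|)%N.
  have d0 : [set i in J | x i == y i] :&: agree_set p q = set0.
    by apply/setP => i; rewrite !inE; case: (i \in supp p); case: (i \in supp q); rewrite ?andbF.
  rewrite /agr -cardsUI d0 cards0 addn0.
  apply: eq_card => i; rewrite !inE.
  case: (boolP (i \in supp p)) => ip; case: (boolP (i \in supp q)) => iq /=.
  - by rewrite x'l // y'l.
  - by rewrite x'l // eq_sym (negPf (y'p i _)) // inE iq.
  - by rewrite y'l // (negPf (x'q i _)) // inE ip.
  by rewrite orbF x'J ?y'J // inE ?(negPf ip) (negPf iq).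
by rewrite xy /a; clear -ct t0; lia.
Qed.
End SpreadPairs.

(** * Families of pieces whose labels agree pairwise *)

Lemma bin_le_exp N k : ('C(N, k) <= N ^ k)%N.
Proof.
rewrite bin_ffactd; apply: leq_trans (leq_div _ _) _.
rewrite ffact_prod -[X in (_ <= X ^ _)%N]card_ord.
rewrite (_ : (#|'I_N| ^ k = \prod_(i < k) N)%N); last by rewrite prod_nat_const !card_ord.
by apply: leq_prod => i _; apply: leq_subr.
Qed.

Lemma exists_subset_card (T : finType) (B : {set T}) k : (k <= #|B|)%N ->
  exists2 A : {set T}, A \subset B & #|A| = k.
Proof.
rewrite -bin_gt0 -cards_draws => /card_gt0P[A]; rewrite inE => /andP[AB /eqP Ak].
by exists A.
Qed.

Lemma sum_subset_exp (R : realFieldType) n (U : {set 'I_n}) (a : R) :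
  \sum_(V : {set 'I_n} | V \subset U) a ^+ #|V| = (1 + a) ^+ #|U|.
Proof.
rewrite -(prod_if_set U) addrC.
rewrite (eq_bigr (fun i => (if i \in U then a else 0) + 1) (P := predT)); last first.
  by move=> i _; case: ifP => _; rewrite ?add0r.
rewrite bigA_distr [X in _ = X](bigID (fun V : {set 'I_n} => V \subset U)) /= [X in _ = _ + X]big1 ?addr0; last first.
  by move=> V /subsetPn[i iV iU]; rewrite (bigD1 i) //= iV (negPf iU) mul0r.
apply: eq_bigr => V VU; rewrite -(prod_if_set V); apply: eq_bigr => i _.
by case: (boolP (i \in V)) => // iV; rewrite (subsetP VU).
Qed.

Section IntersectingPieces.
Variables (R : realFieldType) (m n : nat).
Hypothesis m_gt0 : (0 < m)%N.
Local Notation word := {ffun 'I_n -> 'I_m}.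
Local Notation piece := (piece m n).
Implicit Types (f g : word -> R) (x y z w : word) (A S T J D : {set 'I_n}) (X Y F : {set word}) (p q : piece).

(** A word with the label of [l] matches the label of [p] in at least [k = |T|] places, so every
    place missed in [T] is made up for outside [T]. *)
Lemma agree_extra l p T D x k : x \in cube (supp l) (lbl l) -> T \subset supp p ->
  #|T| = k -> (k <= #|agree_set l p|)%N -> D = [set i in T | x i != lbl p i] ->
  exists2 D1 : {set 'I_n}, D1 \subset supp p :\: T & #|D1| = #|D| /\ forall i, i \in D1 -> x i = lbl p i.
Proof.
move=> /cubeP xl Tp Tk kl DE.
pose A1 := [set i in supp p | x i == lbl p i].
have h1 : (k <= #|A1|)%N.
  apply: leq_trans kl (subset_leq_card _); apply/subsetP => i; rewrite !inE.
  by move=> /andP[/andP[il ip] /eqP e]; rewrite ip xl // e eqxx.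
have h2 : A1 :&: T = T :\: D.
  apply/setP => i; rewrite DE !inE; case: (boolP (i \in T)) => iT; rewrite ?andbF //=.
  by rewrite (subsetP Tp) // ?andbT /= ?andbT ?negbK.
have h3 : (#|D| <= #|A1 :\: T|)%N.
  have DT : D \subset T by apply/subsetP => i; rewrite DE inE => /andP[].
  have := cardsID T A1; rewrite h2 cardsD (setIidPr DT) Tk.
  have := subset_leq_card DT; rewrite Tk; clear -h1; lia.
have [D1 D1A D1c] := exists_subset_card h3.
exists D1; first by apply: subset_trans D1A _; apply/subsetP => i; rewrite !inE => /andP[-> /andP[->]].
by split=> // i /(subsetP D1A); rewrite !inE => /andP[_ /andP[_ /eqP]].
Qed.

(** Take [p] and [q] with the fewest agreements, and [T] their agreement set. A word that misses the
    label exactly on a nonempty [D] in [T] must match [p] on [|D|] further places and [q] on [|D|]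
    further places. These are disjoint, as the labels of [p] and [q] disagree wherever both are
    defined outside [T]. So the word lies in one of at most [r ^ (2 |D|)] cubes fixing [|T| + |D|]
    coordinates; summing over [D] gives the binomial expression. *)
Lemma intersecting_pieces (s : seq piece) X t r :
  (forall p, p \in s -> members p \subset cube (supp p) (lbl p) /\ (#|supp p| <= r)%N) ->
  (forall p q, p \in s -> q \in s -> (t <= #|agree_set p q|)%N) ->
  s != [::] -> (forall x, x \in X -> exists2 p, p \in s & x \in members p) ->
  exists T z, [/\ (t <= #|T|)%N, (#|T| <= r)%N &
    E (ind R (X :\: cube T z)) <= (m ^ #|T|)%:R^-1 * ((1 + r%:R ^+ 2 / m%:R) ^+ #|T| - 1)].
Proof.
move=> hs ht s0 hX.
have m0 : m%:R != 0 :> R by rewrite pnatr_eq0 -lt0n.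
pose P k := has (fun p => has (fun q => #|agree_set p q| == k) s) s.
have exP : exists k, P k.
  case: s s0 hs ht hX @P => // p s _ _ _ _ P; exists #|agree_set p p|.
  by rewrite /P /= eqxx.
case: (ex_minnP exP) => k /hasP[p ps /hasP[q qs /eqP pqk]] kmin.
have {}kmin l l' : l \in s -> l' \in s -> (k <= #|agree_set l l'|)%N.
  by move=> ls l's; apply: kmin; apply/hasP; exists l => //; apply/hasP; exists l'.
set T := agree_set p q in pqk; set z := lbl p.
have Tp : T \subset supp p by apply/subsetP => i; rewrite !inE => /andP[/andP[]].
have Tq : T \subset supp q by apply/subsetP => i; rewrite !inE => /andP[/andP[]].
have [_ pr] := hs p ps; have [_ qr] := hs q qs.
exists T, z; split; first exact: ht.
  exact: leq_trans (subset_leq_card Tp) pr.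
pose big3 D D1 D2 := (T :\: D) :|: D1 :|: D2.
pose ok D (DD : {set 'I_n} * {set 'I_n}) := [&& DD.1 \subset supp p, #|DD.1| == #|D|, DD.2 \subset supp q, #|DD.2| == #|D| & #|big3 D DD.1 DD.2| == (#|T| + #|D|)%N].
apply: le_trans (_ : E (fun x => \sum_(D : {set 'I_n} | (D \subset T) && (D != set0)) \sum_(DD : {set 'I_n} * {set 'I_n} | ok D DD) ind R (cube (big3 D DD.1 DD.2) (mix DD.2 (lbl p) (lbl q))) x) <= _).
  apply: E_le => // x; rewrite /ind; case: (boolP (x \in X :\: cube T z)); last first.
    by move=> _; apply: sumr_ge0 => D _; apply: sumr_ge0 => DD _.
  rewrite in_setD => /andP[xT /hX[l ls xl]].
  have [/subsetP/(_ x xl) xcl _] := hs l ls.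
  pose D := [set i in T | x i != lbl p i].
  have DT : D \subset T by apply/subsetP => i; rewrite inE => /andP[].
  have D0 : D != set0.
    apply: contraNneq xT => D0; apply/cubeP => i iT.
    have : i \notin D by rewrite D0 in_set0.
    by rewrite in_set iT negbK => /eqP.
  have DE0 : D = [set i in T | x i != lbl p i] by [].
  have DEq : D = [set i in T | x i != lbl q i].
    apply/setP => i; rewrite !inE; case: (boolP (i \in supp p)) => //= ip.
    by case: (boolP (i \in supp q)) => //= iq; case: eqP => // ->.
  have [D1 D1p [D1c D1x]] := agree_extra xcl Tp pqk (kmin _ _ ls ps) DE0.
  have [D2 D2q [D2c D2x]] := agree_extra xcl Tq pqk (kmin _ _ ls qs) DEq.
  have d12 : D1 :&: D2 = set0.
    apply/setP => i; rewrite in_setI in_set0; apply/negP => /andP[i1 i2].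
    have := subsetP D1p i i1; have := subsetP D2q i i2; rewrite !in_setD => /andP[_ iq] /andP[iT ip].
    by move: iT; rewrite /T inE in_setI ip iq /= -D1x // -D2x // eqxx.
  have dT1 : (T :\: D) :&: D1 = set0.
    apply/setP => i; rewrite in_setI in_set0; apply/negP => /andP[]; rewrite in_setD => /andP[_ iT] i1.
    by have := subsetP D1p i i1; rewrite in_setD iT.
  have dT2 : (T :\: D :|: D1) :&: D2 = set0.
    rewrite setIUl d12 setU0; apply/setP => i; rewrite in_setI in_set0; apply/negP => /andP[]; rewrite in_setD => /andP[_ iT] i2.
    by have := subsetP D2q i i2; rewrite in_setD iT.
  have card3 : #|big3 D D1 D2| = (#|T| + #|D|)%N.
    rewrite /big3 cardsU dT2 cards0 cardsU dT1 cards0 D1c D2c cardsD (setIidPr DT).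
    by have := subset_leq_card DT; clear; lia.
  rewrite (bigD1 D) ?DT ?D0 //= (bigD1 (D1, D2)) /=; last first.
    rewrite /ok /= D1c D2c card3 !eqxx !andbT (subset_trans D1p (subsetDl _ _)) /=.
    by rewrite (subset_trans D2q (subsetDl _ _)).
  have -> : x \in cube (big3 D D1 D2) (mix D2 (lbl p) (lbl q)).
    apply/cubeP => i; rewrite mixE; case: (boolP (i \in D2)) => i2; first by rewrite D2x.
    rewrite /big3 !in_setU (negPf i2) orbF in_setD => /orP[/andP[iD iT]|/D1x //].
    by move: iD; rewrite in_set iT negbK => /eqP.
  rewrite -addrA lerDl addr_ge0 //; first by apply: sumr_ge0 => DD _.
  by apply: sumr_ge0 => D' _; apply: sumr_ge0 => DD _.
rewrite E_sum mulrBr mulr1 -sum_subset_exp.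
rewrite [X in _ <= _ * X - _](bigD1 set0) ?sub0set //= cards0 expr0 mulrDr mulr1 addrAC subrr add0r mulr_sumr.
apply: ler_sum => D /andP[DT D0]; rewrite E_sum.
apply: le_trans (_ : \sum_(DD : {set 'I_n} * {set 'I_n} | (DD.1 \in [set A : {set 'I_n} | A \subset supp p & #|A| == #|D|]) && (DD.2 \in [set A : {set 'I_n} | A \subset supp q & #|A| == #|D|])) (m ^ (#|T| + #|D|))%:R^-1 <= _).
  rewrite [X in _ <= X](bigID (ok D)) /=; apply: ler_wpDr.
    by apply: sumr_ge0 => DD _; rewrite invr_ge0.
  rewrite [X in _ <= X](eq_bigl (ok D)); last first.
    move=> DD; rewrite /ok !inE; case: (_ \subset _) => //=; case: (_ == _) => //=; case: (_ \subset _) => //=.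
    by case: (_ == _).
  by apply: ler_sum => DD /and5P[_ _ _ _ /eqP e]; rewrite E_cube // e.
rewrite -(pair_big (fun A => A \in _) (fun A => A \in _) (fun _ _ => (m ^ (#|T| + #|D|))%:R^-1)) /=.
rewrite !sumr_const !cards_draws -mulrnA -[_ *+ (_ * _)]mulr_natl.
have cb l : (#|supp l| <= r)%N -> ('C(#|supp l|, #|D|) <= r ^ #|D|)%N.
  by move=> lr; apply: leq_trans (bin_le_exp _ _) _; rewrite leq_exp2r ?lr // card_gt0.
apply: le_trans (_ : (r ^ #|D| * r ^ #|D|)%:R * (m ^ (#|T| + #|D|))%:R^-1 <= _).
  by rewrite ler_wpM2r ?invr_ge0 // ler_nat leq_mul ?cb.
rewrite expnD !natrM !natrX invfM mulrCA ler_wpM2l ?invr_ge0 ?exprn_ge0 //.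
by rewrite expr_div_n -exprM mulnC exprM expr2.
Qed.
End IntersectingPieces.

(** * Isoperimetry and stability around a nearly full cube *)

Lemma disjoint_family (T : finType) (J : {set T}) a l : (l * a <= #|J|)%N ->
  exists As : seq {set T}, [/\ size As = l, forall A, A \in As -> A \subset J /\ #|A| = a &
    pairwise (fun A B : {set T} => [disjoint A & B]) As].
Proof.
elim: l J => [|l IH] J lJ; first by exists [::].
have [A AJ Aa] : exists2 A : {set T}, A \subset J & #|A| = a.
  by apply: exists_subset_card; apply: leq_trans lJ; rewrite mulSn leq_addr.
have [|As [As1 As2 As3]] := IH (J :\: A).
  by rewrite cardsD (setIidPr AJ) Aa leq_subRL ?(leq_trans _ lJ) // mulSn ?leq_addr.
exists (A :: As); split=> /=; first by rewrite As1.
  move=> B; rewrite inE => /orP[/eqP->|/As2[BJ ->]] //.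
  by split=> //; apply: subset_trans BJ (subsetDl _ _).
rewrite As3 andbT; apply/allP => B /As2[BJ _].
apply/pred0P => i /=; apply/negP => /andP[iA /(subsetP BJ)].
by rewrite inE iA.
Qed.

(** Only the two smallest values [s <= s'] of [d] matter: [be] is at most [s ^+ k] except at the
    minimiser of [d], where it is at most [s' ^+ k]. The mean of [d] is at least
    [s' - (s' - s) / m], and Bernoulli compares the two bounds precisely because [k < m]. *)
Lemma iso_step (R : realFieldType) m k (d be : 'I_m -> R) : (1 < m)%N -> (k < m)%N ->
  (forall b, 0 <= d b) -> (forall b c, b != c -> be c <= d b ^+ k) ->
  m%:R^-1 * \sum_c be c <= (m%:R^-1 * \sum_b d b) ^+ k.
Proof.
move=> m1 km d0 hbe; have m0 : (0 < m)%N by apply: ltn_trans m1.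
case: k km hbe => [|k] km hbe.
  rewrite expr0 mulrC ler_pdivrMr ?ltr0n // mul1r.
  apply: le_trans (_ : \sum_(c < m) 1 <= _); last by rewrite sumr_const card_ord.
  apply: ler_sum => c _; have [b bc] : exists b : 'I_m, b != c.
    have [->|c0] := eqVneq c (Ordinal m0); last by exists (Ordinal m0); rewrite eq_sym.
    by exists (Ordinal m1).
  by have := hbe b c bc; rewrite expr0.
case: (@Order.TotalTheory.arg_minP _ _ _ (Ordinal m0) predT d isT) => b0 _ b0min.
have [b1' b1n] : exists b : 'I_m, b != b0.
  have [->|c0] := eqVneq b0 (Ordinal m0); last by exists (Ordinal m0); rewrite eq_sym.
  by exists (Ordinal m1).
case: (@Order.TotalTheory.arg_minP _ _ _ b1' (fun b => b != b0) d b1n) => b1 b1b0 b1min.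
set s := d b0; set s' := d b1.
have s0 : 0 <= s by exact: d0.
have ss' : s <= s' by exact: b0min.
have sumbe : \sum_c be c <= m.-1%:R * s ^+ k.+1 + s' ^+ k.+1.
  rewrite (bigD1 b0) //= addrC lerD ?hbe //.
  have -> : m.-1%:R * s ^+ k.+1 = \sum_(i < m | i != b0) s ^+ k.+1.
    by rewrite sumr_const cardC1 card_ord -[X in _ = X]mulr_natl.
  by apply: ler_sum => c cb0; apply: hbe; rewrite eq_sym.
have sumd : s + m.-1%:R * s' <= \sum_b d b.
  rewrite (bigD1 b0) //= lerD2l.
  have -> : m.-1%:R * s' = \sum_(i < m | i != b0) s'.
    by rewrite sumr_const cardC1 card_ord -[X in _ = X]mulr_natl.
  by apply: ler_sum => c cb0; apply: b1min.
have mR : 1 < m%:R :> R by rewrite ltr1n.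
have mE : m%:R = m.-1%:R + 1 :> R by rewrite natr1 prednK.
have mi : 0 < m%:R^-1 :> R by rewrite invr_gt0; lra.
have mm : m%:R^-1 * m%:R = 1 :> R by rewrite mulVf // gt_eqF //; lra.
set y := m%:R^-1 * (s' - s).
have mean : s' - y <= m%:R^-1 * \sum_b d b.
  have -> : s' - y = m%:R^-1 * (s + m.-1%:R * s').
    rewrite /y (_ : m.-1%:R = m%:R - 1); last by rewrite mE; ring.
    by rewrite -{1}[s']mul1r -{1}mm; ring.
  by rewrite ler_wpM2l // ltW.
have y0 : 0 <= y by rewrite mulr_ge0 ?(ltW mi) //; lra.
have ys' : y <= s'.
  apply: le_trans (_ : s' - s <= _); last by lra.
  by apply: ler_piMl; rewrite ?invf_le1 ?ltr0n //; lra.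
apply: le_trans (_ : (s' - y) ^+ k.+1 <= _); last first.
  by apply: lerXn2r; rewrite ?nnegrE //; lra.
apply: le_trans (ler_wpM2l (ltW mi) sumbe) _.
have [s'0|s'0] := leP s' 0.
  have -> : s' = 0 by lra.
  have -> : s = 0 by lra.
  have -> : y = 0 by lra.
  by rewrite subr0 !expr0n /= !mulr0 add0r mulr0.
have bern : s' ^+ k.+1 - k.+1%:R * s' ^+ k * y <= (s' - y) ^+ k.+1.
  have := @bernoulli R (- (y / s')) k.+1.
  rewrite lerNl opprK ler_pdivrMr // mul1r => /(_ ys') h.
  have -> : s' - y = s' * (1 + - (y / s')) by field; rewrite gt_eqF.
  rewrite exprMn.
  have -> : s' ^+ k.+1 - k.+1%:R * s' ^+ k * y = s' ^+ k.+1 * (1 + k.+1%:R * - (y / s')).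
    by rewrite exprS; field; rewrite gt_eqF.
  by rewrite ler_wpM2l // exprn_ge0 // ltW.
apply: le_trans bern.
have h1 : s ^+ k.+1 <= s' ^+ k * s.
  by rewrite exprSr ler_wpM2r //; apply: lerXn2r; rewrite ?nnegrE //; lra.
have kmR : k.+1%:R <= m.-1%:R :> R by rewrite ler_nat -ltnS prednK.
have s'k : 0 <= s' ^+ k by rewrite exprn_ge0 // ltW.
have h2 : k.+1%:R * (s' ^+ k * (s' - s)) <= m.-1%:R * (s' ^+ k * (s' - s)).
  by rewrite ler_wpM2r // mulr_ge0 //; lra.
have h3 : m.-1%:R * (s' ^+ k * (s' - s)) <= m.-1%:R * (s' ^+ k.+1 - s ^+ k.+1).
  by rewrite ler_wpM2l // exprSr; lra.
rewrite /y (_ : k.+1%:R * s' ^+ k * (m%:R^-1 * (s' - s)) = m%:R^-1 * (k.+1%:R * (s' ^+ k * (s' - s)))); last by ring.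
have e : s' ^+ k.+1 = m%:R^-1 * (m%:R * s' ^+ k.+1) by rewrite mulrA mm mul1r.
rewrite [X in _ <= X - _]e -mulrBr ler_wpM2l ?(ltW mi) //.
by rewrite mE; lra.
Qed.

Section Isoperimetry.
Variables (R : realFieldType) (m n : nat).
Hypothesis m_gt0 : (0 < m)%N.
Local Notation word := {ffun 'I_n -> 'I_m}.
Implicit Types (f g : word -> R) (x y z w : word) (A S T J D : {set 'I_n}) (X Y F : {set word}).

Definition upd x j (c : 'I_m) : word := [ffun i => if i == j then c else x i].

Lemma Av1 j f x : Av [set j] f x = m%:R^-1 * \sum_c f (upd x j c).
Proof.
transitivity (E (fun y : word => \sum_c f (upd x j c) * (y j == c)%:R)).
  apply: eq_E => y; rewrite (bigD1 (y j)) //= eqxx mulr1 big1 ?addr0; last first.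
    by move=> c; rewrite eq_sym => /negPf->; rewrite mulr0.
  by congr f; apply/ffunP => i; rewrite !ffunE inE; case: eqP => // ->.
rewrite E_sum mulr_sumr; apply: eq_bigr => c _.
by rewrite E_scale E_coord // mulrC.
Qed.

(* Iterating the one-coordinate inequality over [J]: fibres with no pair
   disagreeing on all of [J] cannot both be dense. *)
Lemma isoperimetry F J k x y : (1 < m)%N -> (k < m)%N ->
  (forall x' y', x' \in F -> y' \in F -> (forall i, i \notin J -> x' i = x i) ->
     (forall i, i \notin J -> y' i = y i) -> exists2 i, i \in J & x' i = y' i) ->
  Av J (ind R F) y <= (1 - Av J (ind R F) x) ^+ k.
Proof.
move=> m1 km; move: {2}#|J| (erefl #|J|) => c; elim: c J x y => [|c IH] J x y Jc.
  move/eqP: Jc; rewrite cards_eq0 => /eqP-> h; rewrite !Av_set0 //.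
  have hy := ind_le1 R F y; rewrite /ind in hy *.
  case: (boolP (x \in F)) => xF; last by rewrite subr0 expr1n.
  case: (boolP (y \in F)) => yF; last by rewrite subrr exprn_ge0.
  by have [||i] := h x y xF yF => //; rewrite inE.
move=> h; have [j jJ] : exists j, j \in J by apply/set0Pn; rewrite -cards_eq0 Jc.
have jJ' : j \notin J :\ j by rewrite !inE eqxx.
have J'c : #|J :\ j| = c by move: Jc; rewrite (cardsD1 j) jJ => -[].
move: (J :\ j) jJ' J'c (setD1K jJ) h => J' jJ' J'c <- h {jJ Jc}.
rewrite -!Av_Av // !Av1.
have mn0 : m%:R != 0 :> R by rewrite pnatr_eq0 -lt0n.
rewrite (_ : 1 - _ = m%:R^-1 * \sum_b (1 - Av J' (ind R F) (upd x j b))); last first.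
  by rewrite sumrB mulrBr sumr_const card_ord mulVf //.
(* When the letters at [j] differ, the agreement promised in [j |: J'] has to lie in [J'], so the
   induction hypothesis applies to this pair of fibres. *)
apply: iso_step => // [b|b b' bb'].
  by rewrite subr_ge0; apply: Av_le_cst => // z; apply: ind_le1.
apply: IH => // x' y' x'F y'F x'x y'y.
have [i|i|i iJ xy] := h x' y' x'F y'F.
- by rewrite !inE negb_or => /andP[ij iJ]; rewrite x'x // ffunE (negPf ij).
- by rewrite !inE negb_or => /andP[ij iJ]; rewrite y'y // ffunE (negPf ij).
exists i => //; move: iJ; rewrite !inE => /orP[/eqP ij|//].
by move: xy; rewrite ij x'x // y'y // !ffunE eqxx => e; rewrite e eqxx in bb'.
Qed.

End Isoperimetry.

Section Stability.
Variables (R : realFieldType) (m n : nat).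
Hypothesis m_gt0 : (0 < m)%N.
Local Notation word := {ffun 'I_n -> 'I_m}.
Implicit Types (f g : word -> R) (x y z w : word) (A S T J D : {set 'I_n}) (X Y F : {set word}).

(** Functions of disjoint blocks are independent, and each tail is bounded by Markov's
    inequality. *)
Lemma E_prod_tails (As : seq {set 'I_n}) (h : {set 'I_n} -> word -> R) (del eps : R) :
  0 < eps -> (forall A x, A \in As -> 0 <= h A x) ->
  (forall A, A \in As -> indep (~: A) (h A)) ->
  (forall A, A \in As -> E (h A) = del) ->
  pairwise (fun A B : {set 'I_n} => [disjoint A & B]) As ->
  E (fun x => \prod_(A <- As) (eps <= h A x)%R%:R) <= (del / eps) ^+ size As.
Proof.
move=> eps0; elim: As => [|A As IH] h0 hi hE /= => [_|/andP[AAs pAs]].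
  under eq_E do rewrite big_nil.
  by rewrite E_cst.
under eq_E do rewrite big_cons.
rewrite (@E_indep_mul _ _ _ m_gt0 (~: A) (fun x => (eps <= h A x)%R%:R)
   (fun x => \prod_(B <- As) (eps <= h B x)%R%:R)); first last.
- rewrite setCK => x y; apply: eq_big_seq => B BAs; congr (_%:R); congr (nat_of_bool (_ <= _)).
  apply: (@indepS _ _ _ (~: B) A); last by apply: hi; rewrite inE BAs orbT.
  by rewrite -disjoints_subset; exact: (allP AAs).
- by move=> x y; rewrite hi ?inE ?eqxx.
rewrite exprS; apply: ler_pM.
- by apply: E_ge0.
- by apply: E_ge0 => // x; apply: prodr_ge0.
- rewrite ler_pdivlMr // -(hE A) ?inE ?eqxx // -E_scaler; apply: E_le => // x.
  case: (boolP (eps <= h A x)) => he; first by rewrite mul1r.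
  by rewrite mul0r h0 // inE eqxx.
apply: IH => // B *; [apply: h0 | apply: hi | apply: hE]; by rewrite inE ?orbT //; apply/orP; right.
Qed.

Lemma tails_cover (As : seq {set 'I_n}) (h : {set 'I_n} -> word -> R) (eps : R) x :
  1 <= \sum_(A <- As) (h A x < eps)%R%:R + \prod_(A <- As) (eps <= h A x)%R%:R :> R.
Proof.
elim: As => [|A As IH]; first by rewrite !big_nil add0r.
rewrite !big_cons; have [he|he] := leP eps (h A x); first by rewrite mul1r add0r.
rewrite mul0r addr0 lerDl; exact: sumr_ge0.
Qed.

(** Let [h A] be the defect of the cube of [z] once the letters on a block [A] are fixed; its mean
    is [del]. Isoperimetry bounds the fibre of [w] by [h A ^+ l]. Where some block has [h A < eps]
    this is at most [eps ^+ (l - 1) * h A], and all [l] blocks have [h A >= eps] with probability at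
    most [(del / eps) ^+ l]. With [eps = 1 / be] and [del <= eps ^+ 2] everything is at most
    [(l + 1) * eps ^+ (l - 2) * del]. *)
Lemma stability_fibre F t T z w l (be : nat) :
  (0 < t)%N -> avoiding (t - 1) F -> #|T| = t -> (1 < l)%N -> (l < m)%N -> (l * t + t <= n)%N ->
  (0 < be)%N -> w \notin cube T z ->
  let del := 1 - dens R F T z in
  del * be%:R ^+ 2 <= 1 -> 2 * l.+1%:R * m%:R ^+ t <= be%:R ^+ (l - 2) :> R ->
  dens R F T w <= del / (2 * m%:R ^+ t).
Proof.
move=> t0 avF Tt l1 lm ln be0 wT del hdel hl.
pose c := #|[set i in T | w i == z i]|.
have ct : (c < t)%N.
  rewrite -Tt; apply: proper_card; apply/properP; split.
    by apply/subsetP => i; rewrite inE => /andP[].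
  have : exists i, (i \in T) && (w i != z i).
    apply/existsP; apply: contraNT wT; rewrite negb_exists => /forallP h.
    by apply/cubeP => i iT; have := h i; rewrite iT negbK => /eqP.
  by move=> [i /andP[iT wi]]; exists i => //; rewrite inE iT (negPf wi).
pose a := (t - 1 - c)%N.
have [|As [As1 As2 As3]] := @disjoint_family _ (~: T) a l.
  have := cardsC T; rewrite card_ord Tt => h.
  have : (l * a <= l * t)%N by rewrite leq_mul2l /a; apply/orP; right; clear; lia.
  by clear -h ln; lia.
pose f x := ind R F (mix T x z); pose g x := ind R F (mix T x w).
pose h A x := 1 - Av (~: A) f x.
have hE A : E (h A) = del by rewrite E_sub E_cst // E_Av // /del dens_E.
have h01 A x : 0 <= h A x <= 1.
  rewrite /h subr_ge0 lerBlDr lerDl Av_ge0 ?andbT; last by move=> *; apply: ind_ge0.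
    by apply: Av_le_cst => // y; apply: ind_le1.
  by [].
have h0 A x : 0 <= h A x by have /andP[] := h01 A x.
have hi A : indep (~: A) (h A) by move=> x y; rewrite /h indep_Av.
have AvT u A x : A \subset ~: T -> Av (~: A) (fun y => ind R F (mix T y u)) x = Av (~: (T :|: A)) (ind R F) (mix T x u).
  move=> AT; apply: eq_E => y; congr ind; apply/ffunP => i; rewrite !mixE !inE.
  case: (boolP (i \in T)) => iT //=.
have iso A x : A \in As -> Av (~: A) g x <= h A x ^+ l.
  move=> /As2[AT Aa]; rewrite /h !AvT //.
  apply: (@isoperimetry R m n m_gt0) => // [|x' y' x'F y'F x'x y'y]; first exact: ltn_trans lm.
  have x'x1 i : i \in T -> x' i = z i.
    by move=> iT; rewrite x'x ?mixE ?iT // !inE iT.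
  have y'y1 i : i \in T -> y' i = w i.
    by move=> iT; rewrite y'y ?mixE ?iT // !inE iT.
  have xyA i : i \in A -> x' i = y' i.
    move=> iA; have iT : i \notin T by have := subsetP AT i iA; rewrite inE.
    by rewrite x'x ?y'y ?mixE ?(negPf iT) // !inE iA orbT.
  have := avF x' y' x'F y'F.
  case: (boolP [exists i in ~: (T :|: A), x' i == y' i]) => [/exists_inP[i iJ /eqP xy] _|].
    by exists i.
  rewrite negb_exists_in => /forall_inP hne []; rewrite /agr.
  have -> : [set i | x' i == y' i] = [set i in T | w i == z i] :|: A.
    apply/setP => i; rewrite !inE; case: (boolP (i \in T)) => iT /=.
      rewrite x'x1 // y'y1 // eq_sym; case: (boolP (i \in A)) => [iA|_]; last by rewrite orbF.
      by have := subsetP AT i iA; rewrite inE iT.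
    case: (boolP (i \in A)) => iA; first by rewrite xyA // eqxx.
    by apply/negbTE/hne; rewrite !inE negb_or iT.
  rewrite cardsU (_ : _ :&: A = set0) ?cards0 ?Aa -/c.
    by rewrite /a; clear -ct t0; lia.
  apply/setP => i; rewrite !inE; apply/negbTE/negP => /andP[/andP[iT _] iA].
  by have := subsetP AT i iA; rewrite inE iT.
have beR : 1 <= be%:R :> R by rewrite ler1n.
have be_neq : be%:R != 0 :> R by rewrite gt_eqF //; lra.
pose eps : R := be%:R^-1.
have eps0 : 0 < eps by rewrite invr_gt0; lra.
have eps1 : eps <= 1 by rewrite invf_le1 //; lra.
have del0 : 0 <= del by rewrite -(hE set0); apply: E_ge0.
have dele : del <= eps ^+ 2.
  by rewrite exprVn -[X in _ <= X]mul1r ler_pdivlMr ?exprn_gt0 // ltr0n.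
have mass_small : E g <= l%:R * (eps ^+ l.-1 * del) + (del / eps) ^+ l.
  apply: le_trans (_ : E (fun x => \sum_(A <- As) g x * (h A x < eps)%R%:R + \prod_(A <- As) (eps <= h A x)%R%:R) <= _).
    apply: E_le => // x; have := tails_cover As h eps x; rewrite -mulr_sumr.
    have g0 : 0 <= g x by exact: ind_ge0.
    have g1 : g x <= 1 by exact: ind_le1.
    have : 0 <= \prod_(A <- As) (eps <= h A x)%R%:R :> R by apply: prodr_ge0.
    set u := \sum_(A <- As) _; set v := \prod_(A <- As) _ => v0 uv.
    have := ler_wpM2l g0 uv; nra.
  rewrite E_add E_sum lerD //; last first.
    by rewrite -As1; apply: E_prod_tails => // A *; apply: h0.
  apply: le_trans (_ : \sum_(A <- As) eps ^+ l.-1 * del <= _); last first.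
    by rewrite big_const_seq count_predT As1 iter_addr addr0 -[X in X <= _]mulr_natl.
  rewrite !big_seq; apply: ler_sum => A AAs.
  rewrite -(E_Av m_gt0 (~: A)).
  have ih : indep (~: A) (fun x => (h A x < eps)%R%:R : R) by move=> x y; rewrite hi.
  rewrite (@eq_E _ _ _ _ (fun x => (h A x < eps)%R%:R * Av (~: A) g x)); last first.
    move=> x; rewrite -(Av_indep_mul _ _ ih); apply: eq_Av => y; exact: mulrC.
  rewrite -(hE A) -E_scale; apply: E_le => // x.
  have [he|he] := ltP (h A x) eps; last first.
    by rewrite mul0r mulr_ge0 ?exprn_ge0 // ltW.
  rewrite mul1r; apply: le_trans (iso A x AAs) _.
  rewrite -{1}(@prednK l) ?(ltn_trans _ l1) // exprSr ler_wpM2r //.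
  by apply: lerXn2r; rewrite ?nnegrE ?(ltW eps0) ?(ltW he).
rewrite dens_E -/g; apply: le_trans mass_small _.
have lE : l = (l - 2).+2 by clear -l1; lia.
have h2 : (del / eps) ^+ l <= del * eps ^+ (l - 2).
  rewrite lE /= subSS subSS subn0; set j := (l - 2)%N.
  have de : del / eps <= eps.
    by rewrite ler_pdivrMr // -expr2.
  have de0 : 0 <= del / eps by rewrite divr_ge0 // ltW.
  have e1 : (del / eps) ^+ j.+1 <= eps ^+ j.+1.
    by apply: lerXn2r; rewrite ?nnegrE // ltW.
  rewrite exprS; apply: le_trans (ler_wpM2l de0 e1) _.
  by rewrite exprS mulrA divfK // gt_eqF.
have h1 : eps ^+ l.-1 * del <= del * eps ^+ (l - 2).
  rewrite mulrC; apply: ler_wpM2l => //; rewrite lE /= subSS subSS subn0 exprS.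
  by apply: ler_piMl => //; rewrite exprn_ge0 // ltW.
have mt : 0 < m%:R ^+ t :> R by rewrite exprn_gt0 // ltr0n.
have bt : 0 < be%:R ^+ (l - 2) :> R by rewrite exprn_gt0 // ltr0n.
apply: le_trans (_ : (l.+1%:R * eps ^+ (l - 2)) * del <= _).
  by rewrite -natr1; have := ler_wpM2l (ler0n R l) h1; lra.
rewrite mulrC; apply: ler_wpM2l => //.
rewrite /eps exprVn ler_pdivrMr // mulrC ler_pdivlMr ?mulr_gt0 //.
by rewrite mulrCA mulrA.
Qed.

Lemma dens_cube_eq X T z w : w \in cube T z -> dens R X T w = dens R X T z.
Proof.
move=> /cubeP wz; rewrite !dens_E; apply: eq_E => x; congr ind.
by apply/ffunP => i; rewrite !mixE; case: ifP => // /wz.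
Qed.

Lemma E_ind_inj X Y : E (ind R X) = E (ind R Y) -> #|X| = #|Y|.
Proof.
rewrite !E_ind => /(mulIf _) h; apply/eqP; rewrite -(eqr_nat R); apply/eqP/h.
by rewrite invr_eq0 pnatr_eq0 expn_eq0 negb_and -lt0n m_gt0.
Qed.

(** The fibres over the other labels together recover at most half of what the cube lacks, giving
    the bound [(1 - del / 2) / m ^ t]. Equality forces [del = 0], and then the fibre estimate
    empties all other fibres. *)
Lemma stability F t T z l (be : nat) :
  (0 < t)%N -> avoiding (t - 1) F -> #|T| = t -> (1 < l)%N -> (l < m)%N -> (l * t + t <= n)%N ->
  (0 < be)%N -> (1 - dens R F T z) * be%:R ^+ 2 <= 1 ->
  2 * l.+1%:R * m%:R ^+ t <= be%:R ^+ (l - 2) :> R ->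
  E (ind R F) <= (m ^ t)%:R^-1 /\ (E (ind R F) = (m ^ t)%:R^-1 -> F = cube T z).
Proof.
move=> t0 avF Tt l1 lm ln be0 hdel hl.
have fib w : w \notin cube T z -> dens R F T w <= (1 - dens R F T z) / (2 * m%:R ^+ t).
  by move=> wT; apply: (stability_fibre t0 avF Tt l1 lm ln be0 wT hdel hl).
set del := 1 - dens R F T z in fib hdel.
have mt : 0 < m%:R ^+ t :> R by rewrite exprn_gt0 // ltr0n.
have del0 : 0 <= del.
  by rewrite subr_ge0; apply: Av_le_cst => // x; apply: ind_le1.
have main : E (ind R F) <= (m ^ t)%:R^-1 * (1 - del / 2).
  rewrite -(E_Av m_gt0 (~: T)) -/(dens _ _ _).
  apply: le_trans (_ : E (fun w => (1 - del) * ind R (cube T z) w + del / (2 * m%:R ^+ t)) <= _).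
    apply: E_le => // w; have r0 : 0 <= del / (2 * m%:R ^+ t) by rewrite divr_ge0 // mulr_ge0 // ltW.
    rewrite /ind; case: (boolP (w \in cube T z)) => wT.
      by rewrite -/(ind R F) [X in X <= _](dens_cube_eq F wT) mulr1 /del; move: r0; rewrite /del; lra.
    by rewrite mulr0 add0r; apply: fib.
  rewrite E_add E_scale E_cst // E_cube // Tt natrX.
  by rewrite invfM; set q := (m%:R ^+ t)^-1; lra.
have mi : 0 < (m ^ t)%:R^-1 :> R by rewrite natrX invr_gt0.
split; first by apply: le_trans main _; rewrite ler_piMr ?(ltW mi) //; lra.
move=> eqF; have {}del0 : del = 0.
  have : (m ^ t)%:R^-1 * (del / 2) <= 0 by move: main; rewrite eqF; lra.
  by rewrite pmulr_rle0 //; lra.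
apply/eqP; rewrite eqEcard; apply/andP; split; last first.
  by rewrite eq_leq //; apply: E_ind_inj; rewrite E_cube // Tt.
apply/subsetP => x xF; apply: contraTT isT => xT.
have := fib x xT; rewrite del0 mul0r densE // leNgt => /negP[].
rewrite divr_gt0 ?ltr0n ?expn_gt0 ?m_gt0 // card_gt0; apply/set0Pn; exists x.
by rewrite in_setI xF; apply/cubeP.
Qed.
End Stability.

(** * A nearly full cube for long words *)

Lemma pow_1p_le (R : realFieldType) (v : R) k : 0 <= v -> k%:R * v <= 2^-1 ->
  (1 + v) ^+ k <= 1 + 2 * (k%:R * v).
Proof.
move=> v0 kv; case: k kv => [|k] kv; first by rewrite expr0 mul0r mulr0 addr0.
have k1 : 1 <= k.+1%:R :> R by rewrite ler1n.
have v1 : v <= 2^-1 by nra.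
have h1 := @bernoulli R (- v) k.+1; rewrite lerN2 in h1; have {}h1 : 1 + k.+1%:R * - v <= (1 + - v) ^+ k.+1 by apply: h1; lra.
have h2 : (1 + v) ^+ k.+1 * (1 + - v) ^+ k.+1 <= 1.
  by rewrite -exprMn exprn_ile1 //; nra.
have p0 : 0 <= (1 + v) ^+ k.+1 by apply: exprn_ge0; lra.
have := ler_wpM2l p0 h1; set P := (1 + v) ^+ k.+1 in p0 h2 *; set q := k.+1%:R * v in kv *.
have q0 : 0 <= q by rewrite mulr_ge0.
rewrite mulrN -/q => h3; have {}h3 : P * (1 - q) <= 1 by lra.
nra.
Qed.

Section LongWords.
Variables (R : realFieldType) (m n : nat).
Hypothesis m_gt0 : (0 < m)%N.
Local Notation word := {ffun 'I_n -> 'I_m}.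
Local Notation piece := (piece m n).
Implicit Types (x y z w : word) (A S T : {set 'I_n}) (X Y F : {set word}) (p q : piece).

Lemma E_indI_cube X T z : E (ind R (X :&: cube T z)) = (m ^ #|T|)%:R^-1 * dens R X T z.
Proof.
have := @massE R m n m_gt0 (T, z, X :&: cube T z) (subsetIr _ _).
rewrite mass_dens /= dens_cubeI // => ->.
by rewrite mulrC mulfK // pnatr_eq0 expn_eq0 negb_and -lt0n m_gt0.
Qed.

Lemma dense_cube_long F t e :
  avoiding (t - 1) F -> (0 < t)%N -> (0 < e)%N -> (1 < m)%N ->
  (m ^ t.+1 <= 2 ^ (2 * e))%N -> (16 * e ^ 3 * 2 <= m)%N -> (4 * e + t <= n)%N ->
  (t%:R / (n - 4 * e)%:R + m.-1%:R^-1) * (4096 * e%:R ^+ 2) < 1 :> R ->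
  (m ^ t)%:R^-1 <= E (ind R F) ->
  exists T z, #|T| = t /\ 1 - dens R F T z <= (1 + 16 * e%:R ^+ 3) / m%:R.
Proof.
move=> avF t0 e0 m1 hm em en small EF.
have mR : 1 < m%:R :> R by rewrite ltr1n.
have mt k : 0 < (m ^ k)%:R :> R by rewrite ltr0n expn_gt0 m_gt0.
have mti k : 0 < (m ^ k)%:R^-1 :> R by rewrite invr_gt0.
have mS k : (m ^ k.+1)%:R^-1 = (m ^ k)%:R^-1 / m%:R :> R by rewrite expnSr natrM invfM.
(* A factor [m] below the target density, so that the remainder [Y] is negligible, yet at least
   [4 ^ (- e)], so that pieces fix fewer than [2 * e] coordinates. *)
pose tau : R := (m ^ t.+1)%:R^-1.
have tau0 : 0 < tau by exact: mti.
have tau2 : 1 <= tau * 2 ^+ (2 * e).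
  by rewrite /tau mulrC ler_pdivlMr // mul1r -natrX ler_nat.
have em8 : (8 * e <= m)%N.
  by apply: leq_trans em; rewrite expnS; have : (0 < e ^ 2)%N; rewrite ?expn_gt0 ?e0 //; clear; nia.
have two1 : 1 <= 2 :> R by rewrite ler1n.
have [s [Y [sumE YE YF hs]]] := spread_decomposition m_gt0 F two1 (ltW tau0).
have supps p : p \in s -> (#|supp p| <= 2 * e)%N.
  by move=> /hs[sp _]; apply/ltnW/(spread_supp_lt m_gt0 two1 sp tau2).
have agr p q : p \in s -> q \in s -> (t <= #|agree_set p q|)%N.
  move=> /hs[sp pF] /hs[sq qF].
  exact: (spread_pair_agree m_gt0 avF t0 e0 em8 m1 sp sq pF qF tau2 en small).
have tau_lt : tau < (m ^ t)%:R^-1.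
  by rewrite /tau mS ltr_pdivrMr ?ltr_pMr //; lra.
have s0 : s != [::].
  apply: contraTneq EF => s0; rewrite -ltNge.
  rewrite (@eq_E _ _ _ _ (ind R Y)); first exact: le_lt_trans tau_lt.
  by move=> x; rewrite sumE s0 big_nil addr0.
have cov x : x \in F :\: Y -> exists2 p, p \in s & x \in members p.
  rewrite inE => /andP[xY xF]; have := sumE x.
  rewrite /ind xF (negPf xY) add0r => h; apply/hasP; apply: contraT => /hasPn hn.
  have : true%:R = 0 :> R by rewrite h big_seq big1 // => p /hn/negPf->.
  by move/eqP; rewrite oner_eq0.
have [T [z [tT Tr restE]]] := intersecting_pieces R m_gt0
   (fun p ps => conj (let: And3 a _ _ := (hs p ps).1 in a) (supps p ps)) agr s0 cov.
set v : R := _ / m%:R in restE.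
have v0 : 0 <= v by rewrite divr_ge0 // exprn_ge0.
have eR : 1 <= e%:R :> R by rewrite ler1n.
have Tv : #|T|%:R * v <= 8 * e%:R ^+ 3 / m%:R.
  apply: le_trans (_ : (2 * e)%:R * v <= _); first by rewrite ler_wpM2r // ler_nat.
  by rewrite /v natrM le_eqVlt; apply/orP; left; apply/eqP; ring.
have e3m : 8 * e%:R ^+ 3 / m%:R <= 2^-1 :> R.
  rewrite ler_pdivrMr; last lra.
  by move: em; rewrite -(ler_nat R) !natrM; lra.
have pw := pow_1p_le v0 (le_trans Tv e3m).
have {}restE : E (ind R ((F :\: Y) :\: cube T z)) <= (m ^ #|T|)%:R^-1 * (16 * e%:R ^+ 3 / m%:R).
  apply: le_trans restE _; rewrite ler_wpM2l ?(ltW (mti _)) //; lra.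
have split : E (ind R F) <= tau + (m ^ #|T|)%:R^-1 * (16 * e%:R ^+ 3 / m%:R) + (m ^ #|T|)%:R^-1 * dens R F T z.
  rewrite -E_indI_cube; apply: le_trans (lerD (lerD YE restE) (lexx _)).
  rewrite -!E_add; apply: E_le => // x; rewrite /ind !in_setD in_setI.
  by case: (x \in F) (subsetP YF x); case: (x \in Y) => //=; case: (x \in cube T z) => //= _; rewrite ?addr0 ?add0r // ?lerDl.
have dens1 : dens R F T z <= 1 by apply: Av_le_cst => // x; apply: ind_le1.
(* If [|T| > t], the remainder, the words outside the cube and those inside it each have density at
   most [tau], while [F] has density at least [m * tau]. *)
have Tt : #|T| = t.
  apply/eqP; rewrite eqn_leq tT andbT leqNgt; apply/negP => Tgt.
  have hT : (m ^ #|T|)%:R^-1 <= tau.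
    by rewrite /tau lef_pV2 ?posrE // ler_nat leq_pexp2l.
  have : (m ^ t)%:R^-1 <= tau + tau * (16 * e%:R ^+ 3 / m%:R) + tau.
    apply: le_trans EF (le_trans split _).
    apply: lerD; first apply: lerD => //.
      rewrite ler_wpM2r // divr_ge0 ?mulr_ge0 ?exprn_ge0 //.
    apply: le_trans (_ : (m ^ #|T|)%:R^-1 <= _) => //; rewrite ler_piMr // ltW //.
  have : tau * (16 * e%:R ^+ 3 / m%:R) <= tau by rewrite ler_piMr ?(ltW tau0) //; lra.
  have m32 : 32 <= m%:R :> R.
    move: em; rewrite -(ler_nat R) !natrM.
    have e31 : 1 <= e%:R ^+ 3 :> R by rewrite exprn_ege1.
    by clear -e31; lra.
  have : (m ^ t)%:R^-1 = tau * m%:R by rewrite /tau mS divfK //; lra.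
  move=> -> h1 h2; have h3 : 32 * tau <= tau * m%:R by rewrite mulrC ler_wpM2l // ltW.
  by clear -h1 h2 h3 tau0; lra.
exists T, z; split=> //; rewrite Tt /tau mS in split.
have h : (m ^ t)%:R^-1 * 1 <= (m ^ t)%:R^-1 * (m%:R^-1 + 16 * e%:R ^+ 3 / m%:R + dens R F T z).
  by rewrite mulr1; apply: le_trans EF (le_trans split _); rewrite !mulrDr.
by move: h; rewrite ler_pM2l // mulrDl mul1r; lra.
Qed.
End LongWords.

(** * Second moments: planted agreements *)

Section Planting.
Variables (R : realFieldType) (m n : nat).
Hypothesis m_gt0 : (0 < m)%N.
Local Notation word := {ffun 'I_n -> 'I_m}.
Local Notation piece := (piece m n).
Implicit Types (f g : word -> R) (x y z w : word) (A S T : {set 'I_n}) (X Y F : {set word}) (p q : piece).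

Lemma Av_pin A k g (c : 'I_m) G x : k \notin A ->
  (forall y, Av (~: (k |: A)) g y <= G) ->
  Av (~: A) (fun y => g y * (y k == c)%:R) x <= G / m%:R.
Proof.
move=> kA gG.
have ik : indep (~: (k |: A)) (fun y : word => (y k == c)%:R : R).
  by move=> y z; rewrite mixE !inE eqxx.
have kin : [set k] \subset ~: A by rewrite sub1set inE.
have -> : ~: A = (~: A) :|: ~: (k |: A).
  by apply/setP => i; rewrite !inE negb_or; case: (i \in A); rewrite ?andbF ?orbT.
rewrite -Av_Av //.
apply: le_trans (_ : Av (~: A) (fun y => G * (y k == c)%:R) x <= _).
  apply: Av_le => // y; rewrite (@eq_Av _ _ _ _ _ (fun y : word => (y k == c)%:R * g y)); last first.
    by move=> z; rewrite mulrC.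
  by rewrite (Av_indep_mul _ _ ik) mulrC ler_wpM2r.
rewrite Av_scale -(@E_coord R m n m_gt0 k c) // le_eqVlt; apply/orP; left; apply/eqP; congr (_ * _).
by apply: eq_E => y; rewrite mixE inE kA.
Qed.

(* Two compatible extensions of [p] and [q] that agree on [A] must agree once
   more, since their agreement would otherwise be [t - 1]: a union bound over
   the extra coordinate. *)
Lemma planted F t p q A (Gp Gq M : R) :
  avoiding (t - 1) F -> members p \subset F -> members q \subset F ->
  [disjoint A & supp p] -> [disjoint A & supp q] ->
  (#|A| + #|agree_set p q| = t - 1)%N ->
  (forall k x, k \notin A -> k \notin supp p -> Av (~: (k |: A)) (pfun R p) x <= Gp) ->
  (forall k x, k \notin A -> k \notin supp q -> Av (~: (k |: A)) (pfun R q) x <= Gq) ->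
  0 <= M -> mass R p * Gq <= M -> mass R q * Gp <= M ->
  E (fun x => Av (~: A) (pfun R p) x * Av (~: A) (pfun R q) x) <= n%:R / m%:R * M.
Proof.
move=> avF pF qF Ap Aq cA hGp hGq M0 MGq MGp.
have mR : 0 < m%:R :> R by rewrite ltr0n.
pose x' x := mix (supp p) x (lbl p); pose y' y := mix (supp q) y (lbl q).
pose B := ~: (A :|: agree_set p q).
have ApN i : i \in A -> i \notin supp p by move=> iA; rewrite (disjointFr Ap iA).
have AqN i : i \in A -> i \notin supp q by move=> iA; rewrite (disjointFr Aq iA).
pose G k x y := pfun R p x * pfun R q y * (x' x k == y' y k)%:R.
have E1 : E (fun x => Av (~: A) (pfun R p) x * Av (~: A) (pfun R q) x) =
  E (fun x => E (fun y => pfun R p x * pfun R q (mix (~: A) x y))).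
  rewrite -E_mul_Av //; rewrite (@eq_E _ _ _ _ (fun x => pfun R p x * Av (~: A) (pfun R q) x)).
    by apply: eq_E => x; rewrite /Av E_scale.
  by move=> x; rewrite Av_Av // setUid.
rewrite E1.
apply: le_trans (_ : E (fun x => E (fun y => \sum_(k in B) G k x (mix (~: A) x y))) <= _).
  apply: E_le => // x; apply: E_le => // y; set z := mix _ x y.
  have G0 k : 0 <= G k x z by rewrite /G !mulr_ge0 ?pfun_ge0.
  have [e0|ne0] := eqVneq (pfun R p x * pfun R q z) 0; first by rewrite e0 sumr_ge0.
  have xF : x' x \in F.
    apply: (subsetP pF); apply: contraNT ne0 => h.
    by rewrite /pfun /ind (negPf h) mul0r.
  have zF : y' z \in F.
    apply: (subsetP qF); apply: contraNT ne0 => h.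
    by rewrite /pfun /ind (negPf h) mulr0.
  have [k kB xk] : exists2 k, k \in B & x' x k = y' z k.
    case: (boolP [exists k in B, x' x k == y' z k]) => [/exists_inP[k kB /eqP e]|]; first by exists k.
    rewrite negb_exists_in => /forall_inP h; case: (avF _ _ xF zF).
    rewrite -cA /agr -cardsUI [A :&: _](_ : _ = set0) ?cards0 ?addn0; last first.
      apply/setP => i; rewrite !inE; apply/negbTE/negP => /andP[iA /andP[/andP[ip _] _]].
      by rewrite (negPf (ApN i iA)) in ip.
    apply: eq_card => i; rewrite in_set in_setU.
    case: (boolP (i \in A)) => iA /=.
      by rewrite /x' /y' !mixE (negPf (ApN i iA)) (negPf (AqN i iA)) inE iA eqxx.
    case: (boolP (i \in agree_set p q)) => iC.
      by move: iC; rewrite inE in_setI /x' /y' !mixE => /andP[/andP[-> ->]].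
    by apply/negbTE/h; rewrite /B in_setC in_setU negb_or iA.
  rewrite (bigD1 k) //= {1}/G xk eqxx mulr1 lerDl; exact: sumr_ge0.
rewrite (@eq_E _ _ _ _ (fun x => \sum_(k in B) E (fun y => G k x (mix (~: A) x y)))); last first.
  by move=> x; rewrite E_sum.
rewrite E_sum; apply: le_trans (_ : \sum_(k in B) M / m%:R <= _); last first.
  rewrite sumr_const -[X in X <= _]mulr_natl mulrAC -mulrA ler_wpM2r ?divr_ge0 //.
  by rewrite ler_nat -[X in (_ <= X)%N](card_ord n) max_card.
apply: ler_sum => k; rewrite /B in_setC in_setU negb_or => /andP[kA kC].
(* Where [k] is free in [q], the second word is pinned to the letter of the first. Where it is fixed
   by [q] only, the first word is pinned to the label of [q]. Where both fix it, the labels differ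
   at [k], which is outside [agree_set p q], and there is no contribution. *)
case: (boolP (k \in supp q)) => kq; last first.
  apply: le_trans (_ : E (fun x => pfun R p x * (Gq / m%:R)) <= _); last first.
    by rewrite E_scaler mulrA ler_wpM2r // invr_ge0 ltW.
  apply: E_le => // x.
  have -> : E (fun y => G k x (mix (~: A) x y)) = pfun R p x * Av (~: A) (fun y => pfun R q y * (y k == x' x k)%:R) x.
    rewrite -E_scale; apply: eq_E => y; rewrite /G /y' [mix (supp q) _ _ k]mixE (negPf kq).
    by rewrite eq_sym mulrA.
  apply: ler_wpM2l; first exact: pfun_ge0.
  by apply: Av_pin => // y; apply: hGq.
case: (boolP (k \in supp p)) => kp.
  rewrite (@eq_E _ _ _ _ (fun=> 0)) ?E_cst ?divr_ge0 // => x.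
  rewrite (@eq_E _ _ _ _ (fun=> 0)) ?E_cst // => y.
  rewrite /G /x' /y' [mix (supp p) _ _ k]mixE [mix (supp q) _ _ k]mixE kp kq.
  by move: kC; rewrite inE in_setI kp kq /= => /negPf->; rewrite mulr0.
apply: le_trans (_ : E (fun x => (Gp / m%:R) * pfun R q x) <= _); last first.
  by rewrite E_scale mulrAC ler_wpM2r ?invr_ge0 ?(ltW mR) // mulrC.
have -> : E (fun x => E (fun y => G k x (mix (~: A) x y))) =
  E (fun x => Av (~: A) (fun x => pfun R p x * (x k == lbl q k)%:R) x * pfun R q x).
  rewrite -E_mul_Av //; apply: eq_E => x; rewrite /Av -E_scale; apply: eq_E => y.
  rewrite /G /x' /y' [mix (supp p) _ _ k]mixE [mix (supp q) _ _ k]mixE (negPf kp) kq; ring.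
apply: E_le => // x; apply: ler_wpM2r; first exact: pfun_ge0.
by apply: Av_pin => // y; apply: hGp.
Qed.

(** Planting uses a set whose size depends on the pair, whereas a second moment over many pieces
    needs one common [A]; this lemma enlarges [A'] to [A]. Where the average of [f] given [A'] is at
    least [eta], the average given [A] is at most [Gf / eta] times it; elsewhere [f] has total mass
    at most [eta]. *)
Lemma coarsen f g A A' (Gf Gg e eta : R) : A' \subset A ->
  (forall x, 0 <= f x) -> (forall x, 0 <= g x) -> 0 < eta -> 0 <= Gf -> 0 <= Gg ->
  (forall x, Av (~: A) f x <= Gf) -> (forall x, Av (~: A) g x <= Gg) ->
  E (fun x => Av (~: A') f x * Av (~: A') g x) <= e ->
  E (fun x => Av (~: A) f x * Av (~: A) g x) <= Gf * e / eta + Gg * eta.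
Proof.
move=> AA f0 g0 eta0 Gf0 Gg0 hf hg he.
have A0 h B x : (forall x, 0 <= h x) -> 0 <= Av B h x :> R by move=> h0; apply: Av_ge0.
have AvA h x : Av (~: A') (Av (~: A) h) x = Av (~: A') h x :> R.
  by rewrite Av_Av // (setUidPl _) // setCS.
apply: le_trans (_ : E (fun x => (Gf / eta) * (Av (~: A') f x * Av (~: A) g x) + Gg * (Av (~: A) f x * (Av (~: A') f x < eta)%R%:R)) <= _).
  apply: E_le => // x; have := A0 f (~: A) x f0; have := A0 g (~: A) x g0; have := A0 f (~: A') x f0.
  have [h|h] := ltP (Av (~: A') f x) eta => h1 h2 h3.
    rewrite mulr1; apply: le_trans (_ : Gg * Av (~: A) f x <= _).
      by rewrite mulrC; apply: ler_wpM2r.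
    by rewrite lerDr; apply: mulr_ge0; [rewrite divr_ge0 // ltW | apply: mulr_ge0].
  rewrite !mulr0 addr0 mulrA; apply: ler_wpM2r => //.
  by apply: le_trans (hf x) _; rewrite mulrAC ler_pdivlMr // ler_wpM2l.
rewrite E_add !E_scale; apply: lerD.
  rewrite [X in _ <= X]mulrAC; apply: ler_wpM2l; first by rewrite divr_ge0 // ltW.
  apply: le_trans he; rewrite -!E_mul_Av // le_eqVlt; apply/orP; left; apply/eqP.
  by apply: eq_E => x; rewrite AvA Av_Av // setUid.
apply: ler_wpM2l => //; rewrite -(E_Av m_gt0 (~: A')) -[X in _ <= X](@E_cst R m n m_gt0).
have ih : indep (~: A') (fun x => (Av (~: A') f x < eta)%R%:R : R) by move=> x y; rewrite indep_Av.
apply: E_le => // x.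
rewrite (@eq_Av _ _ _ _ _ (fun x => (Av (~: A') f x < eta)%R%:R * Av (~: A) f x)); last first.
  by move=> y; rewrite mulrC.
rewrite (Av_indep_mul _ _ ih) AvA.
by have [h|h] := ltP (Av (~: A') f x) eta; rewrite ?mul1r ?mul0r ltW.
Qed.
End Planting.

(** * Families with small density in every cube of codimension [t] *)

Section LightFamilies.
Variables (R : realFieldType) (m n : nat).
Hypothesis m_gt0 : (0 < m)%N.
Local Notation word := {ffun 'I_n -> 'I_m}.
Local Notation piece := (piece m n).
Implicit Types (f g : word -> R) (x y z w : word) (A S T : {set 'I_n}) (X Y F : {set word}) (p q : piece).

Lemma far_pieces F t p q A (b tau : R) :
  avoiding (t - 1) F -> members p \subset F -> members q \subset F ->
  spread b tau p -> spread b tau q -> 1 <= b -> 0 < mass R p -> (0 < t)%N ->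
  64 * n%:R * b ^+ (3 * t) <= m%:R ->
  [disjoint A & supp p] -> [disjoint A & supp q] -> #|A| = (t - 1)%N ->
  (#|agree_set p q| < t)%N ->
  E (fun x => Av (~: A) (pfun R p) x * Av (~: A) (pfun R q) x) <= 2^-1 * (mass R p * mass R q).
Proof.
move=> avF pF qF [_ gp _] [_ gq _] b1 mp0 t0 hm Ap Aq cA ct.
have b0 : 0 < b by lra.
have mR : 0 < m%:R :> R by rewrite ltr0n.
have mq0 := mass_ge0 R m_gt0 q.
have [A' A'A cA'] : exists2 A' : {set 'I_n}, A' \subset A & #|A'| = (t - 1 - #|agree_set p q|)%N.
  by apply: exists_subset_card; rewrite cA leq_subr.
have cA't : (#|A'|.+1 <= t)%N by rewrite cA'; clear -t0; lia.
have gl r' k x : (forall A x, [disjoint A & supp r'] -> Av (~: A) (pfun R r') x <= b ^+ #|A| * mass R r') ->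
    [disjoint A & supp r'] -> k \notin A' -> k \notin supp r' -> Av (~: (k |: A')) (pfun R r') x <= b ^+ t * mass R r'.
  move=> gr Ar kA kr; apply: le_trans (gr _ _ _) _.
    apply/pred0P => i /=; apply/negP => /andP[]; rewrite !inE => /orP[/eqP->|iA'].
      by rewrite (negPf kr).
    by rewrite (disjointFr Ar (subsetP A'A i iA')).
  rewrite ler_wpM2r ?mass_ge0 // ler_weXn2l // cardsU1 kA; exact: cA't.
have e1 : E (fun x => Av (~: A') (pfun R p) x * Av (~: A') (pfun R q) x) <= n%:R / m%:R * (b ^+ t * (mass R p * mass R q)).
  apply: (planted m_gt0 avF pF qF (disjointWl A'A Ap) (disjointWl A'A Aq)).
  - by rewrite cA'; clear -ct t0; lia.
  - by move=> k x; apply: gl.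
  - by move=> k x; apply: gl.
  - apply: mulr_ge0; first by rewrite exprn_ge0 // ltW.
    by apply: mulr_ge0 => //; apply: ltW.
  - by rewrite le_eqVlt; apply/orP; left; apply/eqP; ring.
  - by rewrite le_eqVlt; apply/orP; left; apply/eqP; ring.
pose c := b ^+ (t - 1).
have c1 : 1 <= c by rewrite exprn_ege1.
have c0 : 0 < c by lra.
(* Makes the second term of [coarsen] one eighth of the product of the masses. The first term
   carries [1 / eta], and the lower bound on [m] brings it under one eighth as well. *)
pose eta := mass R p / (8 * c).
have eta0 : 0 < eta by rewrite divr_gt0 //; lra.
have hA r' : (forall A x, [disjoint A & supp r'] -> Av (~: A) (pfun R r') x <= b ^+ #|A| * mass R r') -> [disjoint A & supp r'] ->
  forall x, Av (~: A) (pfun R r') x <= c * mass R r'.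
  by move=> gr Ar x; rewrite /c -cA; apply: gr.
have := @coarsen R m n m_gt0 (pfun R p) (pfun R q) A A' (c * mass R p) (c * mass R q) _ eta A'A (pfun_ge0 R p) (pfun_ge0 R q) eta0 _ _ (hA _ gp Ap) (hA _ gq Aq) e1.
move=> h; apply: le_trans (h _ _) _; [by apply: mulr_ge0; apply: ltW | by apply: mulr_ge0 => //; apply: ltW|].
have -> : c * mass R p * (n%:R / m%:R * (b ^+ t * (mass R p * mass R q))) / eta =
   (8 * n%:R * (c * c * b ^+ t) / m%:R) * (mass R p * mass R q).
  by rewrite /eta; field; rewrite ?gt_eqF //; lra.
have -> : c * mass R q * eta = 8^-1 * (mass R p * mass R q).
  by rewrite /eta; field; rewrite gt_eqF.
rewrite -mulrDl; apply: ler_wpM2r; first by apply: mulr_ge0 => //; apply: ltW.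
have : 8 * n%:R * (c * c * b ^+ t) / m%:R <= 8^-1.
  rewrite ler_pdivrMr //.
  have : n%:R * (c * c * b ^+ t) <= n%:R * b ^+ (3 * t).
    apply: ler_wpM2l => //; rewrite /c -!exprD ler_weXn2l //; clear; lia.
  by lra.
by lra.
Qed.

(** Second moment of the sum of conditional densities given one set [A] of [t - 1] coordinates
    outside [S]. Pairs with few label agreements contribute at most half the product of their
    masses; for each [p], the pieces close to it have total mass at most [Rw], weighted by
    [b ^+ (t - 1)] from globality. Hence [Lam ^+ 2 <= Lam * (c * Rw + Lam / 2)], which is solved for
    [Lam]. *)
Lemma light_fibre_mass F t S (s : seq piece) (b tau kap : R) :
  avoiding (t - 1) F -> (0 < t)%N -> 1 <= b -> 0 <= tau ->
  (forall p, p \in s -> spread b tau p /\ members p \subset F) ->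
  (forall x, \sum_(p <- s) ind R (members p) x <= ind R F x) ->
  (forall T z, #|T| = t -> dens R F T z <= kap) ->
  64 * n%:R * b ^+ (3 * t) <= m%:R -> (#|S| + t <= n)%N ->
  \sum_(p <- s | supp p == S) mass R p <=
    2 * b ^+ (t - 1) * ((m ^ #|S|)%:R * (2 ^+ #|S| * ((m ^ t)%:R^-1 * kap))).
Proof.
move=> avF t0 b1 tau0 hs sumF light hm Sn.
have b0 : 0 < b by lra.
have mt k : 0 < (m ^ k)%:R :> R by rewrite ltr0n expn_gt0 m_gt0.
set Lam := \sum_(p <- s | _) _; set Rw := _ * (_ * _).
have kap0 : 0 <= kap.
  have [T _ Tt] : exists2 T : {set 'I_n}, T \subset setT & #|T| = t.
    by apply: exists_subset_card; rewrite cardsT card_ord; clear -Sn; lia.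
  apply: le_trans (light T [ffun=> Ordinal m_gt0] Tt); apply: Av_ge0 => // x; exact: ind_ge0.
have Rw0 : 0 <= Rw by rewrite !mulr_ge0 ?exprn_ge0 // invr_ge0 ltW.
have Lam0 : 0 <= Lam by apply: sumr_ge0 => p _; apply: mass_ge0.
have massgt p : p \in s -> 0 < mass R p.
  by move=> /hs[[_ _ h] _]; apply: le_lt_trans h; rewrite mulr_ge0 // exprn_ge0 // ltW.
have [A AS cA] : exists2 A : {set 'I_n}, A \subset ~: S & #|A| = (t - 1)%N.
  apply: exists_subset_card; have := cardsC S; rewrite card_ord; clear -Sn; lia.
have dA p : supp p == S -> [disjoint A & supp p] by move=> /eqP->; rewrite disjoints_subset.
pose X p := Av (~: A) (pfun R p).
have X0 p x : 0 <= X p x by apply: Av_ge0 => // y; apply: pfun_ge0.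
have EX p : E (X p) = mass R p by rewrite E_Av.
(* The pieces close to [p] lie in few light cubes. *)
have row p : p \in s -> supp p == S ->
   \sum_(q <- s | (supp q == S) && (t <= #|agree_set p q|)%N) mass R q <= Rw.
  move=> ps /eqP pS.
  have mq q : q \in s -> supp q == S -> mass R q = E (ind R (members q)) * (m ^ #|S|)%:R.
    by move=> /hs[[h _ _] _] /eqP qS; rewrite massE // qS.
  rewrite big_seq_cond (eq_bigr (fun q => E (ind R (members q)) * (m ^ #|S|)%:R)); last first.
    by move=> q /andP[qs /andP[qS _]]; apply: mq.
  rewrite -mulr_suml mulrC /Rw; apply: ler_wpM2l; first exact: ltW.
  rewrite -E_sum.
  apply: le_trans (_ : E (fun x => \sum_(T : {set 'I_n} | (T \subset S) && (#|T| == t)) ind R (F :&: cube T (lbl p)) x) <= _).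
    apply: E_le => // x.
    case: (boolP [exists T : {set 'I_n}, [&& T \subset S, #|T| == t & x \in cube T (lbl p)]]) => [/existsP[T /and3P[TS Tt xT]]|].
      rewrite (bigD1 T) ?TS //=; apply: ler_wpDr; first by apply: sumr_ge0 => *; apply: ind_ge0.
      rewrite /ind in_setI xT andbT; apply: le_trans (sumF x).
      rewrite [X in _ <= X]big_seq [X in _ <= X](bigID (fun q => (supp q == S) && (t <= #|agree_set p q|)%N)) /=.
      by apply: ler_wpDr; first by apply: sumr_ge0 => *; apply: ind_ge0.
    rewrite negb_exists => /forallP hT; rewrite big1.
      by apply: sumr_ge0 => *; apply: ind_ge0.
    move=> q /andP[qs /andP[qS cl]]; rewrite /ind; case: (boolP (x \in members q)) => // xq.
    have [[/subsetP/(_ x xq)/cubeP xl _ _] _] := hs q qs.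
    have [T Tag Tt] := exists_subset_card cl.
    have := hT T; rewrite Tt eqxx /=; case/negP; apply/andP; split.
      by rewrite -pS; apply: subset_trans Tag _; apply/subsetP => i; rewrite inE in_setI => /andP[/andP[]].
    apply/cubeP => i /(subsetP Tag); rewrite inE in_setI => /andP[/andP[ip iq] /eqP->].
    exact: xl.
  rewrite E_sum; apply: le_trans (_ : \sum_(T : {set 'I_n} | T \subset S) (m ^ t)%:R^-1 * kap <= _).
    rewrite [X in _ <= X](bigID (fun T : {set 'I_n} => #|T| == t)) /=.
    apply: ler_wpDr; first by apply: sumr_ge0 => *; rewrite mulr_ge0 // invr_ge0 ltW.
    apply: ler_sum => T /andP[_ /eqP Tt]; rewrite E_indI_cube // Tt.
    by apply: ler_wpM2l; [rewrite invr_ge0 ltW | apply: light].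
  rewrite (eq_bigr (fun T : {set 'I_n} => (1 : R) ^+ #|T| * ((m ^ t)%:R^-1 * kap))); last by move=> T _; rewrite expr1n mul1r.
  by rewrite -mulr_suml sum_subset_exp (_ : 1 + 1 = 2) //; ring.
have E2 : Lam ^+ 2 <= E (fun x => (\sum_(p <- s | supp p == S) X p x) ^+ 2).
  have -> : Lam = E (fun x => \sum_(p <- s | supp p == S) X p x).
    by rewrite E_sum; apply: eq_bigr => p _.
  have := Av_sqr_le m_gt0 setT (fun x => \sum_(p <- s | supp p == S) X p x) [ffun=> Ordinal m_gt0].
  by rewrite !Av_setT.
pose c := b ^+ (t - 1).
have c1 : 1 <= c by rewrite exprn_ege1.
have pairs p q : p \in s -> q \in s -> supp p == S -> supp q == S ->
   E (fun x => X p x * X q x) <= mass R p * (if (t <= #|agree_set p q|)%N then c * mass R q else 2^-1 * mass R q).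
  move=> ps qs pS qS; have [sp pF] := hs p ps; have [sq qF] := hs q qs.
  case: leqP => cl.
    have -> : mass R p * (c * mass R q) = c * mass R q * mass R p by ring.
    rewrite -(EX p) -E_scale; apply: E_le => // x; rewrite mulrC ler_wpM2r //.
    by have [_ g _] := sq; rewrite /c -cA; apply: g; apply: dA.
  rewrite mulrCA; apply: (far_pieces avF pF qF sp sq b1 (massgt p ps) t0 hm) => //; exact: dA.
have : Lam ^+ 2 <= Lam * (c * Rw + 2^-1 * Lam).
  apply: le_trans E2 _.
  rewrite (@eq_E _ _ _ _ (fun x => \sum_(p <- s | supp p == S) \sum_(q <- s | supp q == S) X p x * X q x)); last first.
    by move=> x; rewrite expr2 mulr_suml; apply: eq_bigr => p _; rewrite mulr_sumr.
  rewrite E_sum {1}/Lam mulr_suml big_seq_cond [X in _ <= X]big_seq_cond.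
  apply: ler_sum => p /andP[ps pS]; rewrite E_sum.
  apply: le_trans (_ : mass R p * \sum_(q <- s | supp q == S) (if (t <= #|agree_set p q|)%N then c * mass R q else 2^-1 * mass R q) <= _).
    rewrite mulr_sumr big_seq_cond [X in _ <= X]big_seq_cond.
    by apply: ler_sum => q /andP[qs qS]; apply: pairs.
  apply: ler_wpM2l; first exact: mass_ge0.
  rewrite (bigID (fun q => t <= #|agree_set p q|)%N) /=; apply: lerD.
    rewrite (eq_bigr (fun q => c * mass R q)); last by move=> q /andP[_ ->].
    by rewrite -mulr_sumr; apply: ler_wpM2l; [lra | apply: row].
  rewrite (eq_bigr (fun q => 2^-1 * mass R q)); last by move=> q /andP[_ /negPf->].
  rewrite -mulr_sumr; apply: ler_wpM2l; first by rewrite invr_ge0.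
  rewrite /Lam [X in _ <= X](bigID (fun q => t <= #|agree_set p q|)%N) /=.
  by rewrite lerDr sumr_ge0 // => q _; apply: mass_ge0.
move=> fin; rewrite -mulrA -/c; have [L0|L0] := leP Lam 0.
  by apply: le_trans L0 _; apply: mulr_ge0 => //; apply: mulr_ge0 => //; lra.
by move: fin; rewrite expr2 ler_pM2l //; lra.
Qed.

(** The pieces are grouped by support. There are at most [2 (2 n) ^+ r] supports, each contributing
    a multiple of [kap / m ^ t], so [kap] has to beat a power of [n]; this is what makes the method
    require [m] to be a large power of [n]. *)
Lemma light_bound F t r (b tau kap : R) :
  avoiding (t - 1) F -> (0 < t)%N -> 1 <= b -> 0 < tau -> 1 <= tau * b ^+ r -> (0 < n)%N ->
  (forall T z, #|T| = t -> dens R F T z <= kap) -> 0 <= kap ->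
  64 * n%:R * b ^+ (3 * t) <= m%:R -> (r + t <= n)%N ->
  E (ind R F) <= tau + 4 * (4 * n%:R) ^+ r * b ^+ (t - 1) * kap * (m ^ t)%:R^-1.
Proof.
move=> avF t0 b1 tau0 taub n0 light kap0 hm rn.
have mt k : 0 < (m ^ k)%:R :> R by rewrite ltr0n expn_gt0 m_gt0.
have nR : 1 <= n%:R :> R by rewrite ler1n.
have [s [Y [sumE YE YF hs]]] := spread_decomposition m_gt0 F b1 (ltW tau0).
rewrite (eq_E sumE) E_add E_sum; apply: lerD => //.
have sumF x : \sum_(p <- s) ind R (members p) x <= ind R F x by rewrite sumE lerDr ind_ge0.
have suppr p : p \in s -> (#|supp p| < r)%N by move=> /hs[sp _]; apply: (spread_supp_lt m_gt0 b1 sp taub).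
pose d := 2 * b ^+ (t - 1) * ((m ^ t)%:R^-1 * kap).
have d0 : 0 <= d by rewrite !mulr_ge0 ?exprn_ge0 ?invr_ge0 ?(ltW (mt t)) //; lra.
rewrite big_seq (partition_big (@supp m n) (fun S => #|S| < r)%N) /=; last exact: suppr.
apply: le_trans (_ : \sum_(S : {set 'I_n} | (#|S| < r)%N) 2 ^+ r * d <= _).
  apply: ler_sum => S Sr.
  rewrite (eq_bigr (fun p => mass R p * (m ^ #|S|)%:R^-1)); last first.
    move=> p /andP[ps /eqP pS]; have [[h _ _] _] := hs p ps.
    by rewrite massE // pS mulfK // gt_eqF.
  rewrite -big_seq_cond -mulr_suml ler_pdivrMr //.
  apply: le_trans (light_fibre_mass avF t0 b1 (ltW tau0) hs sumF light hm _) _.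
    by apply: leq_trans rn; rewrite leq_add2r ltnW.
  rewrite -/d.
  have -> : 2 * b ^+ (t - 1) * ((m ^ #|S|)%:R * (2 ^+ #|S| * ((m ^ t)%:R^-1 * kap))) = 2 ^+ #|S| * d * (m ^ #|S|)%:R.
    by rewrite /d; ring.
  rewrite ler_wpM2r // ler_wpM2r // ler_weXn2l ?ler1n // ltnW //.
rewrite sumr_const -[X in X <= _]mulr_natl.
(* Give every set the weight [v ^+ |S|] with [v = 1 / (2 n)]: the total is [(1 + v) ^+ n <= 2], and
   each counted set weighs at least [v ^+ r]. *)
have cnt : #|[pred S : {set 'I_n} | (#|S| < r)%N]|%:R <= 2 * (2 * n%:R) ^+ r :> R.
  pose v : R := (2 * n%:R)^-1.
  have v0 : 0 <= v by rewrite invr_ge0 mulr_ge0.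
  have nv : #|[set: 'I_n]|%:R * v = 2^-1.
    rewrite cardsT card_ord /v invfM mulrC -mulrA mulVf ?mulr1 // gt_eqF //; lra.
  have := @pow_1p_le R v #|[set: 'I_n]| v0; rewrite nv => /(_ (lexx _)).
  rewrite -sum_subset_exp => h.
  have {}h : \sum_(S : {set 'I_n} | S \subset setT) v ^+ #|S| <= 2 by lra.
  rewrite -sum1_card natr_sum mulrC -ler_pdivrMl ?exprn_gt0 ?mulr_gt0 //; last lra.
  apply: le_trans h; rewrite mulr_sumr [X in _ <= X](bigID (fun S : {set 'I_n} => #|S| < r)%N) /=.
  apply: ler_wpDr; first by apply: sumr_ge0 => S _; apply: exprn_ge0.
  rewrite [X in _ <= X](eq_bigl (fun S : {set 'I_n} => #|S| < r)%N); last by move=> S; rewrite subsetT.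
  apply: ler_sum => S Sr; rewrite mulr1.
  have -> : ((2 * n%:R) ^+ r)^-1 = v ^+ r by rewrite /v exprVn.
  apply: ler_wiXn2l => //; last exact: ltnW.
  by rewrite /v invf_le1; lra.
apply: le_trans (ler_wpM2r _ cnt) _; first by rewrite mulr_ge0 ?exprn_ge0.
rewrite /d !exprMn (_ : (4 : R) ^+ r = 2 ^+ r * 2 ^+ r); last by rewrite -exprMn; congr (_ ^+ _); ring.
by rewrite le_eqVlt; apply/orP; left; apply/eqP; ring.
Qed.
End LightFamilies.

(** * Cubes of codimension [t] that nearly exclude each other *)

Lemma count_meeting (T : finType) (Bs : seq {set T}) (S : {set T}) :
  pairwise (fun A B : {set T} => [disjoint A & B]) Bs ->
  (count (fun B : {set T} => ~~ [disjoint B & S]) Bs <= #|S|)%N.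
Proof.
elim: Bs S => [|B Bs IH] S //= /andP[/allP BBs /IH{}IH].
have [dBS|dBS] := boolP [disjoint B & S]; first by rewrite add0n.
rewrite (@eq_in_count _ _ (fun C : {set T} => ~~ [disjoint C & S :\: B])) => [|C CBs]; last first.
  congr (~~ _); rewrite -!setI_eq0; congr (_ == _); apply/setP => i; rewrite !inE.
  by case: (boolP (i \in B)) => //= iB; rewrite (disjointFr (BBs C CBs) iB).
apply: leq_trans (leq_add (leqnn _) (IH _)) _; rewrite -(cardsID B S) leq_add2r card_gt0.
by rewrite setI_eq0 disjoint_sym.
Qed.

Section FarFamily.
Variables (R : realFieldType) (m n : nat).
Hypothesis m_gt0 : (0 < m)%N.
Local Notation word := {ffun 'I_n -> 'I_m}.
Local Notation piece := (piece m n).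
Implicit Types (f g : word -> R) (x y z w : word) (A B S T : {set 'I_n}) (X Y F : {set word}) (p q : piece).
Variables (I : finType) (Q : I -> piece) (H : {set I}) (t : nat) (F : {set word}).
Variables (kap eta eps : R).
Hypothesis avF : avoiding (t - 1) F.
Hypothesis t_gt0 : (0 < t)%N.
Hypothesis QF : forall i, members (Q i) \subset F.
Hypothesis Qt : forall i, i \in H -> #|supp (Q i)| = t.
Hypothesis Qfar : forall i j, i \in H -> j \in H -> i != j -> (#|agree_set (Q i) (Q j)| < t)%N.
Hypothesis Qkap : forall i, i \in H -> kap <= mass R (Q i).
Hypothesis kap_gt0 : 0 < kap.
Hypothesis eta_gt0 : 0 < eta.
Hypothesis nm_eta : n%:R / m%:R <= eta ^+ 2.
Hypothesis eps_eta : 2 * eta <= eps * kap ^+ 2.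
Local Notation mu i := (mass R (Q i)).
Local Notation W B i := (Av (~: B) (pfun R (Q i))).

Let mu_ge0 i : 0 <= mu i. Proof. exact: mass_ge0. Qed.
Let mu_le1 i : mu i <= 1. Proof. exact: mass_le1. Qed.
Let eps_gt0 : 0 < eps.
Proof.
have h : 0 < kap ^+ 2 by apply: exprn_gt0.
by rewrite -(pmulr_lgt0 _ h); apply: lt_le_trans eps_eta; apply: mulr_gt0.
Qed.

Lemma W_ge0 B i x : 0 <= W B i x.
Proof. by apply: Av_ge0 => // y; apply: pfun_ge0. Qed.

Lemma W_le1 B i x : W B i x <= 1.
Proof. by apply: Av_le_cst => // y; have /andP[] := pfun01 R (Q i) y. Qed.

Lemma E_W B i : E (W B i) = mu i.
Proof. by rewrite E_Av. Qed.

(** Planting with the trivial bound 1 in place of globality, then coarsening to [B], leaves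
    [2 * eta]. This is enough because every mass is at least [kap]. *)
Lemma far_correlation B i j : i \in H -> j \in H -> i != j ->
  [disjoint B & supp (Q i)] -> [disjoint B & supp (Q j)] -> (t - 1 <= #|B|)%N ->
  E (fun x => W B i x * W B j x) <= eps * (mu i * mu j).
Proof.
move=> iH jH ij Bi Bj Bt; have ct := Qfar iH jH ij.
have [A AB cA] : exists2 A : {set 'I_n}, A \subset B & #|A| = (t - 1 - #|agree_set (Q i) (Q j)|)%N.
  by apply: exists_subset_card; apply: leq_trans Bt; apply: leq_subr.
have av1 k A' j' x : Av (~: (k |: A')) (pfun R (Q j')) x <= 1 by exact: W_le1.
have e1 : E (fun x => W A i x * W A j x) <= n%:R / m%:R * 1.
  apply: (planted m_gt0 avF (QF i) (QF j) (disjointWl AB Bi) (disjointWl AB Bj)) => //.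
  - rewrite cA; clear -ct t_gt0; lia.
  - by rewrite mulr1.
  - by rewrite mulr1.
have := coarsen m_gt0 AB (pfun_ge0 R (Q i)) (pfun_ge0 R (Q j)) eta_gt0 ler01 ler01 (W_le1 B i) (W_le1 B j) e1.
move=> h; apply: le_trans h _; rewrite !mul1r !mulr1.
have : n%:R / m%:R / eta <= eta by rewrite ler_pdivrMr // -expr2.
have : eps * kap ^+ 2 <= eps * (mu i * mu j).
  rewrite ler_pM2l // expr2; apply: ler_pM; rewrite ?Qkap ?ltW //.
by move: eps_eta; lra.
Qed.

Lemma second_moment B (Y : {set I}) : Y \subset H ->
  (forall i, i \in Y -> [disjoint B & supp (Q i)]) -> (t - 1 <= #|B|)%N ->
  E (fun x => (\sum_(i in Y) W B i x) ^+ 2) <=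
  \sum_(i in Y) E (fun x => W B i x ^+ 2) + eps * (\sum_(i in Y) mu i) ^+ 2.
Proof.
move=> /subsetP YH BY Bt.
rewrite (@eq_E _ _ _ _ (fun x => \sum_(i in Y) \sum_(j in Y) W B i x * W B j x)); last first.
  by move=> x; rewrite expr2 mulr_suml; apply: eq_bigr => p _; rewrite mulr_sumr.
rewrite E_sum expr2 mulr_suml mulr_sumr -big_split /=; apply: ler_sum => i iY.
rewrite E_sum (bigD1 i) //=; apply: lerD => //.
rewrite mulr_sumr mulr_sumr [X in _ <= X](bigD1 i) //=; apply: ler_wpDl.
  by apply: mulr_ge0; [apply: ltW | apply: mulr_ge0].
by apply: ler_sum => j /andP[jY ji]; apply: far_correlation; rewrite ?YH ?BY // eq_sym.
Qed.

Lemma W_sqr_le B i : E (fun x => W B i x ^+ 2) <= mu i.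
Proof.
rewrite -(E_W B) //; apply: E_le => // x.
by rewrite expr2 ler_piMr ?W_ge0 ?W_le1.
Qed.

Lemma far_mass B (Y : {set I}) : Y \subset H ->
  (forall i, i \in Y -> [disjoint B & supp (Q i)]) -> (t - 1 <= #|B|)%N ->
  (\sum_(i in Y) mu i) ^+ 2 <= \sum_(i in Y) E (fun x => W B i x ^+ 2) + eps * (\sum_(i in Y) mu i) ^+ 2.
Proof.
move=> YH BY Bt; apply: le_trans (second_moment YH BY Bt).
have -> : \sum_(i in Y) mu i = E (fun x => \sum_(i in Y) W B i x).
  by rewrite E_sum; apply: eq_bigr => i _; rewrite E_W.
have := Av_sqr_le m_gt0 setT (fun x => \sum_(i in Y) W B i x) [ffun=> Ordinal m_gt0].
by rewrite !Av_setT.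
Qed.

(** The averages [u] given [A] and [v] given [A'] are independent with mean [mu i], and pointwise
    [u * v >= f - f * (1 - u) - f * (1 - v)]. If both averages nearly determine the piece, then
    [mu i ^+ 2] is nearly [mu i], so the mass is close to 0 or 1. *)
Lemma mass_sqr_defect A A' i : [disjoint A & A'] ->
  mu i * (1 - mu i) <= (mu i - E (fun x => W A i x ^+ 2)) + (mu i - E (fun x => W A' i x ^+ 2)).
Proof.
move=> AA'; pose f := pfun R (Q i).
have fW B : E (fun x => f x * W B i x) = E (fun x => W B i x ^+ 2).
  transitivity (E (fun x => f x * Av (~: B) (W B i) x)).
    by apply: eq_E => x; rewrite Av_Av // setUid.
  by rewrite E_mul_Av //; apply: eq_E => x; rewrite expr2.
have ind1 : E (fun x => W A i x * W A' i x) = mu i * mu i.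
  rewrite (@E_indep_mul _ _ _ m_gt0 (~: A)) ?E_W //; first exact: indep_Av.
  by rewrite setCK; apply: indep_AvS; rewrite -disjoints_subset.
have : E (fun x => f x - (f x - f x * W A i x) - (f x - f x * W A' i x)) <= E (fun x => W A i x * W A' i x).
  apply: E_le => // x; have /andP[f0 f1] := pfun01 R (Q i) x; rewrite -/f in f0 f1.
  have := W_ge0 A i x; have := W_ge0 A' i x; have := W_le1 A i x; have := W_le1 A' i x.
  set u := W A i x; set v := W A' i x => v1 u1 v0 u0.
  have h1 : 0 <= (1 - f x) * (u * v) by apply: mulr_ge0; [lra | apply: mulr_ge0].
  have h2 : 0 <= f x * ((1 - u) * (1 - v)) by apply: mulr_ge0 => //; apply: mulr_ge0; lra.
  by lra.
rewrite ind1 !E_sub !fW -/(mass R (Q i)) => h.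
by lra.
Qed.

Definition clearof B (Y : {set I}) := [set i in Y | [disjoint B & supp (Q i)]].

(** A support of size [t] meets at most [t] of the disjoint blocks, so some block misses the
    supports that carry nearly all the mass. *)
Lemma clearof_average (Bs : seq {set 'I_n}) (Y : {set I}) :
  Y \subset H -> (0 < size Bs)%N ->
  pairwise (fun A B : {set 'I_n} => [disjoint A & B]) Bs ->
  exists2 B, B \in Bs &
    ((size Bs)%:R - t%:R) * \sum_(i in Y) mu i <= (size Bs)%:R * \sum_(i in clearof B Y) mu i.
Proof.
move=> /subsetP YH s0 pw; set L := _ * _.
case: (boolP (has (fun B => L <= (size Bs)%:R * \sum_(i in clearof B Y) mu i) Bs)) => [/hasP[B]|]; first by exists B.
move=> /hasPn h; exfalso.
have : (size Bs)%:R * \sum_(B <- Bs) \sum_(i in clearof B Y) mu i < (size Bs)%:R * L.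
  rewrite mulr_sumr; apply: lt_le_trans (_ : \sum_(B <- Bs) L <= _); last first.
    by rewrite big_const_seq count_predT iter_addr addr0 mulr_natl.
  have hlt B : B \in Bs -> (size Bs)%:R * \sum_(i in clearof B Y) mu i < L.
    by move=> /h; rewrite -ltNge.
  case: (Bs) s0 hlt => // B0 Bs' _ hlt; rewrite !big_cons; apply: ltr_leD; first by apply: hlt; rewrite inE eqxx.
  rewrite big_seq [X in _ <= X]big_seq; apply: ler_sum => B BB; apply/ltW/hlt.
  by rewrite inE BB orbT.
rewrite ltr_pM2l ?ltr0n // ltNge => /negP[].
rewrite /L mulr_sumr (eq_bigr (fun B => \sum_(i in Y) [disjoint B & supp (Q i)]%:R * mu i)); last first.
  move=> B _; rewrite big_mkcond [RHS]big_mkcond; apply: eq_bigr => i _; rewrite inE.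
  by case: (i \in Y) => //=; case: ifP => _; rewrite ?mul1r ?mul0r.
rewrite exchange_big /=; apply: ler_sum => i iY; rewrite -mulr_suml; apply: ler_wpM2r => //.
rewrite lerBlDr -natr_sum -natrD ler_nat.
have -> : (\sum_(B <- Bs) [disjoint B & supp (Q i)] = count (fun B : {set 'I_n} => [disjoint B & supp (Q i)]) Bs)%N.
  by rewrite -sum1_count [RHS]big_mkcond; apply: eq_bigr => B _; case: ifP.
have := count_meeting (supp (Q i)) pw; rewrite (Qt (YH i iY)) => h1.
by rewrite -(count_predC (fun B : {set 'I_n} => [disjoint B & supp (Q i)])) leq_add2l.
Qed.

(** Split the block into halves [A] and [A']. With total mass close to 1, the second moment bound
    leaves little room between [mu] and [E (W ^+ 2)] for either half; by [mass_sqr_defect] the sum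
    of [mu * (1 - mu)] is small, and the largest mass must be close to 1. *)
Lemma mass_exists_large (Bs : seq {set 'I_n}) (tau1 : R) :
  pairwise (fun A B : {set 'I_n} => [disjoint A & B]) Bs ->
  (forall B, B \in Bs -> #|B| = 2 * (t - 1))%N -> (144 * t <= size Bs)%N ->
  eps <= 144^-1 -> tau1 <= 144^-1 -> 1 - tau1 <= \sum_(i in H) mu i ->
  exists2 i, i \in H & 1 - mu i <= 12^-1.
Proof.
move=> pw Bt sB eps1 tau1s LamH.
have L0 : (0 < size Bs)%N by apply: leq_trans sB; rewrite muln_gt0.
have [B BB avg] := clearof_average (subxx H) L0 pw.
set Y := clearof B H in avg; set Lam := \sum_(i in Y) mu i in avg.
have YH : Y \subset H by apply/subsetP => i; rewrite inE => /andP[].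
have BY i : i \in Y -> [disjoint B & supp (Q i)] by rewrite inE => /andP[].
have [A AB cA] : exists2 A : {set 'I_n}, A \subset B & #|A| = (t - 1)%N.
  by apply: exists_subset_card; rewrite (Bt B BB) leq_pmull.
pose A' := B :\: A.
have A'B : A' \subset B by exact: subsetDl.
have cA' : #|A'| = (t - 1)%N by rewrite cardsD (setIidPr AB) (Bt B BB) cA mul2n -addnn addnK.
have AA' : [disjoint A & A'].
  by rewrite disjoint_sym disjoints_subset /A' setDE subsetIr.
have h1 := @far_mass A Y YH (fun i iY => disjointWl AB (BY i iY)).
have h2 := @far_mass A' Y YH (fun i iY => disjointWl A'B (BY i iY)).
rewrite cA in h1; rewrite cA' in h2.
have {}h1 := h1 (leqnn _); have {}h2 := h2 (leqnn _).
rewrite -/Lam in h1 h2.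
have tL : 144 * t%:R <= (size Bs)%:R :> R by rewrite -natrM ler_nat.
have t1 : 1 <= t%:R :> R by rewrite ler1n.
have LamY : 1 - 72^-1 <= Lam.
  have : (size Bs)%:R * (1 - 72^-1) <= (size Bs)%:R * Lam.
    apply: le_trans avg; apply: le_trans (_ : ((size Bs)%:R - t%:R) * (1 - tau1) <= _); last first.
      by apply: ler_wpM2l => //; lra.
    have := ler_wpM2l (_ : 0 <= (size Bs)%:R - t%:R) tau1s; nra.
  by rewrite ler_pM2l //; lra.
have Yne : exists i, i \in Y.
  apply/existsP; apply: contraT; rewrite negb_exists => /forallP h.
  by move: LamY; rewrite /Lam big1 => [|i iY]; [lra | have := h i; rewrite iY].
have [i0 i0Y] := Yne.
case: (@Order.TotalTheory.arg_maxP _ _ _ i0 (fun i => i \in Y) (fun i => mu i) i0Y) => i iY imax.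
exists i; first exact: (subsetP YH).
have h3 : (1 - mu i) * Lam <= 2 * Lam - 2 * Lam ^+ 2 + 2 * (eps * Lam ^+ 2).
  apply: le_trans (_ : \sum_(j in Y) ((mu j - E (fun x => W A j x ^+ 2)) + (mu j - E (fun x => W A' j x ^+ 2))) <= _).
    rewrite /Lam mulr_sumr; apply: ler_sum => j jY.
    apply: le_trans (mass_sqr_defect j AA'); rewrite mulrC; apply: ler_wpM2l => //.
    by rewrite lerD2l lerN2; exact: imax.
  by rewrite big_split /= !sumrB -/Lam; lra.
have Lam0 : 0 < Lam by lra.
have {}h3 : (1 - mu i) * Lam <= (2 - 2 * Lam + 2 * (eps * Lam)) * Lam.
  by apply: le_trans h3 _; rewrite le_eqVlt; apply/orP; left; apply/eqP; ring.
rewrite ler_pM2r // in h3; apply: le_trans h3 _.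
have : eps * Lam <= 144^-1 * Lam by rewrite ler_wpM2r // ltW.
by move: LamY; lra.
Qed.

(** Let [D] be the product of the defects of [i] seen from [A] and from [A']. By independence its
    mean is [del ^+ 2], yet nearly all the mass of every other piece clear of the block lies where
    [D] counts, since it hardly correlates with piece [i]. Cauchy-Schwarz bounds these masses by
    [2 * del ^+ 2], quadratic in the defect. *)
Lemma others_small (Bs : seq {set 'I_n}) i :
  pairwise (fun A B : {set 'I_n} => [disjoint A & B]) Bs ->
  (forall B, B \in Bs -> #|B| = 2 * (t - 1))%N -> (144 * t <= size Bs)%N ->
  eps <= 144^-1 -> i \in H -> 1 - mu i <= 12^-1 ->
  \sum_(j in H :\ i) mu j <= 3^-1 * (1 - mu i).
Proof.
move=> pw Bt sB eps1 iH; set del := 1 - mu i => del12.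
have del0 : 0 <= del by rewrite subr_ge0.
pose Bi := filter (fun B : {set 'I_n} => [disjoint B & supp (Q i)]) Bs.
have sBi : (143 * t <= size Bi)%N.
  have := count_meeting (supp (Q i)) pw; rewrite (Qt iH).
  have : (size Bi + count (fun B : {set 'I_n} => ~~ [disjoint B & supp (Q i)]) Bs = size Bs)%N.
    by rewrite size_filter; apply: count_predC.
  by move: sB; clear; lia.
have L0 : (0 < size Bi)%N by apply: leq_trans sBi; rewrite muln_gt0.
have pwi : pairwise (fun A B : {set 'I_n} => [disjoint A & B]) Bi by apply: pairwise_filter.
have ZH : H :\ i \subset H by exact: subsetDl.
have [B] := clearof_average ZH L0 pwi.
rewrite mem_filter => /andP[Bi0 BB].
set Y := clearof B _; set Lam := \sum_(j in Y) mu j; set Lam' := \sum_(j in _) mu j => avg.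
have Lam'0 : 0 <= Lam' by apply: sumr_ge0.
have Lam0 : 0 <= Lam by apply: sumr_ge0.
have YH : Y \subset H by apply: subset_trans ZH; apply/subsetP => j; rewrite inE => /andP[].
have Yi j : j \in Y -> j != i by rewrite !inE => /andP[/andP[]].
have BY j : j \in Y -> [disjoint B & supp (Q j)] by rewrite inE => /andP[].
have [A AB cA] : exists2 A : {set 'I_n}, A \subset B & #|A| = (t - 1)%N.
  by apply: exists_subset_card; rewrite (Bt B BB) leq_pmull.
pose A' := B :\: A.
have A'B : A' \subset B by exact: subsetDl.
have cA' : #|A'| = (t - 1)%N by rewrite cardsD (setIidPr AB) (Bt B BB) cA mul2n -addnn addnK.
have AA' : [disjoint A & A'].
  by rewrite disjoint_sym disjoints_subset /A' setDE subsetIr.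
pose D x := (1 - W A i x) * (1 - W A' i x).
have D01 x : 0 <= D x <= 1.
  have := W_ge0 A i x; have := W_ge0 A' i x; have := W_le1 A i x; have := W_le1 A' i x.
  by rewrite /D => *; apply/andP; split; [apply: mulr_ge0 | apply: mulr_ile1]; lra.
have indD : indep (~: B) D.
  move=> x y; rewrite /D; congr ((1 - _) * (1 - _)); apply: indep_AvS; by rewrite setCS.
have ED : E D = del ^+ 2.
  rewrite (@E_indep_mul _ _ _ m_gt0 (~: A) (fun x => 1 - W A i x) (fun x => 1 - W A' i x)).
  - by rewrite !E_sub !E_cst // !E_W expr2.
  - by move=> x y; rewrite indep_Av.
  - by rewrite setCK => x y; rewrite (indep_AvS (J := ~: A')) // -disjoints_subset.
have ED2 : E (fun x => D x ^+ 2) <= del ^+ 2.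
  rewrite -ED; apply: E_le => // x; have /andP[d0 d1] := D01 x.
  by rewrite expr2 ler_piMr.
have cross (C : {set 'I_n}) j : C \subset B -> (t - 1 <= #|C|)%N -> j \in Y ->
   E (fun x => pfun R (Q j) x * W C i x) <= eps * mu j.
  move=> CB cC jY; have -> : E (fun x => pfun R (Q j) x * W C i x) = E (fun x => W C j x * W C i x).
    transitivity (E (fun x => pfun R (Q j) x * Av (~: C) (W C i) x)); last by rewrite E_mul_Av.
    by apply: eq_E => x; rewrite Av_Av // setUid.
  apply: le_trans (far_correlation _ _ _ _ _ _) _ => //.
  - exact: (subsetP YH).
  - exact: Yi.
  - by apply: disjointWl CB _; apply: BY.
  - exact: disjointWl CB Bi0.
  by rewrite ler_pM2l // ler_piMr.
have lowj j : j \in Y -> (1 - 2 * eps) * mu j <= E (fun x => W B j x * D x).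
  move=> jY.
  have -> : E (fun x => W B j x * D x) = E (fun x => pfun R (Q j) x * D x).
    rewrite -E_mul_Av //; apply: eq_E => x; congr (_ * _); exact: Av_indep.
  apply: le_trans (_ : E (fun x => pfun R (Q j) x - pfun R (Q j) x * W A i x - pfun R (Q j) x * W A' i x) <= _); last first.
    apply: E_le => // x; have f0 := pfun_ge0 R (Q j) x.
    have h : 0 <= pfun R (Q j) x * (W A i x * W A' i x) by apply: mulr_ge0 => //; apply: mulr_ge0; apply: W_ge0.
    by rewrite /D; set u := W A i x in h *; set v := W A' i x in h *; lra.
  rewrite !E_sub -/(mass R (Q j)).
  have c1 := cross A j AB (eq_leq (esym cA)) jY.
  have c2 := cross A' j A'B (eq_leq (esym cA')) jY.
  by lra.
pose Psi x := \sum_(j in Y) W B j x.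
have low : (1 - 2 * eps) * Lam <= E (fun x => Psi x * D x).
  rewrite (@eq_E _ _ _ _ (fun x => \sum_(j in Y) W B j x * D x)); last by move=> x; rewrite mulr_suml.
  by rewrite E_sum /Lam mulr_sumr; apply: ler_sum => j jY; apply: lowj.
have EPsi : E (fun x => Psi x ^+ 2) <= Lam + eps * Lam ^+ 2.
  apply: le_trans (second_moment YH BY _) _; first by rewrite (Bt B BB) leq_pmull.
  by apply: lerD => //; apply: ler_sum => j _; apply: W_sqr_le.
have CS := EE_CS m_gt0 Psi D.
have d2 : 0 <= del ^+ 2 by exact: sqr_ge0.
have Psi0 : 0 <= E (fun x => Psi x ^+ 2) by apply: E_ge0 => // x; exact: sqr_ge0.
have e0 : 0 <= (1 - 2 * eps) * Lam by apply: mulr_ge0 => //; lra.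
have sq : ((1 - 2 * eps) * Lam) ^+ 2 <= (Lam + eps * Lam ^+ 2) * del ^+ 2.
  apply: le_trans (_ : E (fun x => Psi x * D x) ^+ 2 <= _).
    by apply: lerXn2r; rewrite ?nnegrE // (le_trans e0).
  apply: le_trans CS _; apply: ler_pM => //.
  by apply: E_ge0 => // x; exact: sqr_ge0.
have del144 : del ^+ 2 <= 144^-1.
  have : del ^+ 2 <= 12^-1 ^+ 2 by apply: lerXn2r; rewrite ?nnegrE //; lra.
  by rewrite expr2; lra.
have Lam_small : Lam <= 2 * del ^+ 2.
  have [L00|Lpos] := leP Lam 0; first by lra.
  have h4 : (1 - 2 * eps) ^+ 2 * Lam <= (1 + eps * Lam) * del ^+ 2.
    rewrite -(ler_pM2r Lpos); apply: le_trans (le_trans _ sq) _.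
      by rewrite le_eqVlt; apply/orP; left; apply/eqP; ring.
    by rewrite le_eqVlt; apply/orP; left; apply/eqP; ring.
  have h5 : 2^-1 * Lam + 4^-1 * Lam <= (1 - 2 * eps) ^+ 2 * Lam.
    rewrite -mulrDl ler_pM2r //; have := sqr_ge0 eps; lra.
  have h6 : eps * Lam * del ^+ 2 <= Lam * 144^-1.
    rewrite mulrAC [X in X <= _]mulrC; apply: ler_wpM2l => //.
    apply: le_trans (_ : 1 * del ^+ 2 <= _); last by rewrite mul1r.
    by apply: ler_wpM2r => //; lra.
  by lra.
have Lam'2 : Lam' <= 2 * Lam.
  have tL : 143 * t%:R <= (size Bi)%:R :> R by rewrite -natrM ler_nat.
  have t1 : 1 <= t%:R :> R by rewrite ler1n.
  have : (size Bi)%:R * Lam' <= (size Bi)%:R * (2 * Lam).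
    have h7 := ler_wpM2r Lam'0 tL; have h8 := mulr_ge0 (ler0n R (size Bi)) Lam0.
    by move: avg h7 h8; lra.
  by rewrite ler_pM2l ?ltr0n.
have : del ^+ 2 <= 12^-1 * del by rewrite expr2; apply: ler_wpM2r.
by lra.
Qed.

(** Bootstraps a constant defect to one of order [tau1]: the other masses fill at most a third of
    [1 - mu i], so the remaining two thirds are at most [tau1]. *)
Lemma dominant_mass (Bs : seq {set 'I_n}) (tau1 : R) :
  pairwise (fun A B : {set 'I_n} => [disjoint A & B]) Bs ->
  (forall B, B \in Bs -> #|B| = 2 * (t - 1))%N -> (144 * t <= size Bs)%N ->
  eps <= 144^-1 -> tau1 <= 144^-1 -> 1 - tau1 <= \sum_(i in H) mu i ->
  exists2 i, i \in H & 1 - mu i <= 2 * tau1.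
Proof.
move=> pw Bt sB eps1 tau1s LamH.
have [i iH i12] := mass_exists_large pw Bt sB eps1 tau1s LamH.
exists i => //; have := others_small pw Bt sB eps1 iH i12.
move: LamH; rewrite (bigD1 i) //= (eq_bigl (fun j => j \in H :\ i)); last first.
  by move=> j; rewrite !inE andbC.
by have := mu_ge0 i; have := mu_le1 i; lra.
Qed.
End FarFamily.

(** * A nearly full cube for short words *)

Section ShortWords.
Variables (R : realFieldType) (m n : nat).
Hypothesis m_gt0 : (0 < m)%N.
Local Notation word := {ffun 'I_n -> 'I_m}.
Local Notation piece := (piece m n).
Implicit Types (x y z w : word) (A B S T : {set 'I_n}) (X Y F : {set word}).

Lemma dense_cube_short F t (kap eta eps tau1 : R) :
  avoiding (t - 1) F -> (0 < t)%N -> 0 < kap -> 0 < eta ->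
  n%:R / m%:R <= eta ^+ 2 -> 2 * eta <= eps * kap ^+ 2 ->
  eps <= 144^-1 -> tau1 <= 144^-1 -> (144 * t * (2 * (t - 1)) <= n)%N ->
  (forall X, X \subset F -> (forall T z, #|T| = t -> dens R X T z <= kap) ->
     E (ind R X) <= tau1 * (m ^ t)%:R^-1) ->
  (m ^ t)%:R^-1 <= E (ind R F) ->
  exists T z, #|T| = t /\ 1 - dens R F T z <= 2 * tau1.
Proof.
move=> avF t0 kap0 eta0 nm eek eps1 tau1s nt light EF.
have mt : 0 < (m ^ t)%:R :> R by rewrite ltr0n expn_gt0 m_gt0.
pose z0 : word := [ffun=> Ordinal m_gt0].
pose Q (h : {set 'I_n} * word) : piece := (h.1, h.2, F :&: cube h.1 h.2).
(* The heavy cubes. Fixing the label to [z0] outside its support gives each cube a single index, so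
   that distinct indices have labels agreeing in fewer than [t] places. *)
pose H := [set h : {set 'I_n} * word | [&& #|h.1| == t, h.2 == mix h.1 z0 h.2 & kap <= dens R F h.1 h.2]].
have massQ h : mass R (Q h) = dens R F h.1 h.2 by rewrite mass_dens /= dens_cubeI.
have far h h' : h \in H -> h' \in H -> h != h' -> (#|agree_set (Q h) (Q h')| < t)%N.
  rewrite !inE => /and3P[/eqP ht /eqP hc _] /and3P[/eqP ht' /eqP hc' _].
  rewrite ltnNge; apply: contra => tle.
  have sub1 : agree_set (Q h) (Q h') \subset h.1 by apply/subsetP => i; rewrite !inE => /andP[/andP[]].
  have sub2 : agree_set (Q h) (Q h') \subset h'.1 by apply/subsetP => i; rewrite !inE => /andP[/andP[]].
  have e1 : agree_set (Q h) (Q h') = h.1 by apply/eqP; rewrite eqEcard sub1 ht.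
  have e2 : agree_set (Q h) (Q h') = h'.1 by apply/eqP; rewrite eqEcard sub2 ht'.
  have e : h.1 = h'.1 by rewrite -e1 -e2.
  have ew : h.2 = h'.2.
    rewrite hc hc' -e; apply/ffunP => i; rewrite !mixE; case: ifP => // ih.
    by move: ih; rewrite -{1}e1 !inE => /andP[_ /eqP].
  by apply/eqP; case: h h' e ew {ht hc ht' hc' tle sub1 sub2 e1 e2} => [? ?] [? ?] /= -> ->.
pose X := [set x in F | [forall h in H, x \notin cube h.1 h.2]].
have XF : X \subset F by apply/subsetP => x; rewrite inE => /andP[].
have lightX T z : #|T| = t -> dens R X T z <= kap.
  move=> Tt; have [d|d] := leP (dens R F T z) kap; first by apply: le_trans d; apply: (dens_le R m_gt0 _ _ XF).
  have zc : mix T z0 z \in cube T z by exact: mix_in_cube.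
  have hH : (T, mix T z0 z) \in H.
    rewrite inE /= Tt eqxx (dens_cube_eq R F zc) ltW // andbT /=.
    by apply/eqP/ffunP => i; rewrite !mixE; case: (i \in T).
  rewrite densE // [X :&: _](_ : _ = set0) ?cards0 ?mul0r ?ltW //.
  apply/setP => x; rewrite in_set0 in_setI; apply/negbTE/negP => /andP[].
  rewrite in_set => /andP[_ /forall_inP/(_ _ hH)] /= /negP hx /cubeP xz; apply: hx.
  by apply/cubeP => i iT; rewrite mixE iT xz.
have EX := light X XF lightX.
have EFle : E (ind R F) <= tau1 * (m ^ t)%:R^-1 + (m ^ t)%:R^-1 * \sum_(h in H) mass R (Q h).
  apply: le_trans (_ : E (fun x => ind R X x + \sum_(h in H) ind R (F :&: cube h.1 h.2) x) <= _).
    apply: E_le => // x; have s0 (P : pred ({set 'I_n} * word)) : 0 <= \sum_(h | P h) ind R (F :&: cube h.1 h.2) x.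
      by apply: sumr_ge0 => *; apply: ind_ge0.
    rewrite /ind in_set; case: (boolP (x \in F)) => xF /=; last by rewrite addr_ge0 // s0.
    case: (boolP [forall h in H, x \notin cube h.1 h.2]) => [_|]; first by rewrite lerDl s0.
    rewrite negb_forall_in => /exists_inP[h hH]; rewrite negbK => xh.
    by rewrite add0r (bigD1 h) //= in_setI xF xh lerDl; apply: s0.
  rewrite E_add E_sum lerD // mulr_sumr; apply: ler_sum => h; rewrite in_set => /and3P[/eqP ht _ _].
  by rewrite E_indI_cube // massQ ht.
have LamH : 1 - tau1 <= \sum_(h in H) mass R (Q h).
  have := le_trans EF EFle; rewrite mulrC -mulrDr -{1}[_^-1]mulr1 ler_pM2l ?invr_gt0 //; lra.
have [Bs [sB Bt pw]] : exists Bs : seq {set 'I_n}, [/\ size Bs = (144 * t)%N, forall B, B \in Bs -> B \subset setT /\ #|B| = (2 * (t - 1))%N &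
    pairwise (fun A B : {set 'I_n} => [disjoint A & B]) Bs].
  by apply: disjoint_family; rewrite cardsT card_ord.
have QF h : members (Q h) \subset F by exact: subsetIl.
have Qt h : h \in H -> #|supp (Q h)| = t by rewrite in_set => /and3P[/eqP].
have Qk h : h \in H -> kap <= mass R (Q h) by rewrite massQ in_set => /and3P[].
have [h hH hm] := dominant_mass m_gt0 avF t0 QF Qt far Qk kap0 eta0 nm eek pw (fun B BB => (Bt B BB).2) (eq_leq (esym sB)) eps1 tau1s LamH.
exists h.1, h.2; rewrite -massQ; split=> //; exact: Qt.
Qed.
End ShortWords.

(** * Choice of parameters *)

Lemma floor_root (k m : nat) : (0 < k)%N -> (0 < m)%N ->
  exists2 b : nat, (b ^ k <= m)%N & (m < b.+1 ^ k)%N.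
Proof.
move=> k0 m0; have ex : exists b, (b ^ k <= m)%N by exists 0; rewrite exp0n.
have bd b : (b ^ k <= m)%N -> (b <= m)%N.
  by apply: leq_trans; case: b => // b; rewrite -{1}(expn1 b.+1) leq_pexp2l.
case: (ex_maxnP ex bd) => b bm bmax; exists b => //.
by rewrite ltnNge; apply/negP => /bmax; rewrite ltnn.
Qed.

Section Extremal.
Variables (R : realFieldType) (m n : nat).
Hypothesis m_gt0 : (0 < m)%N.
Local Notation word := {ffun 'I_n -> 'I_m}.
Implicit Types (x y z w : word) (A B S T : {set 'I_n}) (X Y F : {set word}).

Definition extremal t F :=
  E (ind R F) <= (m ^ t)%:R^-1 /\
  (E (ind R F) = (m ^ t)%:R^-1 -> exists T z, #|T| = t /\ F = cube T z).

Lemma extremal_of_dense F t l (be : nat) :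
  (0 < t)%N -> avoiding (t - 1) F ->
  (1 < l)%N -> (l < m)%N -> (l * t + t <= n)%N -> (0 < be)%N ->
  2 * l.+1%:R * m%:R ^+ t <= be%:R ^+ (l - 2) :> R ->
  ((m ^ t)%:R^-1 <= E (ind R F) ->
    exists T z, #|T| = t /\ (1 - dens R F T z) * be%:R ^+ 2 <= 1) ->
  extremal t F.
Proof.
move=> t0 avF l1 lm ln be0 pw dense; rewrite /extremal.
have [EF|EF] := leP ((m ^ t)%:R^-1) (E (ind R F)); last first.
  by split; [exact: ltW|move=> e; rewrite e ltxx in EF].
have [T [z [Tt d]]] := dense EF.
have [le eq] := stability m_gt0 t0 avF Tt l1 lm ln be0 d pw.
by split=> // /eq ->; exists T, z.
Qed.

(** Everything is a power of [b], the integer part of the [q]-th root of [m]. With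
    [kap = b ^ -(t + 4)] and [eps = 1 / b], the second moment asks for [eta = b ^ -(2 t + 9) / 2];
    then [n / m <= eta ^+ 2] follows from [4 n <= b] and [m >= b ^ (4 t + 19)], whence [q]. As
    [m <= b ^ (2 q)], the choice of [r] gives [m ^ (t + 1) <= b ^ r], and [l] makes [b ^ (l - 2)]
    exceed [2 (l + 1) m ^ t]. The bound on [m] puts [b] above [4 (4 n) ^ r], the cost of summing
    over supports. *)
Lemma extremal_short F t (q := (4 * t + 19)%N) (r := (2 * q * (t + 1))%N) (l := (2 * q * t + 4)%N) :
  avoiding (t - 1) F -> (0 < t)%N ->
  (144 * t * (2 * (t - 1)) <= n)%N -> (r + t <= n)%N -> (l * t + t <= n)%N ->
  ((4 * n) ^ (r.+1 * q) <= m)%N -> extremal t F.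
Proof.
move=> avF t0 n1 n2 n3 nm.
have q0 : (0 < q)%N by rewrite /q addnS.
have [b bm mb] := floor_root q0 m_gt0.
have r92 : (92 <= r)%N.
  by rewrite /r; have : (2 * 23 <= 2 * q)%N by [rewrite leq_mul2l /q; clear -t0; lia]; clear -t0; nia.
have n92 : (92 <= n)%N by clear -r92 n2; lia.
have nb : ((4 * n) ^ r.+1 <= b)%N.
  have : (((4 * n) ^ r.+1) ^ q < b.+1 ^ q)%N by rewrite -expnM; apply: leq_ltn_trans mb.
  by rewrite ltn_exp2r.
have n4b : (4 * n <= b)%N.
  by apply: leq_trans nb; rewrite -{1}[(4 * n)%N]expn1 leq_pexp2l //; clear -n92; lia.
have nrb : (4 * (4 * n) ^ r <= b)%N.
  by apply: leq_trans nb; rewrite expnS leq_mul2r; apply/orP; right; clear -n92; lia.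
have b368 : (368 <= b)%N by clear -n92 n4b; lia.
have b0 : (0 < b)%N by clear -b368; lia.
have mb2 : (m <= b ^ (2 * q))%N.
  by apply: ltnW; apply: (leq_trans mb); rewrite expnM leq_exp2r //; clear -b368; nia.
pose B : R := b%:R.
have B368 : 368 <= B by rewrite /B ler_nat.
have B0 : 0 < B by clear -B368; lra.
have B1lt : 1 < B by clear -B368; lra.
have BnZ : B != 0 by rewrite gt_eqF.
have M0 : 0 < m%:R :> R by rewrite ltr0n.
have BE : B ^+ (4 * t + 19) <= m%:R by rewrite -natrX ler_nat.
have n4B : 4 * n%:R <= B by rewrite -natrM ler_nat.
pose kap : R := (B ^+ (t + 4))^-1.
pose eta : R := (2 * B ^+ (2 * t + 9))^-1.
have mt0 : 0 < (m ^ t)%:R :> R by rewrite ltr0n expn_gt0 m_gt0.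
have kap0 : 0 < kap by rewrite invr_gt0 exprn_gt0.
have B4m : B ^+ 4 <= m%:R.
  by apply: le_trans BE; rewrite (ler_eXn2l B1lt); clear; lia.
have light X : X \subset F -> (forall T z, #|T| = t -> dens R X T z <= kap) ->
     E (ind R X) <= 2 / B ^+ 4 * (m ^ t)%:R^-1.
  move=> XF lX.
  have avX : avoiding (t - 1) X by move=> x y xX yX; apply: avF; apply: (subsetP XF).
  have tau0 : 0 < (m ^ t.+1)%:R^-1 :> R by rewrite invr_gt0 ltr0n expn_gt0 m_gt0.
  have tb : 1 <= (m ^ t.+1)%:R^-1 * B ^+ r.
    rewrite mulrC ler_pdivlMr ?ltr0n ?expn_gt0 ?m_gt0 // mul1r -natrX ler_nat /r -addn1 expnM.
    by rewrite leq_exp2r // addn1.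
  have nbm : 64 * n%:R * B ^+ (3 * t) <= m%:R.
    apply: le_trans BE; rewrite (_ : 4 * t + 19 = 2 + (t + 17 + 3 * t))%N; last by clear; lia.
    rewrite exprD; apply: ler_pM; first by rewrite mulr_ge0.
    - by rewrite exprn_ge0 // ltW.
    - rewrite expr2; apply: le_trans (_ : B * (4 * n%:R) <= _); last by rewrite ler_pM2l.
      by rewrite mulrA ler_wpM2r //; clear -B368; lra.
    - by rewrite (ler_eXn2l B1lt) leq_addl.
  have B1 : 1 <= B by clear -B368; lra.
  have n0 : (0 < n)%N by clear -n92; lia.
  apply: le_trans (light_bound m_gt0 avX t0 B1 tau0 tb n0 lX (ltW kap0) nbm n2) _.
  rewrite (_ : 2 / _ = (B ^+ 4)^-1 + (B ^+ 4)^-1); last by clear; set q := (_ ^-1); ring.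
  rewrite [X in _ <= X]mulrDl; apply: lerD.
    by rewrite expnS natrM invfM ler_pM2r ?invr_gt0 // lef_pV2 ?posrE ?exprn_gt0.
  rewrite ler_pM2r ?invr_gt0 // /kap exprD invfM mulrA ler_piMl ?invr_ge0 ?exprn_ge0 ?(ltW B0) //.
  rewrite -/B ler_pdivrMr ?exprn_gt0 // mul1r -[X in _ <= _ ^+ X](subnK t0) addn1 exprSr mulrC.
  rewrite ler_pM2l ?exprn_gt0 //.
  by rewrite (_ : 4 * (4 * n%:R) ^+ r = (4 * (4 * n) ^ r)%:R) ?ler_nat // natrM natrX natrM.
have eta0 : 0 < eta by rewrite invr_gt0 mulr_gt0 ?exprn_gt0.
have neta : n%:R / m%:R <= eta ^+ 2.
  rewrite ler_pdivrMr // /eta exprVn mulrC ler_pdivlMr ?exprn_gt0 ?mulr_gt0 ?exprn_gt0 //.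
  apply: le_trans BE; rewrite (_ : 4 * t + 19 = 1 + (2 * t + 9) * 2)%N; last by clear; lia.
  rewrite [X in _ <= X]exprD [X in _ <= _ * X]exprM exprMn mulrA expr1 ler_pM2r ?exprn_gt0 //.
  have -> : n%:R * 2 ^+ 2 = 4 * n%:R :> R by ring.
  exact: n4B.
have eek : 2 * eta <= B^-1 * kap ^+ 2.
  rewrite /eta /kap invfM mulrA divff ?pnatr_eq0 // mul1r exprVn -invfM -exprM -exprS.
  by rewrite (_ : ((t + 4) * 2).+1 = (2 * t + 9)%N) //; clear; lia.
have eps1 : B^-1 <= 144^-1.
  by rewrite lef_pV2 ?posrE //; clear -B368; lra.
have B4 : 368 <= B ^+ 4.
  by apply: le_trans B368 _; rewrite -{1}[B]expr1 (ler_eXn2l B1lt).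
have tau1s : 2 / B ^+ 4 <= 144^-1.
  by rewrite ler_pdivrMr ?exprn_gt0 //; clear -B4; lra.
have lm : (l < m)%N.
  have : (b ^ 1 <= b ^ q)%N by rewrite leq_pexp2l.
  have : (l * 1 <= l * t)%N by rewrite leq_mul2l t0 orbT.
  by clear -bm n4b n3 t0; lia.
apply: (@extremal_of_dense F t l b) => //.
- by rewrite /l; clear; lia.
- have lb : (2 * l.+1 <= b ^ 2)%N.
    have : (l * 1 <= l * t)%N by rewrite leq_mul2l t0 orbT.
    have : (b * 1 <= b * b)%N by rewrite leq_mul2l b0 orbT.
    by rewrite -mulnn; clear -n4b n3 t0; lia.
  rewrite -!natrX -!natrM ler_nat (_ : l - 2 = 2 + 2 * q * t)%N; last by rewrite /l; clear; lia.
  by rewrite expnD leq_mul // expnM leq_exp2r.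
move=> EF; have [T [z [Tt d]]] := dense_cube_short m_gt0 avF t0 kap0 eta0 neta eek eps1 tau1s n1 light EF.
exists T, z; split=> //.
apply: (le_trans (ler_wpM2r (exprn_ge0 2 (ltW B0)) d)).
rewrite -/B [2 * (2 / _)]mulrA mulrAC ler_pdivrMr ?exprn_gt0 // mul1r.
rewrite [X in _ <= X](exprD B 2 2) ler_pM2r ?exprn_gt0 //.
by rewrite expr2; clear -B368; nra.
Qed.
End Extremal.

(** Raise [l <= k * 2 ^ (l %/ k)] to the power [k]. It will bound powers of a logarithm by the
    number itself. *)
Lemma leq_exp_self k l : (l ^ k <= k ^ k * 2 ^ l)%N.
Proof.
have [->|k0] := posnP k; first by rewrite mul1n expn_gt0.
have lk : (l <= k * 2 ^ (l %/ k))%N.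
  by rewrite mulnC; apply: ltnW; apply: (leq_trans (ltn_ceil l k0)); rewrite leq_mul2r ltn_expl ?orbT.
have : (l ^ k <= (k * 2 ^ (l %/ k)) ^ k)%N by rewrite leq_exp2r.
move/leq_trans; apply; rewrite expnMn leq_mul2l; apply/orP; right.
by rewrite -expnM leq_exp2l // leq_trunc_div.
Qed.

Section ExtremalLong.
Variables (R : realFieldType) (m n : nat).
Hypothesis m_gt0 : (0 < m)%N.
Local Notation word := {ffun 'I_n -> 'I_m}.
Implicit Types (x y z w : word) (A B S T : {set 'I_n}) (X Y F : {set word}).

(** The cube found has defect at most [(1 + 16 e ^ 3) / m]. Since [17 e ^ 3] is at most the square
    root of [m], this survives multiplication by [b ^ 2] when [b] is the integer part of the fourth
    root of [m]. Then [m <= b ^ 8], which explains [l = 8 t + 4]. *)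
Lemma extremal_long F t e (l := (8 * t + 4)%N) :
  avoiding (t - 1) F -> (0 < t)%N -> (0 < e)%N ->
  (m ^ t.+1 <= 2 ^ (2 * e))%N -> ((17 * e ^ 3) ^ 2 <= m)%N -> ((91 * e) ^ 2 < m)%N ->
  ((26 * t) ^ 4 <= m)%N -> (4 * e + t * (91 * e) ^ 2 <= n)%N -> (l * t + t <= n)%N ->
  extremal R t F.
Proof.
move=> avF t0 e0 me e3m e2m tm en ln.
have [b bm mb] := floor_root (isT : 0 < 4)%N m_gt0.
have tb : (26 * t <= b)%N by have := leq_ltn_trans tm mb; rewrite ltn_exp2r.
have b26 : (26 <= b)%N by clear -tb t0; lia.
have b0 : (0 < b)%N by clear -b26; lia.
have mb2 : (m <= b ^ 8)%N.
  by apply: ltnW; apply: (leq_trans mb); rewrite (expnM b 2 4) leq_exp2r //; clear -b26; nia.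
have b1m : (b <= m)%N by apply: leq_trans bm; rewrite -{1}[b]expn1 leq_pexp2l.
apply: (@extremal_of_dense R m n m_gt0 F t l b) => //.
- by rewrite /l; clear; lia.
- by rewrite /l; clear -tb b1m t0; lia.
- have lb : (2 * l.+1 <= b ^ 2)%N by rewrite /l -mulnn; clear -tb t0; nia.
  rewrite -!natrX -!natrM ler_nat (_ : l - 2 = 2 + 8 * t)%N; last by rewrite /l; clear; lia.
  by rewrite expnD leq_mul // expnM leq_exp2r.
move=> EF.
have m1 : (1 < m)%N by clear -b26 b1m; lia.
have e1 : (e <= e ^ 3)%N by rewrite -{1}[e]expn1 leq_pexp2l.
have h2 : (16 * e ^ 3 * 2 <= m)%N by apply: leq_trans e3m; clear -e0 e1; set a := (e ^ 3)%N in e1 *; nia.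
have h3 : (4 * e + t <= n)%N.
  by apply: leq_trans en; rewrite leq_add2l leq_pmulr // expn_gt0 muln_gt0 e0.
have n4 : (t * (91 * e) ^ 2 <= n - 4 * e)%N by clear -en; lia.
pose e2 : R := e%:R ^+ 2.
have e20 : 0 < e2 by rewrite exprn_gt0 // ltr0n.
(* Both summands are at most [1 / (91 * e) ^ 2], and [91 ^ 2 = 8281] exceeds [2 * 4096]. *)
have h4 : (t%:R / (n - 4 * e)%:R + m.-1%:R^-1) * (4096 * e%:R ^+ 2) < 1 :> R.
  have n40 : 0 < (n - 4 * e)%:R :> R.
    by rewrite ltr0n; apply: leq_trans n4; rewrite muln_gt0 t0 expn_gt0 muln_gt0 e0.
  have m10 : 0 < m.-1%:R :> R by rewrite ltr0n; clear -m1; lia.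
  have ee0 : 0 < 91 ^+ 2 * e2 by apply: mulr_gt0 => //; apply: exprn_gt0; rewrite ltr0n.
  have a1 : t%:R / (n - 4 * e)%:R <= (91 ^+ 2 * e2)^-1 :> R.
    rewrite ler_pdivrMr // mulrC ler_pdivlMr // -exprMn -natrM -natrX -natrM ler_nat //.
  have a2 : m.-1%:R^-1 <= (91 ^+ 2 * e2)^-1 :> R.
    by rewrite lef_pV2 ?posrE // -exprMn -natrM -natrX ler_nat; clear -e2m; lia.
  rewrite -/e2; apply: le_lt_trans (_ : ((91 ^+ 2 * e2)^-1 + (91 ^+ 2 * e2)^-1) * (4096 * e2) < 1).
    apply: ler_wpM2r; last exact: lerD.
    by apply: mulr_ge0; [rewrite ler0n|exact: ltW].
  rewrite (_ : _ * _ = 8192 / 91 ^+ 2); last by field; rewrite gt_eqF.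
  by rewrite ltr_pdivrMr ?exprn_gt0 // mul1r -natrX ltr_nat expnS expn1; lia.
have [T [z [Tt d]]] := dense_cube_long m_gt0 avF t0 e0 m1 me h2 h3 h4 EF.
exists T, z; split=> //.
have M0 : 0 < m%:R :> R by rewrite ltr0n.
apply: (le_trans (ler_wpM2r (exprn_ge0 2 (ler0n R b)) d)).
rewrite mulrAC ler_pdivrMr // mul1r.
have : ((1 + 16 * e ^ 3) * b ^ 2 <= m)%N.
  rewrite -(@leq_exp2r _ _ 2) // expnMn -expnM -[X in (_ <= X)%N]mulnn leq_mul //.
  apply: leq_trans e3m; rewrite leq_exp2r //; clear -e1 e0.
  by set a := (e ^ 3)%N in e1 *; lia.
by rewrite -(ler_nat R) natrM natrD natrM !natrX.
Qed.
End ExtremalLong.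

Lemma poly_log_sq_leq a c (k n p : nat) :
  (p ^ (2 * k) <= c * n)%N -> (a ^ 2 * c < n)%N -> (a * p ^ k < n)%N.
Proof.
move=> pk an; rewrite -(@ltn_exp2r _ _ 2) // expnMn -expnM [(k * 2)%N]mulnC.
have n0 : (0 < n)%N by apply: leq_ltn_trans an.
apply: (@leq_ltn_trans (a ^ 2 * (c * n))); first by rewrite leq_mul2l pk orbT.
by rewrite mulnA -mulnn ltn_mul2r n0.
Qed.

(* [a], [c1] and [c2] are variables because unification would evaluate numerals
   like [12 ^ 12] in unary. *)
Lemma extremal_large (R : realFieldType) (a c1 c2 m n : nat) (m_gt0 : (0 < m)%N) t (F : {set {ffun 'I_n -> 'I_m}}) :
  (forall l, l ^ 12 <= c1 * 2 ^ l)%N -> (forall l, l ^ 4 <= c2 * 2 ^ l)%N ->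
  a = (183 * 2139)%N ->
  avoiding (t - 1) F -> (0 < t)%N ->
  (182 ^ 4 * (2 * c1 + 1) * t ^ 12 <= m)%N ->
  ((a ^ 4 * (8 * c2) + 288) * t ^ 18 <= n)%N ->
  extremal R t F.
Proof.
move=> hc1 hc2 ha avF t0 mt nt.
pose q := (4 * t + 19)%N; pose r := (2 * q * (t + 1))%N; pose D := (r.+1 * q)%N.
have tle i j : (i <= j)%N -> (t ^ i <= t ^ j)%N by move=> ij; rewrite leq_pexp2l.
have n18 : (288 * t ^ 18 <= n)%N.
  by apply: leq_trans nt; rewrite leq_mul2r leq_addl orbT.
have ntk k d : (d <= 288)%N -> (k <= 18)%N -> (d * t ^ k <= n)%N.
  by move=> d1 k1; apply: leq_trans n18; rewrite leq_mul // tle.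
have q23 : (q <= 23 * t)%N by rewrite /q; clear -t0; lia.
have r93 : (r.+1 <= 93 * t ^ 2)%N.
  apply: (@leq_trans (2 * (23 * t) * (2 * t) + t ^ 2)).
    rewrite -[r.+1]addn1 leq_add ?expn_gt0 ?t0 // /r leq_mul //; last by clear -t0; lia.
    by rewrite leq_mul2l q23.
  by rewrite -mulnn; apply/eq_leq; clear; lia.
have Dt : (D <= 2139 * t ^ 3)%N.
  by apply: (leq_trans (leq_mul r93 q23)); rewrite (expnS t 2); apply/eq_leq; clear; lia.
have [short|long] := leqP ((4 * n) ^ D) m.
  apply: (@extremal_short R m n m_gt0 F t avF t0 _ _ _ short); rewrite -?/q -?/r.
  - by apply: leq_trans (ntk 2 288 _ _) => //; rewrite -mulnn; clear; nia.
  - apply: leq_trans (ntk 2 94 _ _) => //; have := tle 1 2 isT; rewrite expn1; clear -r93; lia.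
  - apply: leq_trans (ntk 3 51 _ _) => //.
    have : (2 * q * t * t <= 2 * (23 * t) * t * t)%N by rewrite !leq_mul2r leq_mul2l q23 !orbT.
    have := tle 2 3 isT; have := tle 1 3 isT; rewrite expn1 -mulnn (expnS t 2) -mulnn; clear.
    set u := (2 * q * t * t)%N => h1 h2 h3.
    have -> : ((2 * q * t + 4) * t + t = u + 5 * t)%N by rewrite /u; clear; ring.
    clearbody u; nia.
(* [lam] and [mu] are integer upper bounds for the binary logarithms of [m] and [4 n]. Failure of
   the first case gives [lam <= mu * D], so [lam] is polynomial in [t] and [log n]. *)
pose lam := (trunc_log 2 m).+1.
have mlam : (m < 2 ^ lam)%N by apply: trunc_log_ltn.
have lamm : (2 ^ lam <= 2 * m)%N by rewrite expnS leq_mul2l trunc_logP.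
have n0 : (0 < n)%N by apply: leq_trans n18; rewrite muln_gt0 expn_gt0 t0.
pose mu := (trunc_log 2 n + 3)%N.
have nmu : (4 * n < 2 ^ mu)%N.
  by rewrite /mu (_ : trunc_log 2 n + 3 = 2 + (trunc_log 2 n).+1)%N ?expnD ?ltn_pmul2l ?trunc_log_ltn // addnS addnC.
have mun : (2 ^ mu <= 8 * n)%N.
  by rewrite /mu addnC expnD leq_mul2l trunc_logP.
have lamD : (lam <= mu * D)%N.
  have : (2 ^ trunc_log 2 m < 2 ^ (mu * D))%N.
    apply: (leq_ltn_trans (trunc_logP _ m_gt0)) => //; apply: (leq_trans long).
    by rewrite expnM leq_exp2r ?(ltnW nmu) // muln_gt0 /q addnS.
  by rewrite ltn_exp2l.
pose e := (t.+1 * lam)%N.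
have et : (e <= 2 * t * lam)%N by rewrite leq_mul2r; apply/orP; right; clear -t0; lia.
(* [m] beats a power of its own logarithm: squaring once more yields [lam ^ 12 <= 2 * c1 * m], and
   the factor [t ^ 12] in the lower bound on [m]. *)
have m182 : ((182 * t ^ 3 * lam ^ 3) ^ 2 < m)%N.
  rewrite expnMn -expnM; apply: (@poly_log_sq_leq _ (2 * c1)).
    by apply: (leq_trans (hc1 _)); rewrite [(2 * c1)%N]mulnC -mulnA leq_mul2l lamm orbT.
  apply: leq_trans mt; rewrite -expnM expnMn -expnM mulnAC ltn_mul2r expn_gt0 t0 /=.
  by rewrite addn1 ltn_mul2l expn_gt0 ltnSn.
(* Likewise [n] beats a power of its logarithm; squaring [t ^ 9] produces the [t ^ 18]. In [a], the
   factor 2139 comes from [Dt], and [183 ^ 2] covers [182 ^ 2 + 8], the coefficients of the terms in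
   [e ^ 2] and in [e]. *)
have n183 : (a ^ 2 * t ^ 9 * mu ^ 2 < n)%N.
  apply: (@poly_log_sq_leq _ (8 * c2)).
    by apply: (leq_trans (hc2 _)); rewrite [(8 * c2)%N]mulnC -mulnA leq_mul2l mun orbT.
  apply: leq_trans nt; rewrite expnMn -!expnM mulnAC ltn_mul2r expn_gt0 t0 /=.
  by rewrite addnS ltnS leq_addr.
have e0 : (0 < e)%N by rewrite muln_gt0.
have t13 : (t <= t ^ 3)%N by have := tle 1 3 isT; rewrite expn1.
have l13 : (lam <= lam ^ 3)%N by rewrite -{1}[lam]expn1 leq_pexp2l.
apply: (@extremal_long R m n m_gt0 F t e avF t0 e0).
- have : (m ^ t.+1 <= (2 ^ lam) ^ t.+1)%N by rewrite leq_exp2r // ltnW.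
  move/leq_trans; apply; rewrite -expnM leq_exp2l // /e [(lam * _)%N]mulnC.
  by rewrite leq_pmull.
- apply: ltnW; apply: leq_ltn_trans m182; rewrite leq_exp2r //.
  have : (e ^ 3 <= 8 * (t ^ 3 * lam ^ 3))%N.
    by apply: (@leq_trans ((2 * t * lam) ^ 3)); rewrite ?leq_exp2r // !expnMn -mulnA.
  by move: (e ^ 3)%N (t ^ 3)%N (lam ^ 3)%N; clear; move=> w u v; lia.
- apply: leq_ltn_trans m182; rewrite leq_exp2r //.
  apply: (leq_trans (leq_mul (leqnn 91) et)).
  by rewrite (_ : 91 * (2 * t * lam) = 182 * t * lam)%N; [rewrite leq_mul ?leq_mul|clear; lia].
- have : ((26 * t) ^ 4 <= (182 * t ^ 3) ^ 4)%N by rewrite leq_exp2r // leq_mul.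
  move/leq_trans; apply; apply: leq_trans mt; rewrite expnMn -expnM mulnAC.
  by rewrite leq_pmulr // addn1.
- apply: ltnW; apply: leq_ltn_trans n183.
  have e2 : (t * (91 * e) ^ 2 <= 182 ^ 2 * (t ^ 3 * lam ^ 2))%N.
    apply: (@leq_trans (t * (182 * t * lam) ^ 2)).
      by rewrite leq_mul2l leq_exp2r // (_ : 182 * t * lam = 91 * (2 * t * lam))%N ?leq_mul2l ?et ?orbT //; clear; lia.
    rewrite (expnMn _ lam) (expnMn _ t) (expnS t 2); apply/eq_leq; move: (182 ^ 2)%N (t ^ 2)%N (lam ^ 2)%N => x y z; clear.
    by ring.
  have e1 : (4 * e <= 8 * (t ^ 3 * lam ^ 2))%N.
    have : (t * lam <= t ^ 3 * lam ^ 2)%N by rewrite leq_mul // -{1}[lam]expn1 leq_pexp2l.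
    by move: et; move: (t ^ 3 * lam ^ 2)%N => u; clear; clearbody e; nia.
  have tl : (t ^ 3 * lam ^ 2 <= 2139 ^ 2 * (t ^ 9 * mu ^ 2))%N.
    have : (lam ^ 2 <= (mu * (2139 * t ^ 3)) ^ 2)%N.
      by rewrite leq_exp2r // (leq_trans lamD) // leq_mul2l Dt orbT.
    rewrite (expnMn mu) (expnMn 2139) -(expnM t) => h; apply: (leq_trans (leq_mul (leqnn _) h)).
    rewrite (expnD t 3 (3 * 2)); apply/eq_leq.
    move: (2139 ^ 2)%N (t ^ 3)%N (t ^ (3 * 2))%N (mu ^ 2)%N => x y z u; clear.
    by ring.
  apply: (leq_trans (leq_add e1 e2)); rewrite -mulnDl ha expnMn.
  have c183 : (8 + 182 ^ 2 <= 183 ^ 2)%N by rewrite -!mulnn; clear; lia.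
  apply: (leq_trans (leq_mul c183 tl)); apply/eq_leq; clear.
  by move: (183 ^ 2)%N (2139 ^ 2)%N (t ^ 9)%N (mu ^ 2)%N => x y z u; ring.
- apply: leq_trans (ntk 2 13 _ _) => //; have := tle 1 2 isT; rewrite expn1 -mulnn; clear.
  nia.
Qed.

Lemma extremal_poly (R : realFieldType) : exists c d : nat, forall m n (m_gt0 : (0 < m)%N) t
  (F : {set {ffun 'I_n -> 'I_m}}), avoiding (t - 1) F -> (0 < t)%N ->
  (c * t ^ 12 <= m)%N -> (d * t ^ 18 <= n)%N -> extremal R t F.
Proof.
have [c1 h1] : exists c1, forall l, (l ^ 12 <= c1 * 2 ^ l)%N by exists (12 ^ 12)%N => l; apply: leq_exp_self.
have [c2 h2] : exists c2, forall l, (l ^ 4 <= c2 * 2 ^ l)%N by exists (4 ^ 4)%N => l; apply: leq_exp_self.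
have [a ha] : exists a, a = (183 * 2139)%N by eexists.
exists (182 ^ 4 * (2 * c1 + 1))%N, (a ^ 4 * (8 * c2) + 288)%N => m n m_gt0 t F avF t0 mt nt.
exact: (extremal_large R m_gt0 h1 h2 ha avF t0 mt nt).
Qed.

(** * From densities to cardinalities and restrictions *)

Lemma restr_cube m n (T : {set 'I_n}) (w : word m n) :
  [set x : word m n | restr T x == restr T w] = cube T w.
Proof.
apply/setP => x; rewrite inE; apply/eqP/cubeP => [e i iT|xw].
  by have /ffunP/(_ (exist _ i iT)) := e; rewrite !ffunE.
by apply/ffunP => i; rewrite !ffunE xw // (valP i).
Qed.

Lemma restr_surj m n (m_gt0 : (0 < m)%N) (T : {set 'I_n}) (z : subword m T) :
  exists w : word m n, restr T w = z.
Proof.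
exists [ffun i => if insub i is Some j then z j else Ordinal m_gt0].
by apply/ffunP => j; rewrite !ffunE valK.
Qed.

Lemma card_leq_E m n (m_gt0 : (0 < m)%N) t (F : {set word m n}) : (t <= n)%N ->
  ((#|F| <= m ^ (n - t))%N = (E (ind rat F) <= (m ^ t)%:R^-1)) *
  ((#|F| == m ^ (n - t))%N = (E (ind rat F) == (m ^ t)%:R^-1)).
Proof.
move=> tn; have p k : 0 < (m ^ k)%:R :> rat by rewrite ltr0n expn_gt0 m_gt0.
have -> : (m ^ t)%:R^-1 = (m ^ (n - t))%:R / (m ^ n)%:R :> rat.
  by rewrite -{2}(subnK tn) expnD natrM invfM mulrA divff ?mul1r // gt_eqF.
rewrite E_ind ler_pM2r ?invr_gt0 ?p // ler_nat; split=> //.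
by rewrite (inj_eq (mulIf _)) ?eqr_nat // invr_eq0 gt_eqF.
Qed.

Definition monomial (c k : nat) : {poly int} := c%:R *: 'X^k.

Lemma monomialE c k (t : nat) : (monomial c k).[t%:Z] = (c * t ^ k)%N%:Z.
Proof. by rewrite hornerZ hornerXn; lia. Qed.

Local Close Scope ring_scope.

Theorem theorem3 :
  exists n0 m0 : {poly int},
    forall t n m : nat,
      1 <= t ->
      (n0.[t%:Z] <= n%:Z)%R ->
      (m0.[t%:Z] <= m%:Z)%R ->
      forall F : {set word m n},
        avoiding (t - 1) F ->
        #|F| <= m ^ (n - t) /\
        (#|F| = m ^ (n - t) <->
         exists (T : {set 'I_n}) (z : subword m T),
           #|T| = t /\ F = [set x : word m n | restr T x == z]).
Proof.
have [c [d ext]] := extremal_poly rat.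
(* Raising both constants by one makes them positive, so that [0 < m] and [t <= n] follow from the
   bounds themselves. *)
exists (monomial d.+1 18), (monomial c.+1 12) => t n m t0.
rewrite !monomialE !lez_nat => nt mt F avF.
have m0 : 0 < m by apply: leq_trans mt; rewrite muln_gt0 expn_gt0 t0.
have tn : t <= n.
  by apply: leq_trans nt; rewrite -{1}[t]expn1 mulSn (leq_trans _ (leq_addr _ _)) // leq_pexp2l.
have [||le eq] := ext m n m0 t F avF t0.
- by apply: leq_trans mt; rewrite leq_mul2r leqnSn orbT.
- by apply: leq_trans nt; rewrite leq_mul2r leqnSn orbT.
rewrite (card_leq_E m0 F tn) le; split=> //; split.
  move/eqP; rewrite (card_leq_E m0 F tn) => /eqP/eq[T [w [Tt ->]]].
  by exists T, (restr T w); rewrite restr_cube.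
case=> T [z [Tt ->]]; have [w <-] := restr_surj m0 z.
by apply/eqP; rewrite restr_cube (card_leq_E m0 _ tn) E_cube // Tt natrX.
Qed.
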